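(* Consider the scalar case $N=1$ with flux $f:\mathbb{R}\to\mathbb{R}^d$. Let $u_0\in L^1\cap L^\infty(\mathbb{R}^d)$ and let $\sigma$ be a uniformly bounded Young measure from $\mathbb{R}^d$ to $\mathbb{R}$. Let $u\in L^1\cap L^\infty(\mathbb{R}^d\times\mathbb{R}_+)$ be the entropy solution of the scalar conservation law $\partial_tu+\nabla_x\cdot f(u)=0$ with initial data $u_0$. Let $\nu$ be any EMV solution of the measure-valued Cauchy problem $\partial_t\langle\nu,\mathrm{id}\rangle+\nabla_x\cdot\langle\nu,f\rangle=0$, $\nu_{(x,0)}=\sigma_x$, which satisfies $$\limsup_{T\to0}\frac1T\int_0^T\int_{\mathbb{R}^d}\langle\nu_{(x,t)},|u(x,t)-\xi|\rangle\,dx\,dt\le\int_{\mathbb{R}^d}\langle\sigma_x,|u_0(x)-\xi|\rangle\,dx .$$ Then for all $t>0$, $$\int_{\mathbb{R}^d}\langle\nu_{(x,t)},|u(x,t)-\xi|\rangle\,dx\le\int_{\mathbb{R}^d}\langle\sigma_x,|u_0(x)-\xi|\rangle\,dx,$$ or equivalently, $$\bigl\|W_1(\nu_{(\cdot,t)},\delta_{u(\cdot,t)})\bigr\|_{L^1(\mathbb{R}^d)}\le\bigl\|W_1(\sigma,\delta_{u_0})\bigr\|_{L^1(\mathbb{R}^d)} .$$ In particular, if $\sigma=\delta_{u_0}$ then $\nu=\delta_u$.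
   Context: Notation: $\mathbb{R}_+=[0,\infty)$; $\mathrm{id}(\xi)=\xi$. A Young measure from a set $D\subset\mathbb{R}^k$ to $\mathbb{R}^N$ is a map $z\mapsto \nu_z$ from $D$ to the Borel probability measures on $\mathbb{R}^N$ such that $z\mapsto\langle\nu_z,g\rangle:=\int_{\mathbb{R}^N} g(\xi)\,d\nu_z(\xi)$ is Borel measurable for every $g\in C_0(\mathbb{R}^N)$; we also write $\langle\nu_z,g(\xi)\rangle$ for $\int g(\xi)\,d\nu_z(\xi)$. It is uniformly bounded if there is a compact $K$ with $\operatorname{supp}\nu_z\subset K$ for all $z\in D$. For measurable $u$, $\delta_u$ denotes the Young measure $z\mapsto\delta_{u(z)}$. $W_1(\mu,\rho)=\inf_{\pi}\int|\xi-\zeta|\,d\pi(\xi,\zeta)$, the infimum being over probability measures $\pi$ on $\mathbb{R}\times\mathbb{R}$ with marginals $\mu,\rho$. Scalar entropy pair: $(\eta,q)$ with $\eta:\mathbb{R}\to\mathbb{R}$ convex and $q:\mathbb{R}\to\mathbb{R}^d$ with $q'=\eta'f'$. $u$ is an entropy solution with data $u_0$ if it is a weak (distributional) solution with that initial data, i.e. $\int_{\mathbb{R}_+}\int_{\mathbb{R}^d}\partial_t\varphi\,u+\nabla_x\varphi\cdot f(u)\,dx\,dt+\int_{\mathbb{R}^d}\varphi(x,0)u_0(x)\,dx=0$ for all $\varphi\in C^1_c(\mathbb{R}^d\times\mathbb{R}_+)$, and for every entropy pair and all $0\le\varphi\in C^1_c(\mathbb{R}^d\times\mathbb{R}_+)$,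 $\int_{\mathbb{R}_+}\int_{\mathbb{R}^d}\partial_t\varphi\,\eta(u)+\nabla_x\varphi\cdot q(u)\,dx\,dt+\int_{\mathbb{R}^d}\varphi(x,0)\eta(u_0(x))\,dx\ge0$. A Young measure $\nu$ from $\mathbb{R}^d\times\mathbb{R}_+$ to $\mathbb{R}$ is an EMV (entropy measure-valued) solution with initial data $\sigma$ if (1) for all $\varphi\in C_c^1(\mathbb{R}^d\times\mathbb{R}_+)$, $\int_{\mathbb{R}_+}\int_{\mathbb{R}^d}\partial_t\varphi\,\langle\nu_{(x,t)},\mathrm{id}\rangle+\nabla_x\varphi\cdot\langle\nu_{(x,t)},f\rangle\,dx\,dt+\int_{\mathbb{R}^d}\varphi(x,0)\langle\sigma_x,\mathrm{id}\rangle\,dx=0$; (2) for every entropy pair $(\eta,q)$ and all $0\le\varphi\in C_c^1(\mathbb{R}^d\times\mathbb{R}_+)$, $\int_{\mathbb{R}_+}\int_{\mathbb{R}^d}\partial_t\varphi\,\langle\nu_{(x,t)},\eta\rangle+\nabla_x\varphi\cdot\langle\nu_{(x,t)},q\rangle\,dx\,dt+\int_{\mathbb{R}^d}\varphi(x,0)\langle\sigma_x,\eta\rangle\,dx\ge0$.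
   Formalization: The flux f is taken C^1, the EMV solution ν is assumed uniformly bounded (the claim fails without it), and ''for all t>0'' is read as almost every t>0, with ν=δ_u holding for almost every (x,t), since ν and u are only determined up to null sets. *)

(* Defs.v *)
From HB Require Import structures.
From mathcomp Require Import all_boot all_order all_algebra.
From mathcomp Require Import all_classical all_reals all_analysis.
From mathcomp Require Import measurable_realfun.

Set Implicit Arguments.
Unset Strict Implicit.
Unset Printing Implicit Defensive.
Import Order.TTheory GRing.Theory Num.Theory.
Import numFieldNormedType.Exports.

Local Open Scope classical_set_scope.
Local Open Scope ring_scope.

(* The library has neither a sigma-algebra nor a Lebesgue measure on
   'rV[R]_n.  The sigma-algebra is generated by the coordinates, as for
   n.-tuple; [measurable_rVE] identifies it with the Borel one. *)

Definition measure_rV_display : measure_display.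
Proof. exact. Qed.

Section measurable_rV.
Context {R : realType} (n : nat).

Let coord : 'I_n -> 'rV[R]_n -> R := fun i v => v ord0 i.

Let rV_set0 : g_sigma_preimage coord set0.
Proof. exact: sigma_algebra0. Qed.

Let rV_setC A : g_sigma_preimage coord A -> g_sigma_preimage coord (~` A).
Proof. exact: sigma_algebraC. Qed.

Let rV_bigcup (F : (set 'rV[R]_n)^nat) : (forall i, g_sigma_preimage coord (F i)) ->
  g_sigma_preimage coord (\bigcup_i (F i)).
Proof. exact: sigma_algebra_bigcup. Qed.

HB.instance Definition _ := @isMeasurable.Build measure_rV_display
  'rV[R]_n (g_sigma_preimage coord) rV_set0 rV_setC rV_bigcup.

Lemma measurable_coord_rV (i : 'I_n) :
  measurable_fun [set: 'rV[R]_n] (fun v : 'rV[R]_n => v ord0 i).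
Proof.
move=> _ Y mY; rewrite setTI; apply: sub_sigma_algebra => /=.
rewrite -bigcup_seq/=; exists i => /=; first by rewrite mem_index_enum.
by exists Y => //; rewrite setTI.
Qed.

Lemma measurable_fun_rVP d (T : measurableType d) (f : T -> 'rV[R]_n) :
  measurable_fun [set: T] f <->
  forall i, measurable_fun [set: T] (fun x => f x ord0 i).
Proof.
split=> [mf i|mf].
  exact: (measurableT_comp (measurable_coord_rV i) mf).
have : g_sigma_preimage coord `<=` [set A | measurable (f @^-1` A)].
  apply: smallest_sub.
    split => /=.
    - by rewrite preimage_set0.
    - move=> A /= mA; rewrite setTD preimage_setC; exact: measurableC.
    - move=> F /= mF; rewrite preimage_bigcup; exact: bigcupT_measurable.
  rewrite -bigcup_seq => A/= [i _ [B mB <-]].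
  by rewrite /= setTI -[X in measurable X]setTI; exact: (mf i).
by move=> + _ A mA => /(_ A mA); rewrite setTI.
Qed.

Lemma measurable_rV_box (A : 'I_n -> set R) : (forall i, measurable (A i)) ->
  measurable [set v : 'rV[R]_n | forall i, A i (v ord0 i)].
Proof.
move=> mA; have -> : [set v : 'rV[R]_n | forall i, A i (v ord0 i)] =
    \big[setI/setT]_(i < n) ([set v : 'rV[R]_n | A i (v ord0 i)]).
  rewrite -bigcap_seq; apply/seteqP; split => [v Av i _|v Av i]; first exact: Av.
  by apply: Av => /=; rewrite mem_index_enum.
apply: bigsetI_measurable => i _.
by have := @measurable_coord_rV i measurableT _ (mA i); rewrite setTI.
Qed.

Lemma measurable_rVE :
  @measurable _ 'rV[R]_n = <<s [set A : set 'rV[R]_n | open A] >>.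
Proof.
apply/seteqP; split.
  apply: smallest_sub; first exact: smallest_sigma_algebra.
  rewrite -bigcup_seq => _ [i _ [B mB <-]]; rewrite setTI.
  suff : <<s (@RGenOInfty.G R) >> `<=`
      [set B | <<s [set A : set 'rV[R]_n | open A] >> (coord i @^-1` B)].
    by apply; move: mB; rewrite -[<<s _ >>]RGenOInfty.measurableE.
  apply: smallest_sub.
    split => /=.
    - by rewrite preimage_set0; exact: sigma_algebra0.
    - by move=> A /= mA; rewrite setTD preimage_setC; exact: sigma_algebraC.
    - by move=> F /= mF; rewrite preimage_bigcup; exact: sigma_algebra_bigcup.
  move=> _ [x ->] /=; apply: sub_sigma_algebra => /=.
  apply: open_comp; last exact: interval_open.
  by move=> v _; exact: coord_continuous.
apply: smallest_sub; first exact: sigma_algebra_measurable.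
move=> U /= oU.
pose B (p : 'rV[rat]_n * nat) : set 'rV[R]_n :=
  [set v | forall i, ball (ratr (p.1 ord0 i) : R) (p.2.+1%:R^-1) (v ord0 i)].
have -> : U = \bigcup_(p in [set p | B p `<=` U]) B p.
  apply/seteqP; split => [v Uv|v [p BU]]; last exact: BU.
  have /nbhs_ballP[e /= e0 eU] : nbhs v U by exact: open_nbhs_nbhs.
  have [k ke] : exists k : nat, k.+1%:R^-1 < e / 2.
    have [k _ kP] := near_infty_natSinv_lt (PosNum (divr_gt0 e0 (ltr0n R 2))).
    by exists k; exact: (kP k (leqnn k)).
  have k0 : (0 : R) < k.+1%:R^-1 by rewrite invr_gt0 ltr0n.
  have dns i : exists q : rat, ball (v ord0 i) (k.+1%:R^-1 : R) (ratr q).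
    have [|x [/= bx [q _ qx]]] := @dense_rat R (ball (v ord0 i) (k.+1%:R^-1 : R)) _ (@ball_open _ _ _ _).
      by exists (v ord0 i); exact: ballxx.
    by exists q; rewrite qx.
  have [q qP] := choice dns.
  exists (\row_i q i, k) => /=.
    move=> w Bw; apply: eU; split=> // i j; rewrite (ord1 i).
    have := Bw j; rewrite /= mxE => Bwj.
    apply: (@ball_split _ _ (ratr (q j) : R) (v ord0 j) (w ord0 j)).
      by apply: le_ball (qP j); exact: ltW.
    by apply: le_ball Bwj; exact: ltW.
  by move=> i /=; rewrite mxE; exact: ball_sym (qP i).
rewrite bigcup_mkcond; apply: countable_bigcupT_measurable => [|p]; first exact: countableP.
case: ifPn => _ //.
apply: (@measurable_rV_box (fun i => ball (ratr (p.1 ord0 i) : R) p.2.+1%:R^-1)).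
by move=> i; exact: measurable_ball.
Qed.

End measurable_rV.

(* Lebesgue measure on R^n, by recursion on n: R^n.+1 is R * R^n. *)
Section lebesgue_rV.
Context {R : realType}.

Definition cons_rV n (p : R * 'rV[R]_n) : 'rV[R]_n.+1 :=
  \row_i (if unlift ord0 i is Some j then p.2 ord0 j else p.1).

Definition uncons_rV n (v : 'rV[R]_n.+1) : R * 'rV[R]_n :=
  (v ord0 ord0, \row_i v ord0 (lift ord0 i)).

Lemma cons_rV0 n p : @cons_rV n p ord0 ord0 = p.1.
Proof. by rewrite mxE unlift_none. Qed.

Lemma cons_rVS n p i : @cons_rV n p ord0 (lift ord0 i) = p.2 ord0 i.
Proof. by rewrite mxE liftK. Qed.

Lemma cons_rVK n : cancel (@cons_rV n) (@uncons_rV n).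
Proof.
move=> [x v]; rewrite /uncons_rV cons_rV0; congr pair.
by apply/rowP => i; rewrite mxE cons_rVS.
Qed.

Lemma measurable_cons_rV n : measurable_fun setT (@cons_rV n).
Proof.
apply/measurable_fun_rVP => i; have [j ->|->] := unliftP ord0 i.
  rewrite [X in measurable_fun _ X](_ : _ = (fun v : 'rV[R]_n => v ord0 j) \o snd).
    exact: (measurableT_comp (measurable_coord_rV j)).
  by apply/funext => p; rewrite cons_rVS.
rewrite [X in measurable_fun _ X](_ : _ = fst) //.
by apply/funext => p; rewrite cons_rV0.
Qed.

Lemma measurable_uncons_rV n : measurable_fun setT (@uncons_rV n).
Proof.
apply: measurable_fun_pair; first exact: measurable_coord_rV.
apply/measurable_fun_rVP => i.
rewrite [X in measurable_fun _ X](_ : _ = fun v : 'rV[R]_n.+1 => v ord0 (lift ord0 i)).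
  exact: measurable_coord_rV.
by apply/funext => v; rewrite mxE.
Qed.

Section step.
Variables (n : nat) (m : {sigma_finite_measure set 'rV[R]_n -> \bar R}).

Definition lebesgue_rVS : set 'rV[R]_n.+1 -> \bar R :=
  pushforward (@lebesgue_measure R \x m)%E (@cons_rV n).

Let lebesgue_rVS0 : lebesgue_rVS set0 = 0%E.
Proof. by rewrite /lebesgue_rVS /pushforward preimage_set0 measure0. Qed.

Let lebesgue_rVS_ge0 A : (0 <= lebesgue_rVS A)%E.
Proof. by rewrite /lebesgue_rVS /pushforward measure_ge0. Qed.

Let lebesgue_rVS_sigma_additive : semi_sigma_additive lebesgue_rVS.
Proof.
have mcons A : measurable A -> measurable (@cons_rV n @^-1` A).
  by move=> mA; rewrite -[X in measurable X]setTI; exact: measurable_cons_rV.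
move=> F mF tF mUF; rewrite /lebesgue_rVS /pushforward preimage_bigcup.
apply: measure_semi_sigma_additive.
- by move=> k; exact: mcons.
- apply/trivIsetP => i j _ _ ij; rewrite -preimage_setI.
  by move/trivIsetP : tF => /(_ _ _ _ _ ij) ->//; rewrite preimage_set0.
- by rewrite -preimage_bigcup; exact: mcons.
Qed.

HB.instance Definition _ := isMeasure.Build _ _ _ lebesgue_rVS
  lebesgue_rVS0 lebesgue_rVS_ge0 lebesgue_rVS_sigma_additive.

Let lebesgue_rVS_sigma_finite : sigma_finite setT lebesgue_rVS.
Proof.
have /sigma_finiteP[F [TF ndF Foo]] := sigma_finiteT (@lebesgue_measure R).
have /sigma_finiteP[G [TG ndG Goo]] := sigma_finiteT m.
exists (fun k => @uncons_rV n @^-1` (F k `*` G k)).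
  rewrite -preimage_bigcup [X in _ @^-1` X](_ : _ = setT) ?preimage_setT//.
  rewrite -setXTT TF TG predeqE => -[x y]; split.
    by move=> [k _ []/= ? ?]; split; exists k.
  move=> [/= [i _ Fix] [k _ Gky]]; exists (maxn i k) => //; split.
  - by move: x Fix; exact/subsetPset/ndF/leq_maxl.
  - by move: y Gky; exact/subsetPset/ndG/leq_maxr.
move=> k; have [mF Fk] := Foo k; have [mG Gk] := Goo k; split.
  rewrite -[X in measurable X]setTI.
  by apply: measurable_uncons_rV => //; exact: measurableX.
rewrite /lebesgue_rVS /pushforward -comp_preimage.
rewrite (_ : _ \o _ = id) ?preimage_id; last by apply/funext => p; exact: cons_rVK.
by rewrite product_measure1E// lte_mul_pinfty// ge0_fin_numE.
Qed.

HB.instance Definition _ := Measure_isSigmaFinite.Build _ _ _ lebesgue_rVS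
  lebesgue_rVS_sigma_finite.

End step.

Fixpoint lebesgue_rV n : {sigma_finite_measure set 'rV[R]_n -> \bar R} :=
  if n is n'.+1 then lebesgue_rVS (lebesgue_rV n') else \d_(0 : 'rV[R]_0).

Lemma lebesgue_rV_box n (A : 'I_n -> set R) : (forall i, measurable (A i)) ->
  lebesgue_rV n [set v | forall i, A i (v ord0 i)] =
  (\prod_(i < n) lebesgue_measure (A i))%E.
Proof.
elim: n A => [|n IHn] A mA.
  by rewrite big_ord0 /= diracE mem_set//= => -[].
rewrite big_ord_recl -IHn//= /lebesgue_rVS /pushforward.
rewrite -product_measure1E; [|exact: mA|
  exact: (measurable_rV_box (fun i => mA (lift ord0 i)))].
apply: (f_equal (lebesgue_measure \x lebesgue_rV n)%E).
apply/seteqP; split => -[x v] /=.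
  move=> Av; split; first by have := Av ord0; rewrite cons_rV0.
  by move=> i; have := Av (lift ord0 i); rewrite cons_rVS.
move=> [Ax Av] i; have [j ->|->] := unliftP ord0 i; first by rewrite cons_rVS.
by rewrite cons_rV0.
Qed.

End lebesgue_rV.

Section conservation_law.
Context {R : realType} (d : nat).
Local Notation leb := (@lebesgue_measure R).
Local Notation lebd := (@lebesgue_rV R d).

(* R^d x R_+ ; a function on it is represented by a total function on
   'rV[R]_d * R, of which only the values at t >= 0 are ever used. *)
Definition halfspace : set ('rV[R]_d * R) := [set z | 0 <= z.2].

Section young_measure.
Context {disp} {Z : measurableType disp}.
Implicit Types (D : set Z) (nu : Z -> probability R R).

Definition C0 (g : R -> R) : Prop :=
  [/\ continuous g, g @ +oo --> (0 : R) & g @ -oo --> (0 : R)].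

Definition young_measure D nu : Prop :=
  forall g : R -> R, C0 g -> measurable_fun D (fun z => \int[nu z]_xi g xi).

Definition supp (mu : set R -> \bar R) : set R :=
  [set xi | forall U, open U -> U xi -> (0 < mu U)%E].

Definition uniformly_bounded D nu : Prop :=
  exists2 K : set R, compact K & forall z, D z -> supp (nu z) `<=` K.

Definition dirac_young (v : Z -> R) : Z -> probability R R := fun z => \d_(v z).

(* Probability measures are equal iff they agree on the Borel sets. *)
Definition same_measure (mu rho : set R -> \bar R) : Prop :=
  forall A : set R, measurable A -> mu A = rho A.

(* The vector-valued moment <nu_z, g>. *)
Definition vmoment (mu : probability R R) (g : R -> 'rV[R]_d) : 'rV[R]_d :=
  \row_i \int[mu]_xi g xi ord0 i.

End young_measure.

Definition coupling (mu rho : probability R R) (pi : probability (R * R)%type R) :=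
  forall A : set R, measurable A ->
    pi (A `*` setT) = mu A /\ pi (setT `*` A) = rho A.

Definition W1 (mu rho : probability R R) : \bar R :=
  ereal_inf [set (\int[pi]_z `|z.1 - z.2|%:E)%E | pi in coupling mu rho].

Definition dt (phi : 'rV[R]_d * R -> R) (z : 'rV[R]_d * R) : R :=
  'D_((0, 1) : 'rV[R]_d * R) phi z.

Definition grad (phi : 'rV[R]_d * R -> R) (z : 'rV[R]_d * R) : 'rV[R]_d :=
  \row_i 'D_((delta_mx ord0 i, 0) : 'rV[R]_d * R) phi z.

Definition dotrV (v w : 'rV[R]_d) : R := \sum_(i < d) v ord0 i * w ord0 i.

(* C^1_c(R^d x R_+), as the restrictions to t >= 0 of C^1_c(R^d x R); the
   functions need not vanish at t = 0. *)
Definition test_function (phi : 'rV[R]_d * R -> R) : Prop :=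
  [/\ forall z, differentiable phi z,
      forall v : 'rV[R]_d * R, continuous (fun z => 'D_v phi z) &
      compact (closure [set z | phi z != 0])].

Definition C1_flux (f : R -> 'rV[R]_d) : Prop :=
  (forall xi, derivable f xi 1) /\ continuous (derive1 f).

(* q' = eta' f'.  A convex eta need not be differentiable everywhere (e.g.
   |xi - k|), but it is so off a countable set; q is then determined up to a
   constant by its continuity and q' = eta' f' wherever eta' exists. *)
Definition entropy_pair (f : R -> 'rV[R]_d) (eta : R -> R) (q : R -> 'rV[R]_d) :=
  [/\ @convex_function R R^o setT eta, continuous q &
      forall xi, derivable eta xi 1 ->
        is_derive xi 1 q (derive1 eta xi *: derive1 f xi)].

(* int_{R_+} int_{R^d} (d_t phi a + grad phi . b) dx dt
     + int_{R^d} phi(x,0) a0(x) dx *)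
Definition weak_form (phi : 'rV[R]_d * R -> R) (a : 'rV[R]_d * R -> R)
    (b : 'rV[R]_d * R -> 'rV[R]_d) (a0 : 'rV[R]_d -> R) : R :=
  \int[leb]_(t in `[0, +oo[)
    (\int[lebd]_x (dt phi (x, t) * a (x, t) + dotrV (grad phi (x, t)) (b (x, t))))
  + \int[lebd]_x (phi (x, 0) * a0 x).

Definition entropy_solution (f : R -> 'rV[R]_d) (u0 : 'rV[R]_d -> R)
    (u : 'rV[R]_d * R -> R) : Prop :=
  (forall phi, test_function phi -> weak_form phi u (f \o u) u0 = 0) /\
  (forall eta q, entropy_pair f eta q ->
     forall phi, test_function phi -> (forall z, halfspace z -> 0 <= phi z) ->
     0 <= weak_form phi (eta \o u) (q \o u) (eta \o u0)).

Definition EMV_solution (f : R -> 'rV[R]_d) (sigma : 'rV[R]_d -> probability R R)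
    (nu : 'rV[R]_d * R -> probability R R) : Prop :=
  [/\ young_measure halfspace nu,
      forall phi, test_function phi ->
        weak_form phi (fun z => \int[nu z]_xi xi) (fun z => vmoment (nu z) f)
          (fun x => \int[sigma x]_xi xi) = 0 &
      forall eta q, entropy_pair f eta q ->
        forall phi, test_function phi -> (forall z, halfspace z -> 0 <= phi z) ->
        0 <= weak_form phi (fun z => \int[nu z]_xi eta xi)
               (fun z => vmoment (nu z) q) (fun x => \int[sigma x]_xi eta xi)].

(* int_{R^d} <mu_x, |v(x) - xi|> dx, possibly +oo *)
Definition L1_dist (mu : 'rV[R]_d -> probability R R) (v : 'rV[R]_d -> R) : \bar R :=
  (\int[lebd]_x \int[mu x]_xi `|v x - xi|%:E)%E.

(* || W_1(mu_., rho_.) ||_{L^1(R^d)} *)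
Definition W1_L1norm (mu rho : 'rV[R]_d -> probability R R) : \bar R :=
  'N[lebd]_1[(fun x => W1 (mu x) (rho x))]%E.

End conservation_law.

(* Main.v *)
Require Import Defs.
From HB Require Import structures.
From mathcomp Require Import all_boot all_order all_algebra.
From mathcomp Require Import all_classical all_reals all_analysis.
From mathcomp Require Import measurable_realfun ess_sup_inf ring lra.

Set Implicit Arguments.
Unset Strict Implicit.
Unset Printing Implicit Defensive.
Import Order.TTheory GRing.Theory Num.Theory.
Import numFieldNormedType.Exports.

Local Open Scope classical_set_scope.
Local Open Scope ring_scope.

(** The theorem is the L1 contraction of Kruzkov between an entropy solution [u]
    and an entropy measure-valued solution [nu].

    The first half is a comparison inequality.  The entropies [|xi - k|] and their
    fluxes are symmetric in [xi] and [k] ([kruzkov_sym]).  Take the inequality of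
    [nu] in the variable [z] with [k := u w], and that of [u] in the variable [w]
    with [k := xi], averaged over [xi] against [nu z]; test both with
    [psi z * mollifier e (w - z)] and add.  The derivatives of the mollifier cancel,
    since it depends on [w - z] only, and as [e] tends to 0 there remains
      d_t <nu, |u - xi|> + div <nu, sgn (u - xi) (f u - f xi)> <= 0
    on positive times ([doubling_of_variables]).  In the limit it is [u] that has
    to be compared with its translates, so that what is needed is the continuity of
    translations in L1 for bounded measurable functions
    ([bounded_vanishing_oscillation]); [nu] is never translated.

    The second half tests this inequality with a weight supported in a backward
    light cone whose speed exceeds the speed of propagation.  All the spatial terms
    are then absorbed by the shrinking of the weight, and the weighted distance is
    nonincreasing between Lebesgue points in time ([weighted_distance_monotone]).
    As the cone grows to the whole half-space, Fatou's lemma gives, for almost every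
    [t] and all [T < t],
      [T * D t <= int_0^T D s ds],
    with [D t] the integral over [x] of [<nu_(x,t), |u(x,t) - xi|>], possibly
    infinite ([total_distance_decay]).  The hypothesis at the initial time bounds
    precisely the averages [1/T int_0^T D] as [T] tends to 0, hence also [D t].

    The distance W1 to a Dirac mass is a first absolute moment ([W1_dirac]), which
    makes the two forms of the estimate one.  When [sigma] is the Dirac family at
    [u0], [D] vanishes almost everywhere, and a measure whose first absolute moment
    about a point is zero is the Dirac mass there. *)

(** * An explicit C1 bump on the line *)

Section spline.
Context {R : realType}.
Implicit Types x y e : R.

(** A quadratic bound on the remainder covers at once the regular points of a
    truncated power and its node. *)
Lemma is_derive_quadratic (g : R -> R) x l C :
  (forall h, `|h| <= 1 -> `|g (x + h) - g x - h * l| <= C * h ^+ 2) ->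
  is_derive x (1 : R) g l.
Proof.
move=> gC.
have gl : (fun h : R => h^-1 *: ((g \o shift x) (h *: (1 : R)) - g x))
    @ (0 : R)^' --> l.
  apply/cvgrPdist_le => e e0; near=> h.
  have h0 : h != 0 by near: h; exact: nbhs_dnbhs_neq.
  have hgt : 0 < `|h| by rewrite normr_gt0.
  have h1 : `|h| <= 1.
    by near: h; apply: dnbhs0_le; exact: ltr01.
  have Ch : `|h| <= e / (`|C| + 1).
    by near: h; apply: dnbhs0_le; rewrite divr_gt0// ltr_wpDl.
  have -> : l - h^-1 *: ((g \o shift x) (h *: (1 : R)) - g x) =
      - h^-1 * (g (x + h) - g x - h * l).
    rewrite /= [h *: _]mulr1 [h + x]addrC [_ *: _]mulrC; field.
    by [].
  rewrite normrM normrN normfV ler_pdivrMl//.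
  apply: (le_trans (gC h h1)).
  rewrite -[h ^+ 2]real_normK ?num_real// expr2 mulrA mulrC ler_wpM2l//.
  apply: (@le_trans _ _ ((`|C| + 1) * `|h|)).
    by rewrite ler_wpM2r//; have := ler_norm C; lra.
  by rewrite mulrC -ler_pdivlMr// ltr_wpDl.
apply: DeriveDef; first by apply/cvg_ex; exists l.
exact/cvg_lim.
Unshelve. all: by end_near. Qed.

Definition pospart x : R := Num.max x 0.

Lemma pospart_ge0 x : 0 <= pospart x. Proof. by rewrite le_max lexx orbT. Qed.

Lemma pospart_id x : 0 <= x -> pospart x = x.
Proof. by move=> x0; rewrite /pospart max_l. Qed.

Lemma pospart_eq0 x : x <= 0 -> pospart x = 0.
Proof. by move=> x0; rewrite /pospart max_r. Qed.

Lemma le_pospart x y : x <= y -> pospart x <= pospart y.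
Proof. by move=> xy; rewrite /pospart; apply: le_max2. Qed.

Lemma continuous_pospart : continuous pospart.
Proof. by move=> x; apply: continuous_max => //; exact: cst_continuous. Qed.

Lemma is_derive_pospart2 x : is_derive x (1 : R) (fun y => pospart y ^+ 2) (2 * pospart x).
Proof.
apply: (@is_derive_quadratic _ _ _ 1) => h _; rewrite mul1r.
rewrite ler_norml /pospart.
have := sqr_ge0 h; have [xh|xh] := leP (x + h) 0; have [x0|x0] := leP x 0; nra.
Qed.

Lemma is_derive_pospart3 x :
  is_derive x (1 : R) (fun y => pospart y ^+ 3) (3 * pospart x ^+ 2).
Proof.
apply: (@is_derive_quadratic _ _ _ (3 * `|x| + 1)) => h.
rewrite !ler_norml => /andP[h1 h2] /=; rewrite /pospart.
have h20 := sqr_ge0 h; have [xh|xh] := leP (x + h) 0; have [x0|x0] := leP x 0.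
- by rewrite ler0_norm//; nra.
- rewrite gtr0_norm//.
  have -> : 0 ^+ 3 - x ^+ 3 - h * (3 * x ^+ 2) = x ^+ 2 * (- x - 3 * h) by ring.
  have x20 := sqr_ge0 x.
  have : x ^+ 2 * (- x - 3 * h) <= 3 * (x * h ^+ 2).
    have : 0 <= x * ((- h) * (- h - x)) by rewrite !mulr_ge0//; lra.
    have : 0 <= x ^+ 2 * x by rewrite mulr_ge0// ltW.
    by lra.
  have : 0 <= x ^+ 2 * (- x - 3 * h) by rewrite mulr_ge0//; lra.
  have : 0 <= x * h ^+ 2 by rewrite mulr_ge0// ltW.
  by lra.
- rewrite ler0_norm//.
  have : (x + h) ^+ 3 <= h ^+ 2 * 1.
    have xh2 : (x + h) ^+ 2 <= h ^+ 2 by nra.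
    rewrite exprSr; apply: ler_pM; [exact: sqr_ge0|exact: ltW|exact: xh2|lra].
  have : 0 <= (x + h) ^+ 3 by rewrite exprn_ge0// ltW.
  by nra.
- rewrite gtr0_norm//.
  have -> : (x + h) ^+ 3 - x ^+ 3 - h * (3 * x ^+ 2) = h ^+ 2 * (3 * x + h) by ring.
  by nra.
Qed.

(** The quadratic B-spline with nodes 0, 1, 2, 3.  It is C1, has compact support and
    unit mass; written with truncated powers, its derivative and its primitive are
    explicit, and what is needed about them reduces to polynomial inequalities
    between consecutive nodes. *)
Definition bspline x : R := (pospart x ^+ 2 - 3 * pospart (x - 1) ^+ 2
  + 3 * pospart (x - 2) ^+ 2 - pospart (x - 3) ^+ 2) / 2.

Definition dbspline x : R := pospart x - 3 * pospart (x - 1)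
  + 3 * pospart (x - 2) - pospart (x - 3).

Definition bspline_prim x : R := (pospart x ^+ 3 - 3 * pospart (x - 1) ^+ 3
  + 3 * pospart (x - 2) ^+ 3 - pospart (x - 3) ^+ 3) / 6.

Lemma is_derive_scale_arg (g : R -> R) (a b x l : R) :
  is_derive (a * x + b) (1 : R) g l ->
  is_derive x (1 : R) (fun y => g (a * y + b)) (a * l).
Proof.
move=> gl; have dg : is_derive x (1 : R) (fun y : R => a * y + b) a.
  apply: (@is_derive_quadratic _ _ _ 0) => h _.
  rewrite mul0r (_ : _ - _ - _ = 0) ?normr0//; ring.
by rewrite mulrC; exact: (@is_derive1_comp _ g (fun y => a * y + b)).
Qed.

Lemma is_derive_comp_shift (g : R -> R) a x l :
  is_derive (x - a) (1 : R) g l -> is_derive x (1 : R) (fun y => g (y - a)) l.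
Proof.
move=> gl; have := @is_derive_scale_arg g 1 (- a) x l; rewrite !mul1r => /(_ gl).
by under eq_fun do rewrite mul1r.
Qed.

Lemma is_derive_bspline x : is_derive x (1 : R) bspline (dbspline x).
Proof.
have d0 := is_derive_pospart2 x.
have d1 := is_derive_comp_shift (is_derive_pospart2 (x - 1)).
have d2 := is_derive_comp_shift (is_derive_pospart2 (x - 2)).
have d3 := is_derive_comp_shift (is_derive_pospart2 (x - 3)).
rewrite (_ : bspline = 2^-1 *: ((fun y => pospart y ^+ 2)
  - 3 *: (fun y => pospart (y - 1) ^+ 2) + 3 *: (fun y => pospart (y - 2) ^+ 2)
  - (fun y => pospart (y - 3) ^+ 2))); last first.
  by apply/funext => y; rewrite /bspline mulrC.
apply: is_derive_eq; rewrite /dbspline /GRing.scale/=; lra.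
Qed.

Lemma is_derive_bspline_prim x : is_derive x (1 : R) bspline_prim (bspline x).
Proof.
have d0 := is_derive_pospart3 x.
have d1 := is_derive_comp_shift (is_derive_pospart3 (x - 1)).
have d2 := is_derive_comp_shift (is_derive_pospart3 (x - 2)).
have d3 := is_derive_comp_shift (is_derive_pospart3 (x - 3)).
rewrite (_ : bspline_prim = 6^-1 *: ((fun y => pospart y ^+ 3)
  - 3 *: (fun y => pospart (y - 1) ^+ 3) + 3 *: (fun y => pospart (y - 2) ^+ 3)
  - (fun y => pospart (y - 3) ^+ 3))); last first.
  by apply/funext => y; rewrite /bspline_prim mulrC.
apply: is_derive_eq; rewrite /bspline /GRing.scale/=; lra.
Qed.

Lemma continuous_dbspline : continuous dbspline.
Proof.
have cs a : continuous (fun y : R => pospart (y - a)).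
  move=> y; apply: (@continuous_comp _ _ _ (fun y => y - a) pospart).
    by apply: cvgB => //; exact: cvg_cst.
  exact: continuous_pospart.
move=> x; apply: cvgB; last exact: cs.
apply: cvgD; last by apply: cvgM; [exact: cvg_cst|exact: cs].
apply: cvgB; first exact: continuous_pospart.
by apply: cvgM; [exact: cvg_cst|exact: cs].
Qed.

Lemma bspline_ge0 x : 0 <= bspline x.
Proof.
rewrite /bspline /pospart; have [x0|x0] := leP x 0; have [x1|x1] := leP (x - 1) 0;
  have [x2|x2] := leP (x - 2) 0; have [x3|x3] := leP (x - 3) 0; nra.
Qed.

Lemma bspline_le1 x : bspline x <= 1.
Proof.
rewrite /bspline /pospart; have [x0|x0] := leP x 0; have [x1|x1] := leP (x - 1) 0;
  have [x2|x2] := leP (x - 2) 0; have [x3|x3] := leP (x - 3) 0; nra.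
Qed.

Lemma bspline_out x : x <= 0 \/ 3 <= x -> bspline x = 0.
Proof.
case=> x03; rewrite /bspline.
  by rewrite !pospart_eq0; lra.
by rewrite !pospart_id; lra.
Qed.

Lemma bspline_prim_le0 x : x <= 0 -> bspline_prim x = 0.
Proof.
by move=> x0; rewrite /bspline_prim !pospart_eq0; lra.
Qed.

Lemma bspline_prim_ge3 x : 3 <= x -> bspline_prim x = 1.
Proof.
by move=> x0; rewrite /bspline_prim !pospart_id; lra.
Qed.

Lemma le_bspline_prim x y : x <= y -> bspline_prim x <= bspline_prim y.
Proof.
rewrite le_eqVlt => /predU1P[->//|xy].
apply: (@ger0_derive1_le_cc _ bspline_prim x y) => //.
- move=> z _; by have [] := is_derive_bspline_prim z.
- move=> z _; rewrite derive1E (@derive_val _ _ _ _ _ _ _ (is_derive_bspline_prim z)).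
  exact: bspline_ge0.
- apply: continuous_subspaceT => z.
  apply: differentiable_continuous; apply/derivable1_diffP.
  by have [] := is_derive_bspline_prim z.
- by rewrite in_itv/= lexx ltW.
- by rewrite in_itv/= lexx ltW.
- exact: ltW.
Qed.

(** The B-spline contracted to [0, 3 e], normalised to unit mass. *)
Definition spline_bump e x : R := e^-1 * bspline (e^-1 * x).

Definition dspline_bump e x : R := e^-1 * (e^-1 * dbspline (e^-1 * x)).

Lemma spline_bump_ge0 e x : 0 < e -> 0 <= spline_bump e x.
Proof. by move=> e0; rewrite /spline_bump mulr_ge0 ?bspline_ge0// invr_ge0 ltW. Qed.

Lemma spline_bump_out e x : 0 < e -> x <= 0 \/ 3 * e <= x -> spline_bump e x = 0.
Proof.
move=> e0 h; rewrite /spline_bump bspline_out ?mulr0//.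
by case: h => h; [left|right]; rewrite ?pmulr_rle0 ?invr_gt0// mulrC ler_pdivlMr.
Qed.

Lemma is_derive_spline_bump e x : is_derive x (1 : R) (spline_bump e) (dspline_bump e x).
Proof.
have := @is_derive_scale_arg bspline e^-1 0 x _ (is_derive_bspline _) => h.
rewrite /dspline_bump -[X in dbspline X]addr0 (_ : spline_bump e = e^-1 *: (fun y => bspline (e^-1 * y + 0))); last first.
  by apply/funext => y; rewrite /spline_bump -[e^-1 * y]addr0.
exact: is_deriveZ.
Qed.

Lemma continuous_spline_bump e : continuous (spline_bump e).
Proof.
move=> x; apply: differentiable_continuous; apply/derivable1_diffP.
by have [] := is_derive_spline_bump e x.
Qed.

Lemma continuous_dspline_bump e : continuous (dspline_bump e).
Proof.
move=> x; rewrite /dspline_bump; apply: cvgM; first exact: cvg_cst.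
apply: cvgM; first exact: cvg_cst.
apply: (@continuous_comp _ _ _ (fun y => e^-1 * y) dbspline).
  by apply: cvgM => //; exact: cvg_cst.
exact: continuous_dbspline.
Qed.

Lemma integral_compactly_supported_derivative (F f : R -> R) a b : a < b ->
  (forall x, is_derive x (1 : R) F (f x)) -> continuous f ->
  (forall x, x \notin `[a, b] -> f x = 0) ->
  (\int[lebesgue_measure]_x (f x)%:E = (F b - F a)%:E)%E.
Proof.
move=> ab Ff cf f0.
have cF : continuous F.
  by move=> x; apply: differentiable_continuous; apply/derivable1_diffP; have [] := Ff x.
transitivity (\int[lebesgue_measure]_(x in `[a, b]) (f x)%:E)%E.
  rewrite [RHS]integral_mkcond; apply: eq_integral => x _; rewrite patchE.
  by case: ifPn => //; rewrite mem_setE => /f0 ->.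
rewrite EFinB; apply: (continuous_FTC2 ab).
- exact: continuous_subspaceT.
- split.
  + by move=> x _; have [] := Ff x.
  + by apply: cvg_at_right_filter; exact: cF.
  + by apply: cvg_at_left_filter; exact: cF.
- by move=> x _; rewrite derive1E; have [] := Ff x.
Qed.

Lemma integral_spline_bump e x : 0 < e ->
  (\int[lebesgue_measure]_y (spline_bump e (y - x))%:E = 1)%E.
Proof.
move=> e0; transitivity ((bspline_prim 3 - bspline_prim 0)%:E); last first.
  by rewrite bspline_prim_ge3// bspline_prim_le0// subr0.
have -> : bspline_prim 3 = bspline_prim (e^-1 * (x + 3 * e) + - (e^-1 * x)).
  by congr bspline_prim; field; rewrite gt_eqF.
have -> : bspline_prim 0 = bspline_prim (e^-1 * x + - (e^-1 * x)) by rewrite subrr.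
apply: (@integral_compactly_supported_derivative
    (fun y => bspline_prim (e^-1 * y + - (e^-1 * x)))).
- by rewrite ltrDl mulr_gt0.
- move=> y; rewrite /spline_bump mulrBr; apply: is_derive_scale_arg.
  exact: is_derive_bspline_prim.
- move=> y; apply: (@continuous_comp _ _ _ (fun y => y - x) (spline_bump e)).
    by apply: cvgB => //; exact: cvg_cst.
  exact: continuous_spline_bump.
- move=> y; rewrite in_itv/= negb_and -!ltNge => /orP yx.
  by apply: spline_bump_out => //; case: yx => ?; [left|right]; lra.
Qed.

Lemma integral_spline_bump_reflected e y : 0 < e ->
  (\int[lebesgue_measure]_x (spline_bump e (y - x))%:E = 1)%E.
Proof.
move=> e0; transitivity ((- bspline_prim 0 - - bspline_prim 3)%:E); last first.
  by rewrite (bspline_prim_le0 (lexx 0)) bspline_prim_ge3// opprK oppr0 add0r.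
have -> : bspline_prim 3 = bspline_prim (- e^-1 * (y - 3 * e) + e^-1 * y).
  by congr bspline_prim; field; rewrite gt_eqF.
have -> : bspline_prim 0 = bspline_prim (- e^-1 * y + e^-1 * y).
  by rewrite mulNr addNr.
apply: (@integral_compactly_supported_derivative
    (- (fun x => bspline_prim (- e^-1 * x + e^-1 * y)))).
- by rewrite gtrBl mulr_gt0.
- move=> x.
  have -> : spline_bump e (y - x) = - (- e^-1 * bspline (- e^-1 * x + e^-1 * y)).
    rewrite /spline_bump mulNr opprK; congr (_ * bspline _); ring.
  by apply: is_deriveN; apply: is_derive_scale_arg; exact: is_derive_bspline_prim.
- move=> x; apply: (@continuous_comp _ _ _ (fun x => y - x) (spline_bump e)).
    by apply: cvgB => //; exact: cvg_cst.
  exact: continuous_spline_bump.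
- move=> x; rewrite in_itv/= negb_and -!ltNge => /orP yx.
  by apply: spline_bump_out => //; case: yx => ?; [right|left]; lra.
Qed.

End spline.

(** * Real functions of class C1 *)

Section C1.
Context {R : realType} {V : normedModType R}.
Implicit Types (g h : V -> R) (z v a : V).

(** The regularity that test functions have: differentiability together with
    continuous directional derivatives. *)
Definition C1 g : Prop :=
  (forall z, differentiable g z) /\ forall v, continuous (fun z => 'D_v g z).

Lemma C1_is_derive g z v : C1 g -> is_derive z v g ('D_v g z).
Proof. by move=> [dg _]; apply: DeriveDef => //; exact: diff_derivable. Qed.

Lemma C1_continuous g : C1 g -> continuous g.
Proof. by move=> [dg _] z; exact: differentiable_continuous. Qed.

(** Turns a formula for all the directional derivatives into C1 regularity. *)
Lemma C1_intro g (dg : V -> V -> R) : (forall z, differentiable g z) ->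
  (forall v z, is_derive z v g (dg v z)) -> (forall v, continuous (dg v)) -> C1 g.
Proof.
move=> ? gdg cdg; split=> // v; rewrite (_ : (fun z => _) = dg v) //.
by apply/funext => z; have [_ ->] := gdg v z.
Qed.

Lemma C1_cst (c : R) : C1 (fun=> c).
Proof.
apply: (@C1_intro _ (fun _ _ => 0)) => [z|v z].
- exact: differentiable_cst.
- exact: cvg_cst.
Qed.

Lemma deriveD_C1 g h z v : C1 g -> C1 h ->
  'D_v (fun y => g y + h y) z = 'D_v g z + 'D_v h z.
Proof.
move=> Cg Ch; have [] // := is_deriveD (C1_is_derive z v Cg) (C1_is_derive z v Ch).
Qed.

Lemma deriveM_C1 g h z v : C1 g -> C1 h ->
  'D_v (fun y => g y * h y) z = g z * 'D_v h z + h z * 'D_v g z.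
Proof.
move=> Cg Ch; have [] // := is_deriveM (C1_is_derive z v Cg) (C1_is_derive z v Ch).
Qed.

Lemma C1_add g h : C1 g -> C1 h -> C1 (fun z => g z + h z).
Proof.
move=> Cg Ch; apply: (@C1_intro _ (fun v z => 'D_v g z + 'D_v h z)).
- by move=> z; apply: differentiableD; [exact: Cg.1|exact: Ch.1].
- by move=> v z; apply: (@is_deriveD _ _ _ g h); exact: C1_is_derive.
- by move=> v z; apply: cvgD; [exact: Cg.2|exact: Ch.2].
Qed.

Lemma C1_mul g h : C1 g -> C1 h -> C1 (fun z => g z * h z).
Proof.
move=> Cg Ch; apply: (@C1_intro _ (fun v z => g z * 'D_v h z + h z * 'D_v g z)).
- by move=> z; apply: differentiableM; [exact: Cg.1|exact: Ch.1].
- by move=> v z; apply: (@is_deriveM _ _ g h); exact: C1_is_derive.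
- have cg := C1_continuous Cg; have ch := C1_continuous Ch.
  move=> v z; apply: cvgD; apply: cvgM.
  + exact: cg.
  + exact: Ch.2.
  + exact: ch.
  + exact: Cg.2.
Qed.

Lemma is_derive_comp_real (k : R -> R) g z v (l : R) : C1 g ->
  is_derive (g z) (1 : R) k l -> is_derive z v (fun y => k (g y)) (l * 'D_v g z).
Proof.
move=> Cg kl; have dg := Cg.1 z.
have dk : differentiable k (g z) by apply/derivable1_diffP; have [] := kl.
apply: DeriveDef; first by apply: diff_derivable; exact: differentiable_comp.
rewrite (deriveE _ (differentiable_comp dg dk)) diff_comp//= -[X in 'd k _ X]mulr1.
rewrite [X in 'd k _ X](_ : _ = 'd g z v *: (1 : R))// linearZ/= -!deriveE//.
by have [_ ->] := kl; rewrite mulrC.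
Qed.

Lemma C1_comp_real (k dk : R -> R) g : (forall x, is_derive x (1 : R) k (dk x)) ->
  continuous dk -> C1 g -> C1 (fun z => k (g z)).
Proof.
move=> kdk cdk Cg; apply: (@C1_intro _ (fun v z => dk (g z) * 'D_v g z)).
- move=> z; apply: differentiable_comp; first exact: Cg.1.
  by apply/derivable1_diffP; have [] := kdk (g z).
- by move=> v z; exact: is_derive_comp_real.
- move=> v z; apply: cvgM; last exact: Cg.2.
  apply: (@continuous_comp _ _ _ g dk); last exact: cdk.
  exact: C1_continuous.
Qed.

Lemma C1_sum (I : Type) (r : seq I) (F : I -> V -> R) : (forall i, C1 (F i)) ->
  C1 (fun z => \sum_(i <- r) F i z).
Proof.
move=> CF; elim: r => [|i r IH].
  by under eq_fun do rewrite big_nil; exact: C1_cst.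
by under eq_fun do rewrite big_cons; exact: C1_add.
Qed.

Lemma C1_prod (I : Type) (r : seq I) (F : I -> V -> R) : (forall i, C1 (F i)) ->
  C1 (fun z => \prod_(i <- r) F i z).
Proof.
move=> CF; elim: r => [|i r IH].
  by under eq_fun do rewrite big_nil; exact: C1_cst.
by under eq_fun do rewrite big_cons; exact: C1_mul.
Qed.

Lemma derive_sum_C1 (I : Type) (r : seq I) (F : I -> V -> R) z v :
  (forall i, C1 (F i)) ->
  'D_v (fun z => \sum_(i <- r) F i z) z = \sum_(i <- r) 'D_v (F i) z.
Proof.
move=> CF; elim: r => [|i r IH].
  by under eq_fun do rewrite big_nil; rewrite big_nil derive_cst.
under eq_fun do rewrite big_cons.
by rewrite deriveD_C1//; [rewrite IH big_cons|exact: C1_sum].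
Qed.

Lemma linear_is_derive (l : V -> R) z v : linear l -> is_derive z v l (l v).
Proof.
move=> lin.
have E : (fun h : R => h^-1 *: ((l \o shift z) (h *: v) - l z)) @ (0 : R)^' --> l v.
  apply: cvg_near_cst; near=> h.
  have h0 : h != 0 by near: h; exact: nbhs_dnbhs_neq.
  by rewrite /= lin addrK scalerA mulVf// scale1r.
by apply: DeriveDef; [apply/cvg_ex; exists (l v)|exact/cvg_lim].
Unshelve. all: by end_near. Qed.

Lemma C1_linear (l : V -> R) : linear l -> continuous l -> C1 l.
Proof.
move=> lin cl; apply: (@C1_intro _ (fun v _ => l v)) => [z|v z|v z].
- pose lM := GRing.isLinear.Build _ _ _ _ l lin.
  pose lL : {linear _ -> _} := HB.pack l lM.
  rewrite (_ : l = lL) //; exact: linear_differentiable.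
- exact: linear_is_derive.
- exact: cvg_cst.
Qed.

Lemma is_derive_translate g a z v (l : R) :
  is_derive (z - a) v g l -> is_derive z v (fun y => g (y - a)) l.
Proof.
have E : (fun h : R => h^-1 *: (((fun y => g (y - a)) \o shift z) (h *: v) - g (z - a)))
    = (fun h : R => h^-1 *: ((g \o shift (z - a)) (h *: v) - g (z - a))).
  by apply/funext => h /=; rewrite addrA.
move=> [dg <-]; apply: DeriveDef; last by rewrite /derive E.
by move: dg; rewrite /derivable E.
Qed.

Lemma is_derive_reflect g a z v (l : R) :
  is_derive (a - z) (- v) g l -> is_derive z v (fun y => g (a - y)) l.
Proof.
have E : (fun h : R => h^-1 *: (((fun y => g (a - y)) \o shift z) (h *: v) - g (a - z)))
    = (fun h : R => h^-1 *: ((g \o shift (a - z)) (h *: - v) - g (a - z))).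
  by apply/funext => h /=; rewrite scalerN opprD addrCA addrC addrAC addrC.
move=> [dg <-]; apply: DeriveDef; last by rewrite /derive E.
by move: dg; rewrite /derivable E.
Qed.

Lemma derive_opp_dir g z v : C1 g -> 'D_(- v) g z = - 'D_v g z.
Proof.
by move=> [dg _]; rewrite !deriveE// linearN.
Qed.

Lemma derive_translate g a z v : C1 g ->
  'D_v (fun y => g (y - a)) z = 'D_v g (z - a).
Proof.
by move=> Cg; have [] := is_derive_translate (C1_is_derive (z - a) v Cg).
Qed.

Lemma derive_reflect g a z v : C1 g ->
  'D_v (fun y => g (a - y)) z = - 'D_v g (a - z).
Proof.
move=> Cg; rewrite -derive_opp_dir//.
by have [] := is_derive_reflect (C1_is_derive (a - z) (- v) Cg).
Qed.

Lemma C1_translate g a : C1 g -> C1 (fun z => g (z - a)).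
Proof.
move=> Cg; apply: (@C1_intro _ (fun v z => 'D_v g (z - a))).
- move=> z; apply: (@differentiable_comp _ _ _ _ (fun y => y - a) g); last exact: Cg.1.
  by apply: differentiableB => //; exact: differentiable_cst.
- by move=> v z; apply: is_derive_translate; exact: C1_is_derive.
- move=> v z; apply: (@continuous_comp _ _ _ (fun y => y - a) (fun z => 'D_v g z)).
    by apply: cvgB => //; exact: cvg_cst.
  exact: Cg.2.
Qed.

Lemma C1_reflect g a : C1 g -> C1 (fun z => g (a - z)).
Proof.
move=> Cg; apply: (@C1_intro _ (fun v z => 'D_(- v) g (a - z))).
- move=> z; apply: (@differentiable_comp _ _ _ _ (fun y => a - y) g); last exact: Cg.1.
  by apply: differentiableB => //; exact: differentiable_cst.
- by move=> v z; apply: is_derive_reflect; exact: C1_is_derive.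
- move=> v z; apply: (@continuous_comp _ _ _ (fun y => a - y) (fun z => 'D_(- v) g z)).
    by apply: cvgB => //; exact: cvg_cst.
  exact: Cg.2.
Qed.

End C1.

(** * Space-time *)

(** Lebesgue measure on space-time, under a name of its own so that it can carry
    a sigma-finite structure. *)
Definition space_time_measure {R : realType} d :
  set ('rV[R]_d * measurableTypeR R)%type -> \bar R :=
  (@lebesgue_rV R d \x @lebesgue_measure R)%E.

HB.instance Definition _ (R : realType) d := Measure.on (@space_time_measure R d).

Section space_time.
Context {R : realType} (d : nat).
Local Notation Z := ('rV[R]_d * measurableTypeR R)%type.
Local Notation mu := (@space_time_measure R d).
Implicit Types (z w v : Z) (phi psi : Z -> R) (r e : R).

Definition cbox r : set Z := [set z : Z | (forall i, `|z.1 ord0 i| <= r) /\ `|z.2| <= r].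

Lemma cboxE r : cbox r =
  [set x : 'rV[R]_d | forall i, `[- r, r]%classic (x ord0 i)] `*` `[- r, r]%classic.
Proof.
apply/seteqP; split=> -[x t]; rewrite /cbox/= in_itv/= -ler_norml => -[xr tr]; split=> // i.
  by have := xr i; rewrite in_itv/= -ler_norml.
by have := xr i; rewrite in_itv/= -ler_norml.
Qed.

Lemma measurable_cbox r : measurable (cbox r).
Proof.
rewrite cboxE; apply: measurableX => //.
exact: (@measurable_rV_box R d (fun=> `[- r, r]%classic)).
Qed.

Lemma cbox_lty r : (mu (cbox r) < +oo)%E.
Proof.
rewrite cboxE /space_time_measure product_measure1E//; last exact: (@measurable_rV_box R d (fun=> `[- r, r]%classic)).
have fin : lebesgue_measure (`[- r, r]%classic : set R) \is a fin_num.
  by rewrite lebesgue_measure_itv/=; case: ifP.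
rewrite ltey_eq fin_numM//.
have mI (i : 'I_d) : measurable (`[- r, r]%classic : set R) by [].
have := @lebesgue_rV_box R d (fun=> `[- r, r]%classic) mI.
by move=> /= ->; rewrite prode_fin_num.
Qed.

Let space_time_sigma_finite : sigma_finite setT mu.
Proof.
exists (fun n => cbox n%:R).
  apply/seteqP; split=> // z _; have [n zn] : exists n : nat, `|z| <= n%:R.
    by exists (Num.truncn `|z|).+1; apply: ltW; exact: truncnS_gt.
  exists n => //; move: zn; rewrite prod_normE ge_max => /andP[z1 z2]; split=> // i.
  apply: le_trans z1; rewrite /Num.norm/= mx_normrE.
  exact: (le_trans _ (le_bigmax _ _ (ord0, i))).
by move=> n; split; [exact: measurable_cbox|exact: cbox_lty].
Qed.

HB.instance Definition _ := Measure_isSigmaFinite.Build _ _ _ mu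
  space_time_sigma_finite.

Lemma compact_cbox r : compact (cbox r).
Proof.
rewrite cboxE; apply: compact_setX; last exact: segment_compact.
apply: (@rV_compact R d (fun=> `[- r, r]%classic)) => i; exact: segment_compact.
Qed.

Lemma le_cbox r r' : r <= r' -> cbox r `<=` cbox r'.
Proof. by move=> rr' z [z1 z2]; split=> [i|]; apply: le_trans rr'. Qed.

Lemma compact_sub_cbox (K : set Z) : compact K -> exists2 r, 0 <= r & K `<=` cbox r.
Proof.
move=> /compact_bounded[M [_ KM]]; exists (`|M| + 1); first by rewrite addr_ge0.
move=> z Kz; have : `|z| <= `|M| + 1 by apply: KM => //; rewrite (le_lt_trans (ler_norm _))// ltrDl.
rewrite prod_normE ge_max => /andP[z1 z2]; split=> // i; apply: le_trans z1.
by rewrite /Num.norm/= mx_normrE; apply: (le_trans _ (le_bigmax _ _ (ord0, i))).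
Qed.

(** Space-time carries the product sigma-algebra.  Exchanging the factors maps it
    to the row vectors of length [d.+1], whose sigma-algebra is the Borel one. *)
Lemma continuous_measurable_space_time phi : continuous phi -> measurable_fun setT phi.
Proof.
move=> cphi.
pose sw (p : R * 'rV[R]_d) : Z := (p.2, p.1).
pose g : 'rV[R]_d.+1 -> R := phi \o (sw \o @uncons_rV R d).
have cg : continuous g.
  move=> v; apply: (@continuous_comp _ _ _ (sw \o @uncons_rV R d) phi); last exact: cphi.
  have c1 : (fun v : 'rV[R]_d.+1 => v ord0 ord0) @ v --> v ord0 ord0.
    exact: coord_continuous.
  have c2 : (fun v : 'rV[R]_d.+1 => \row_i v ord0 (lift ord0 i) : 'rV[R]_d) @ v
      --> (\row_i v ord0 (lift ord0 i) : 'rV[R]_d).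
    have -> : (fun v : 'rV[R]_d.+1 => \row_i v ord0 (lift ord0 i) : 'rV[R]_d) =
        (fun v : 'rV[R]_(1 + d) => rsubmx v).
      apply/funext => w; apply/rowP => i; rewrite !mxE; congr (w _ _); exact: val_inj.
    have -> : (\row_i v ord0 (lift ord0 i) : 'rV[R]_d) = rsubmx (v : 'rV[R]_(1 + d)).
      apply/rowP => i; rewrite !mxE; congr (v _ _); exact: val_inj.
    exact: (differentiable_continuous (differentiable_rsubmx (v : 'rV[R]_(1 + d)))).
  exact: (cvg_pair c2 c1).
have -> : phi = g \o @cons_rV R d \o (fun z : Z => (z.2, z.1)).
  by apply/funext => -[x t]; rewrite /g /= cons_rVK.
apply: measurableT_comp; last exact: measurable_fun_pair.
apply: measurableT_comp; last exact: measurable_cons_rV.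
apply: (measurability _ (RGenOInfty.measurableE R)) => _ [_ [a ->] <-].
rewrite setTI measurable_rVE; apply: sub_sigma_algebra => /=.
by apply: open_comp => //; exact: interval_open.
Unshelve. all: by end_near. Qed.

(** Compact support, in a form stable under products, translations and derivatives. *)
Definition vanishes_off r phi : Prop := forall z, ~ cbox r z -> phi z = 0.

Lemma closed_cbox r : closed (cbox r).
Proof. by apply: compact_closed; [exact: norm_hausdorff|exact: compact_cbox]. Qed.

Lemma derive_local0 (U : set Z) phi z v : open U ->
  (forall y, U y -> phi y = 0) -> U z -> 'D_v phi z = 0.
Proof.
move=> oU U0 Uz; have nU : nbhs z U by exact: open_nbhs_nbhs.
rewrite (@near_eq_derive _ _ _ phi (cst 0) z v); first by rewrite derive_cst.
by near=> y; rewrite U0//; near: y.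
Unshelve. all: by end_near. Qed.

Lemma vanishes_off_derive r phi v : vanishes_off r phi ->
  vanishes_off r (fun z => 'D_v phi z).
Proof.
move=> phi0 z nz; apply: (@derive_local0 (~` cbox r)) => //.
exact/closed_openC/closed_cbox.
Qed.

Lemma derive_negative_time phi z v : (forall z, z.2 <= 0 -> phi z = 0) ->
  z.2 < 0 -> 'D_v phi z = 0.
Proof.
move=> phi0 z0; apply: (@derive_local0 [set z : Z | z.2 < 0]) => //.
  have -> : [set z : Z | z.2 < 0] = snd @^-1` [set t : R | t < 0] by [].
  by apply: open_comp; [move=> y _; exact: cvg_snd|exact: open_lt].
by move=> y /ltW; exact: phi0.
Qed.

Lemma C1_test_function r phi : C1 phi -> vanishes_off r phi -> test_function phi.
Proof.
move=> [dphi cphi] phi0; split=> //.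
apply: (subclosed_compact _ (@compact_cbox r)); first exact: closed_closure.
rewrite [X in _ `<=` X]((closure_id _).1 (@closed_cbox r)).
by apply: closure_subset => z /=; apply: contra_neqP => /phi0.
Qed.

Lemma test_function_C1 phi : test_function phi ->
  C1 phi /\ exists2 r, 0 <= r & vanishes_off r phi.
Proof.
move=> [dphi cphi /compact_sub_cbox[r r0 Kr]]; split => //.
exists r => // z nz; apply/eqP/negPn/negP => pz; apply: nz; apply: Kr.
exact: subset_closure.
Qed.

Lemma vanishes_off_bounded r phi : continuous phi -> vanishes_off r phi ->
  exists2 C, 0 <= C & forall z, `|phi z| <= C.
Proof.
move=> cphi phi0.
have /compact_bounded[M [_ KM]] : compact (phi @` cbox r).
  by apply: continuous_compact; [exact: continuous_subspaceT|exact: compact_cbox].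
exists (`|M| + 1); first by rewrite addr_ge0.
move=> z; have [zr|/phi0 ->] := pselect (cbox r z); last by rewrite normr0 addr_ge0.
by apply: KM; [rewrite (le_lt_trans (ler_norm _))// ltrDl|exists z].
Qed.

(** * The mollifier *)

Lemma C1_coord (i : 'I_d) : C1 (fun z : Z => z.1 ord0 i).
Proof.
apply: C1_linear; first by move=> a z w /=; rewrite !mxE.
move=> z; apply: (@continuous_comp _ _ _ (fun z : Z => z.1) (fun x => x ord0 i)).
  exact: cvg_fst.
exact: coord_continuous.
Qed.

Lemma C1_time : C1 (fun z : Z => z.2).
Proof. by apply: C1_linear => // z; exact: cvg_snd. Qed.

(** A product of one-dimensional bumps, so that its integral splits by Tonelli. *)
Definition mollifier e z : R := (\prod_(i < d) spline_bump e (z.1 ord0 i)) * spline_bump e z.2.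

Lemma C1_mollifier e : C1 (mollifier e).
Proof.
have Cb (g : Z -> R) : C1 g -> C1 (fun z => spline_bump e (g z)).
  apply: (@C1_comp_real _ _ (spline_bump e) (dspline_bump e)); first exact: is_derive_spline_bump.
  exact: continuous_dspline_bump.
apply: C1_mul; last exact/Cb/C1_time.
by apply: C1_prod => i; exact/Cb/C1_coord.
Qed.

Lemma mollifier_ge0 e z : 0 < e -> 0 <= mollifier e z.
Proof. by move=> e0; rewrite mulr_ge0 ?spline_bump_ge0// prodr_ge0// => i _; exact: spline_bump_ge0. Qed.

(** The mollifier is one-sided.  In time, this keeps [psi z * mollifier e (w - z)]
    supported in positive times in [w] as soon as [psi] is; in general, it makes each
    coordinate of [w] exceed that of [z]. *)
Lemma mollifier_neq0 e z : 0 < e -> mollifier e z != 0 ->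
  (forall i, 0 < z.1 ord0 i < 3 * e) /\ 0 < z.2 < 3 * e.
Proof.
move=> e0; rewrite mulf_eq0 negb_or => /andP[/prodf_neq0 n1 n2]; split=> [i|].
- apply/negP => h; have /negP := n1 i isT; apply; apply/eqP; apply: spline_bump_out => //.
  by move: h => /negP; rewrite negb_and -!leNgt => /orP.
- apply/negP => h; have /negP := n2; apply; apply/eqP; apply: spline_bump_out => //.
  by move: h => /negP; rewrite negb_and -!leNgt => /orP.
Qed.

Lemma mollifier_vanishes_off e : 0 < e -> vanishes_off (3 * e) (mollifier e).
Proof.
move=> e0 z nz; apply/eqP; apply/negPn/negP => /(mollifier_neq0 e0)[h1 h2]; apply: nz.
by split=> [i|]; [have /andP[? ?] := h1 i|case/andP: h2 => ? ?]; rewrite gtr0_norm ?ltW.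
Qed.

Lemma vanishes_off_translate r r' phi z : cbox r z -> vanishes_off r' phi ->
  vanishes_off (r + r') (fun w => phi (w - z)).
Proof.
move=> [z1 z2] phi0 w nw; apply: phi0 => -[h1 h2]; apply: nw; split=> [i|].
- have := h1 i; have := z1 i; rewrite !mxE => *.
  by rewrite -(subrK (z.1 ord0 i) (w.1 ord0 i)) (le_trans (ler_normD _ _))// addrC lerD.
- by rewrite -(subrK z.2 w.2) (le_trans (ler_normD _ _))// addrC lerD.
Qed.

End space_time.

Section mollifier_integral.
Context {R : realType}.
Local Notation leb := (@lebesgue_measure R).

Lemma measurable_prod_coord n (c : 'I_n -> R -> R) :
  (forall i, measurable_fun setT (c i)) ->
  measurable_fun setT (fun x : 'rV[R]_n => \prod_(i < n) c i (x ord0 i)).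
Proof.
move=> mc; apply: measurable_prod => i _.
exact: measurableT_comp (mc i) (measurable_coord_rV i).
Qed.

(** By induction along the recursive construction of Lebesgue measure. *)
Lemma integral_prod_coord1 n (c : 'I_n -> R -> R) :
  (forall i x, 0 <= c i x) -> (forall i, measurable_fun setT (c i)) ->
  (forall i, \int[leb]_x (c i x)%:E = 1)%E ->
  (\int[lebesgue_rV n]_x (\prod_(i < n) c i (x ord0 i))%:E = 1)%E.
Proof.
elim: n c => [|n IH] c c0 mc c1.
  rewrite integral_dirac//; last by apply/measurable_EFinP; exact: measurable_prod_coord mc.
  by rewrite diracT big_ord0 mul1e.
have mp : measurable_fun setT (fun x : 'rV[R]_n.+1 => (\prod_(i < n.+1) c i (x ord0 i))%:E).
  by apply/measurable_EFinP; exact: measurable_prod_coord mc.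
have p0 (x : 'rV[R]_n.+1) : (0 <= (\prod_(i < n.+1) c i (x ord0 i))%:E)%E.
  by rewrite lee_fin prodr_ge0.
transitivity (\int[(leb \x lebesgue_rV n)%E]_p
   (\prod_(i < n.+1) c i (cons_rV p ord0 i))%:E)%E.
  have mcons : @measurable_fun _ _ (measurableTypeR R * 'rV[R]_n)%type 'rV[R]_n.+1
      setT (@cons_rV R n) by exact: measurable_cons_rV.
  have := ge0_integral_pushforward mcons (leb \x lebesgue_rV n)%E measurableT mp
    (fun x _ => p0 x).
  rewrite preimage_setT => <-; exact: eq_measure_integral.
pose g (x : 'rV[R]_n) := \prod_(i < n) c (lift ord0 i) (x ord0 i).
rewrite (_ : (fun p => _) = (fun p : R * 'rV[R]_n => (c ord0 p.1 * g p.2)%:E)); last first.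
  apply/funext => p; rewrite big_ord_recl cons_rV0; congr (_ * _)%:E.
  by apply: eq_bigr => i _; rewrite cons_rVS.
have mg : measurable_fun setT g.
  exact: (@measurable_prod_coord n (fun i => c (lift ord0 i))).
have g0 x : 0 <= g x by rewrite prodr_ge0.
rewrite fubini_tonelli1; last 2 first.
- apply/measurable_EFinP/measurable_funM; first exact: measurableT_comp (mc ord0) _.
  exact: measurableT_comp mg _.
- by move=> p; rewrite lee_fin mulr_ge0.
have gI : (\int[lebesgue_rV n]_x (g x)%:E = 1)%E.
  exact: (IH (fun i => c (lift ord0 i))).
rewrite -[RHS](c1 ord0); apply: eq_integral => x _; rewrite /fubini_F/=.
under eq_integral do rewrite EFinM.
rewrite ge0_integralZl_EFin//=.
- by rewrite gI mule1.
- by move=> y _; rewrite lee_fin.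
- exact/measurable_EFinP.
Qed.

Context (d : nat).
Local Notation Z := ('rV[R]_d * measurableTypeR R)%type.
Local Notation mu := (@space_time_measure R d).
Implicit Types (z w : Z) (e : R).

Lemma integral_prod_space_time (c : 'I_d -> R -> R) (h : R -> R) :
  (forall i x, 0 <= c i x) -> (forall i, measurable_fun setT (c i)) ->
  (forall i, \int[leb]_x (c i x)%:E = 1)%E ->
  (forall x, 0 <= h x) -> measurable_fun setT h -> (\int[leb]_x (h x)%:E = 1)%E ->
  (\int[mu]_z ((\prod_(i < d) c i (z.1 ord0 i)) * h z.2)%:E = 1)%E.
Proof.
move=> c0 mc c1 h0 mh h1; have mp := measurable_prod_coord mc.
rewrite /space_time_measure fubini_tonelli1; last 2 first.
- apply/measurable_EFinP/measurable_funM; first exact: measurableT_comp mp _.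
  exact: measurableT_comp mh _.
- by move=> p; rewrite lee_fin mulr_ge0// prodr_ge0.
rewrite /fubini_F/= -[RHS](integral_prod_coord1 c0 mc c1).
apply: eq_integral => x _; under eq_integral do rewrite EFinM.
rewrite ge0_integralZl_EFin//=.
- by rewrite h1 mule1.
- by move=> y _; rewrite lee_fin.
- exact/measurable_EFinP.
- exact: prodr_ge0.
Qed.

Lemma measurable_spline_bump e : measurable_fun setT (@spline_bump R e).
Proof. by apply: continuous_measurable_fun; exact: continuous_spline_bump. Qed.

Lemma integral_mollifier e z : 0 < e -> (\int[mu]_w (mollifier e (w - z))%:E = 1)%E.
Proof.
move=> e0; have mb (a : R) : measurable_fun setT (fun x : R => spline_bump e (x - a)).
  by apply: measurableT_comp; [exact: measurable_spline_bump|apply: measurable_funB].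
rewrite -[RHS](@integral_prod_space_time
  (fun i x => spline_bump e (x - z.1 ord0 i)) (fun t => spline_bump e (t - z.2))) //.
- apply: eq_integral => w _; rewrite /mollifier; congr (_ * _)%:E.
  by apply: eq_bigr => i _; rewrite !mxE.
- by move=> i x; exact: spline_bump_ge0.
- by move=> i; exact: integral_spline_bump.
- by move=> x; exact: spline_bump_ge0.
- exact: integral_spline_bump.
Qed.

Lemma integral_mollifier_reflected e w : 0 < e ->
  (\int[mu]_z (mollifier e (w - z))%:E = 1)%E.
Proof.
move=> e0; have mb (a : R) : measurable_fun setT (fun x : R => spline_bump e (a - x)).
  by apply: measurableT_comp; [exact: measurable_spline_bump|apply: measurable_funB].
rewrite -[RHS](@integral_prod_space_time
  (fun i x => spline_bump e (w.1 ord0 i - x)) (fun t => spline_bump e (w.2 - t))) //.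
- apply: eq_integral => z _; rewrite /mollifier; congr (_ * _)%:E.
  by apply: eq_bigr => i _; rewrite !mxE.
- by move=> i x; exact: spline_bump_ge0.
- by move=> i; exact: integral_spline_bump_reflected.
- by move=> x; exact: spline_bump_ge0.
- exact: integral_spline_bump_reflected.
Qed.

Lemma measurable_sub_space_time :
  measurable_fun setT (fun p : Z * Z => p.2 - p.1).
Proof.
apply: measurable_fun_pair; last first.
  by apply: measurable_funB; apply: measurableT_comp.
apply/measurable_fun_rVP => i.
rewrite (_ : (fun p => _) = (fun p : Z * Z => p.2.1 ord0 i - p.1.1 ord0 i)); last first.
  by apply/funext => p; rewrite !mxE.
by apply: measurable_funB; apply: (measurableT_comp (measurable_coord_rV i));
  apply: measurableT_comp.
Qed.

Lemma measurable_continuous_sub (g : Z -> R) : continuous g ->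
  measurable_fun setT (fun p : Z * Z => g (p.2 - p.1)).
Proof.
move=> cg; apply: (measurableT_comp _ measurable_sub_space_time).
exact: continuous_measurable_space_time.
Qed.

End mollifier_integral.

(** * Continuity of translations in L1 *)

Section approximate_identity.
Context {R : realType} (d : nat).
Local Notation Z := ('rV[R]_d * measurableTypeR R)%type.
Local Notation mu := (@space_time_measure R d).
Implicit Types (z w : Z) (g : Z -> R) (e : R) (A : set Z).
Variable r : R.

(** The L1 modulus of continuity of [g] over the box [cbox r], averaged by the
    mollifier over translations of size [e]. *)
Definition oscillation e g : \bar R :=
  (\int[mu]_(z in cbox r) \int[mu]_w (`|g w - g z| * mollifier e (w - z))%:E)%E.

Lemma measurable_mollified e (k : Z * Z -> R) : measurable_fun setT k ->
  measurable_fun setT (fun p : Z * Z => (k p * mollifier e (p.2 - p.1))%:E).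
Proof.
move=> mk; apply/measurable_EFinP; apply: measurable_funM => //.
by apply: measurable_continuous_sub; apply: C1_continuous; exact: C1_mollifier.
Qed.

Lemma measurable_diff_abs g : measurable_fun setT g ->
  measurable_fun setT (fun p : Z * Z => `|g p.2 - g p.1|).
Proof.
move=> mg; apply: measurableT_comp => //.
by apply: measurable_funB; apply: (measurableT_comp mg).
Qed.

Lemma measurable_inner e (k : Z * Z -> R) : 0 < e -> measurable_fun setT k ->
  (forall p, 0 <= k p) -> measurable_fun setT
  (fun z => \int[mu]_w (k (z, w) * mollifier e (w - z))%:E)%E.
Proof.
move=> e0 mk k0.
apply: (measurable_fun_fubini_tonelli_F
  (fun p : Z * Z => (k p * mollifier e (p.2 - p.1))%:E)).
  exact: measurable_mollified.
by move=> p; rewrite lee_fin mulr_ge0// mollifier_ge0.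
Qed.

Lemma measurable_shift_mollifier e z : measurable_fun setT (fun w => mollifier e (w - z)).
Proof.
apply: continuous_measurable_space_time; apply: C1_continuous.
exact/C1_translate/C1_mollifier.
Qed.

Lemma integral_mollifierZ e z (c : R) : 0 < e -> 0 <= c ->
  (\int[mu]_w (c * mollifier e (w - z))%:E = c%:E)%E.
Proof.
move=> e0 c0; under eq_integral do rewrite EFinM.
rewrite ge0_integralZl_EFin//.
- by rewrite integral_mollifier// mule1.
- by move=> w _; rewrite lee_fin mollifier_ge0.
- by apply/measurable_EFinP; exact: measurable_shift_mollifier.
Qed.

Lemma oscillation_triangle e g g1 g2 : 0 < e ->
  measurable_fun setT g -> measurable_fun setT g1 -> measurable_fun setT g2 ->
  (forall z w, `|g w - g z| <= `|g1 w - g1 z| + `|g2 w - g2 z|) ->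
  (oscillation e g <= oscillation e g1 + oscillation e g2)%E.
Proof.
move=> e0 mg mg1 mg2 gle.
have m0 (h : Z -> R) z w : 0 <= `|h w - h z : R| * mollifier e (w - z).
  by rewrite mulr_ge0// mollifier_ge0.
have mz (h : Z -> R) z : measurable_fun setT h ->
    measurable_fun setT (fun w => (`|h w - h z| * mollifier e (w - z))%:E).
  move=> mh; apply/measurable_EFinP/measurable_funM; last exact: measurable_shift_mollifier.
  by apply: measurableT_comp => //; apply: measurable_funB.
rewrite /oscillation -ge0_integralD//.
- apply: ge0_le_integral => //.
  + exact: measurable_cbox.
  + by move=> z _; apply: integral_ge0 => w _; rewrite lee_fin.
  + by apply: measurable_funTS; exact: (measurable_inner e0 (measurable_diff_abs mg)).
  + apply: measurable_funTS; apply: emeasurable_funD.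
      exact: (measurable_inner e0 (measurable_diff_abs mg1)).
    exact: (measurable_inner e0 (measurable_diff_abs mg2)).
  move=> z _; rewrite -ge0_integralD//.
  + apply: ge0_le_integral => //.
    * by move=> w _; rewrite lee_fin.
    * exact: mz.
    * by apply: emeasurable_funD; exact: mz.
    * by move=> w _; rewrite -EFinD lee_fin -mulrDl ler_wpM2r// mollifier_ge0.
  + by move=> w _; rewrite lee_fin.
  + exact: mz.
  + by move=> w _; rewrite lee_fin.
  + exact: mz.
- exact: measurable_cbox.
- by move=> z _; apply: integral_ge0 => w _; rewrite lee_fin.
- by apply: measurable_funTS; exact: (measurable_inner e0 (measurable_diff_abs mg1)).
- by move=> z _; apply: integral_ge0 => w _; rewrite lee_fin.
- by apply: measurable_funTS; exact: (measurable_inner e0 (measurable_diff_abs mg2)).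
Qed.

(** By Tonelli: the mollifier has unit mass and moves points by at most [3 * e] in
    each coordinate, which enlarges the box by at most 3. *)
Lemma integral_mollified_le e (h : Z -> R) : 0 < e -> e <= 1 -> measurable_fun setT h ->
  (forall z, 0 <= h z) ->
  (\int[mu]_(z in cbox r) \int[mu]_w (h w * mollifier e (w - z))%:E
   <= \int[mu]_(z in cbox (r + 3)) (h z)%:E)%E.
Proof.
move=> e0 e1 mh h0; have mB := @measurable_cbox R d r; have mB' := @measurable_cbox R d (r + 3).
have mh1 : measurable_fun setT (h \_ (cbox (r + 3))).
  by apply/(measurable_restrictT _ mB'); exact: measurable_funTS.
have h10 z : 0 <= (h \_ (cbox (r + 3))) z by rewrite patchE; case: ifP.
have mh2 : measurable_fun setT (fun p : Z * Z => (h \_ (cbox (r + 3))) p.2).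
  exact: measurableT_comp mh1 _.
apply: (@le_trans _ _ (\int[mu]_z \int[mu]_w ((h \_ (cbox (r + 3))) w * mollifier e (w - z))%:E)%E).
  apply: (@le_trans _ _ (\int[mu]_(z in cbox r) \int[mu]_w ((h \_ (cbox (r + 3))) w * mollifier e (w - z))%:E)%E).
    apply: ge0_le_integral => //.
    - by move=> z _; apply: integral_ge0 => w _; rewrite lee_fin mulr_ge0// mollifier_ge0.
    - apply: measurable_funTS; apply: (@measurable_inner e (fun p => h p.2)) => //.
      exact: measurableT_comp mh _.
    - by apply: measurable_funTS; exact: (@measurable_inner e (fun p => (h \_ (cbox (r + 3))) p.2)).
    - move=> z Bz; rewrite le_eqVlt; apply/orP; left; apply/eqP.
      apply: eq_integral => w _; congr EFin; rewrite patchE; case: ifPn => // nB'.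
      rewrite (_ : mollifier e (w - z) = 0) ?mulr0//.
      apply: (vanishes_off_translate Bz (mollifier_vanishes_off e0)) => Bw.
      move/negP: nB'; apply; rewrite inE; apply: le_cbox Bw; lra.
  apply: ge0_subset_integral => //.
  - exact: (@measurable_inner e (fun p => (h \_ (cbox (r + 3))) p.2)).
  - by move=> z _; apply: integral_ge0 => w _; rewrite lee_fin mulr_ge0// mollifier_ge0.
have -> : (\int[mu]_z \int[mu]_w ((h \_ (cbox (r + 3))) w * mollifier e (w - z))%:E =
    \int[mu]_w \int[mu]_z ((h \_ (cbox (r + 3))) w * mollifier e (w - z))%:E)%E.
  apply: (fubini_tonelli (fun p : Z * Z =>
    ((h \_ (cbox (r + 3))) p.2 * mollifier e (p.2 - p.1))%:E)).
    exact: measurable_mollified.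
  by move=> p; rewrite lee_fin mulr_ge0// mollifier_ge0.
rewrite [leRHS]integral_mkcond le_eqVlt; apply/orP; left; apply/eqP.
apply: eq_integral => w _; under eq_integral do rewrite EFinM.
rewrite ge0_integralZl_EFin//.
- by rewrite integral_mollifier_reflected// mule1 /patch; case: ifP.
- by move=> z _; rewrite lee_fin mollifier_ge0.
- apply/measurable_EFinP; apply: continuous_measurable_space_time; apply: C1_continuous.
  exact/C1_reflect/C1_mollifier.
Qed.

(** The bound is uniform in [e]; hence a vanishing oscillation is preserved by L1
    limits. *)
Lemma oscillation_le_norm e g : 0 < e -> e <= 1 -> measurable_fun setT g ->
  (oscillation e g <= 2%:E * \int[mu]_(z in cbox (r + 3)) `|g z|%:E)%E.
Proof.
move=> e0 e1 mg; have mB := @measurable_cbox R d r.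
have mng : measurable_fun setT (fun z => `|g z|) by exact: measurableT_comp.
have mng2 : measurable_fun setT (fun p : Z * Z => `|g p.2|) by exact: measurableT_comp mng _.
have step : (oscillation e g <=
    \int[mu]_(z in cbox r) (\int[mu]_w (`|g w| * mollifier e (w - z))%:E + `|g z|%:E))%E.
  have mI : measurable_fun setT (fun z => \int[mu]_w (`|g w| * mollifier e (w - z))%:E)%E.
    exact: (@measurable_inner e (fun p => `|g p.2|)).
  apply: ge0_le_integral => //.
  - by move=> z _; apply: integral_ge0 => w _; rewrite lee_fin mulr_ge0// mollifier_ge0.
  - by apply: measurable_funTS; exact: (measurable_inner e0 (measurable_diff_abs mg)).
  - by apply: measurable_funTS; apply: emeasurable_funD => //; exact/measurable_EFinP.
  move=> z _; rewrite -[X in (_ + X)%E](@integral_mollifierZ e z)// -ge0_integralD//.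
  - apply: ge0_le_integral => //.
    + by move=> w _; rewrite lee_fin mulr_ge0// mollifier_ge0.
    + apply/measurable_EFinP/measurable_funM; last exact: measurable_shift_mollifier.
      by apply: measurableT_comp => //; apply: measurable_funB.
    + apply/measurable_EFinP; apply: measurable_funD; apply: measurable_funM => //;
      exact: measurable_shift_mollifier.
    + move=> w _; rewrite -EFinD lee_fin -mulrDl ler_wpM2r ?mollifier_ge0//.
      exact: ler_normB.
  - by move=> w _; rewrite lee_fin mulr_ge0// mollifier_ge0.
  - by apply/measurable_EFinP/measurable_funM => //; exact: measurable_shift_mollifier.
  - by move=> w _; rewrite lee_fin mulr_ge0// mollifier_ge0.
  - by apply/measurable_EFinP/measurable_funM => //; exact: measurable_shift_mollifier.
apply: (le_trans step); rewrite ge0_integralD//.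
- rewrite mule_natl mule2n; apply: leeD.
    exact: (@integral_mollified_le e (fun z => `|g z|)).
  apply: ge0_subset_integral => //; first exact: measurable_cbox.
  - by apply: measurable_funTS; exact/measurable_EFinP.
  - by apply: le_cbox; lra.
- by move=> z _; apply: integral_ge0 => w _; rewrite lee_fin mulr_ge0// mollifier_ge0.
- by apply: measurable_funTS; exact: (@measurable_inner e (fun p => `|g p.2|)).
- by apply: measurable_funTS; exact/measurable_EFinP.
Qed.

Definition vanishing_oscillation g : Prop := forall eps : R, 0 < eps ->
  exists N, forall n, (N <= n)%N -> (oscillation n.+1%:R^-1 g <= eps%:E)%E.

Let eps_gt0 n : 0 < n.+1%:R^-1 :> R. Proof. by rewrite invr_gt0. Qed.

Let eps_le1 n : n.+1%:R^-1 <= 1 :> R. Proof. by rewrite invf_le1// ler1n. Qed.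

Lemma vanishing_oscillation_triangle g g1 g2 :
  measurable_fun setT g -> measurable_fun setT g1 -> measurable_fun setT g2 ->
  (forall z w, `|g w - g z| <= `|g1 w - g1 z| + `|g2 w - g2 z|) ->
  vanishing_oscillation g1 -> vanishing_oscillation g2 -> vanishing_oscillation g.
Proof.
move=> mg mg1 mg2 gle v1 v2 eps eps0; have e20 : 0 < eps / 2 by rewrite divr_gt0.
have [N1 N1P] := v1 _ e20; have [N2 N2P] := v2 _ e20; exists (maxn N1 N2) => n.
rewrite geq_max => /andP[n1 n2].
apply: (le_trans (oscillation_triangle (eps_gt0 n) mg mg1 mg2 gle)).
by rewrite (splitr eps) EFinD; apply: leeD; [exact: N1P|exact: N2P].
Qed.

Lemma vanishing_oscillation_approx g : measurable_fun setT g ->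
  (forall eps : R, 0 < eps -> exists g1, [/\ measurable_fun setT g1,
     vanishing_oscillation g1 &
     (\int[mu]_(z in cbox (r + 3)) `|g z - g1 z|%:E <= eps%:E)%E]) ->
  vanishing_oscillation g.
Proof.
move=> mg appr eps eps0.
have [g1 [mg1 v1 g1e]] := appr (eps / 4) (divr_gt0 eps0 (ltr0n _ 4)).
have [N NP] := v1 (eps / 2) (divr_gt0 eps0 (ltr0n _ 2)).
exists N => n Nn.
have mgg1 : measurable_fun setT (fun z => g z - g1 z) by exact: measurable_funB.
apply: (le_trans (@oscillation_triangle _ g g1 (fun z => g z - g1 z) (eps_gt0 n) mg mg1 mgg1 _)).
  move=> z w; rewrite (_ : g w - g z = (g1 w - g1 z) + ((g w - g1 w) - (g z - g1 z))).
    exact: ler_normD.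
  ring.
have -> : eps%:E = ((eps / 2)%:E + 2%:E * (eps / 4)%:E)%E.
  by rewrite -EFinM -EFinD; congr EFin; field.
apply: leeD; first exact: NP.
apply: (le_trans (oscillation_le_norm (eps_gt0 n) (eps_le1 n) mgg1)).
by rewrite lee_pmul2l// lte_fin.
Qed.

Lemma vanishing_oscillationZ (c : R) g : measurable_fun setT g ->
  vanishing_oscillation g -> vanishing_oscillation (fun z => c * g z).
Proof.
move=> mg vg eps eps0; have c0 : 0 < `|c| + 1 by rewrite ltr_wpDl.
have [N NP] := vg (eps / (`|c| + 1)) (divr_gt0 eps0 c0).
exists N => n Nn; apply: (@le_trans _ _ ((`|c| + 1)%:E * oscillation n.+1%:R^-1 g)%E).
  have mB := @measurable_cbox R d r; have k0 := ltW c0.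
  rewrite /oscillation -ge0_integralZl_EFin//; last 2 first.
  - by move=> z _; apply: integral_ge0 => w _; rewrite lee_fin mulr_ge0// mollifier_ge0.
  - by apply: measurable_funTS; exact: (measurable_inner (eps_gt0 n) (measurable_diff_abs mg)).
  have mz (h : Z -> R) z : measurable_fun setT h ->
      measurable_fun setT (fun w => (`|h w - h z| * mollifier n.+1%:R^-1 (w - z))%:E).
    move=> mh; apply/measurable_EFinP/measurable_funM; last exact: measurable_shift_mollifier.
    by apply: measurableT_comp => //; apply: measurable_funB.
  have mcg : measurable_fun setT (fun z => c * g z) by exact: measurable_funM.
  apply: ge0_le_integral => //.
  - by move=> z _; apply: integral_ge0 => w _; rewrite lee_fin mulr_ge0// mollifier_ge0.
  - by apply: measurable_funTS; exact: (measurable_inner (eps_gt0 n) (measurable_diff_abs mcg)).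
  - apply: measurable_funTS; apply: measurable_funeM.
    exact: (measurable_inner (eps_gt0 n) (measurable_diff_abs mg)).
  move=> z _; rewrite -ge0_integralZl_EFin//; last 2 first.
  - by move=> w _; rewrite lee_fin mulr_ge0// mollifier_ge0.
  - exact: mz.
  apply: ge0_le_integral => //.
  - by move=> w _; rewrite lee_fin mulr_ge0// mollifier_ge0.
  - exact: mz.
  - by apply: measurable_funeM; exact: mz.
  - move=> w _; rewrite -EFinM lee_fin -mulrBr normrM -mulrA ler_wpM2r//.
      by rewrite mulr_ge0// mollifier_ge0.
    by rewrite lerDl.
rewrite (_ : eps%:E = (`|c| + 1)%:E * (eps / (`|c| + 1))%:E)%E.
  by rewrite lee_pmul2l ?lte_fin// NP.
by rewrite -EFinM; congr EFin; field; rewrite gt_eqF.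
Qed.

(** Dominated convergence, in the form needed for limits of indicators. *)
Lemma integral_cbox_eventually0 (rho : R) (f : nat -> Z -> \bar R) :
  (forall n, measurable_fun setT (f n)) ->
  (forall n z, (0 <= f n z <= 1)%E) ->
  (forall z, exists N, forall n, (N <= n)%N -> f n z = 0%E) ->
  forall eps : R, 0 < eps ->
  exists N, forall n, (N <= n)%N -> (\int[mu]_(z in cbox rho) f n z <= eps%:E)%E.
Proof.
move=> mf f01 f0 eps eps0; have mB := @measurable_cbox R d rho.
have [|||||_ _] := @dominated_convergence _ _ _ mu _ mB f (cst 0%E) (cst 1%E).
- by move=> n; exact: measurable_funTS.
- exact: measurable_cst.
- apply: aeW => z _; apply: cvg_near_cst; have [N NP] := f0 z.
  by exists N => // n /= Nn; exact: NP.
- apply/integrableP; split; first exact: measurable_cst.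
  under eq_integral do rewrite /= normr1.
  by rewrite integral_cst// mul1e cbox_lty.
- apply: aeW => z n _; have /andP[f0n f1n] := f01 n z.
  by rewrite gee0_abs.
rewrite integral0 => /fine_cvgP[fin /cvgrPdist_le /(_ _ eps0) le].
have [N _ NP] := filterI fin le; exists N => n Nn; have [/= fn ln] := NP n Nn.
by rewrite -(fineK fn) lee_fin; apply: le_trans ln; rewrite sub0r normrN ler_norm.
Qed.

Lemma vanishing_oscillation_cst (c : R) : vanishing_oscillation (fun=> c).
Proof.
move=> eps eps0; exists 0%N => n _; rewrite /oscillation.
under eq_integral do under eq_integral do rewrite subrr normr0 mul0r.
rewrite integral0_eq; first by rewrite lee_fin ltW.
by move=> z _; rewrite integral0.
Qed.

Definition translation_continuous_set : set (set Z) :=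
  [set A | measurable A /\ vanishing_oscillation \1_A].

Lemma translation_continuous_setC A :
  translation_continuous_set A -> translation_continuous_set (~` A).
Proof.
move=> [mA vA]; split; first exact: measurableC.
apply: (@vanishing_oscillation_triangle _ \1_A (fun=> 0)).
- by apply: measurable_indic; exact: measurableC.
- exact: measurable_indic.
- exact: measurable_cst.
- move=> z w; rewrite !indicE !in_setC subrr normr0 addr0.
  by case: (w \in A); case: (z \in A); rewrite /= ?subrr ?subr0 ?sub0r ?normrN.
- exact: vA.
- exact: vanishing_oscillation_cst.
Qed.

Lemma translation_continuous_setU A B : translation_continuous_set A ->
  translation_continuous_set B -> translation_continuous_set (A `|` B).
Proof.
move=> [mA vA] [mB vB]; split; first exact: measurableU.
apply: (vanishing_oscillation_triangle _ _ _ _ vA vB) => //.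
- by apply: measurable_indic; exact: measurableU.
move=> z w; rewrite !indicE !in_setU.
by case: (w \in A); case: (w \in B); case: (z \in A); case: (z \in B);
  rewrite /= ?subrr ?subr0 ?sub0r ?normrN ?normr1 ?normr0; lra.
Qed.

Lemma translation_continuous_set0 : translation_continuous_set set0.
Proof.
by split => //; rewrite indic0; exact: vanishing_oscillation_cst.
Qed.

(** The finite unions converge to the union in L1 of any box. *)
Lemma translation_continuous_bigcup (F : nat -> set Z) :
  (forall n, translation_continuous_set (F n)) ->
  translation_continuous_set (\bigcup_n F n).
Proof.
move=> tF; have mU : measurable (\bigcup_n F n).
  by apply: bigcupT_measurable => n; exact: (tF n).1.
have tU n : translation_continuous_set (\big[setU/set0]_(i < n) F i).
  elim: n => [|n IH]; first by rewrite big_ord0; exact: translation_continuous_set0.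
  by rewrite big_ord_recr/=; apply: translation_continuous_setU; [exact: IH|exact: tF].
split=> //; apply: vanishing_oscillation_approx => [//|eps eps0].
have mUn n : measurable_fun setT (\1_(\big[setU/set0]_(i < n) F i) : Z -> R).
  by apply: measurable_indic; exact: (tU n).1.
have mUU : measurable_fun setT (\1_(\bigcup_n F n) : Z -> R) by exact: measurable_indic.
have sub n z : z \in \big[setU/set0]_(i < n) F i -> z \in \bigcup_n F n.
  by rewrite !inE -bigcup_mkord => -[k /= _ Fk]; exists k.
have [|||N NP] := @integral_cbox_eventually0 (r + 3)
  (fun n z => (`|\1_(\bigcup_n F n) z - \1_(\big[setU/set0]_(i < n) F i) z : R|)%:E)
  _ _ _ _ eps0.
- by move=> n; apply/measurable_EFinP; apply: measurableT_comp => //; exact: measurable_funB.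
- move=> n z; rewrite !lee_fin normr_ge0/= !indicE; have := sub n z.
  by case: (z \in \big[_/_]_(i < n) _) => [->//|_]; rewrite ?subrr ?normr0//;
    case: (z \in _); rewrite ?subr0 ?normr1 ?normr0.
- move=> z; have [zF|nzF] := boolP (z \in \bigcup_n F n); last first.
    exists 0%N => n _; rewrite !indicE (negbTE nzF).
    by have := sub n z; rewrite (negbTE nzF); case: (z \in _) => [/(_ isT)|]//;
      rewrite subrr normr0.
  move: (zF); rewrite inE => -[k _ Fkz]; exists k.+1 => n kn; rewrite !indicE zF.
  rewrite (_ : z \in \big[_/_]_(i < n) _) ?subrr ?normr0//.
  by rewrite inE -bigcup_mkord; exists k.
exists (\1_(\big[setU/set0]_(i < N) F i)); split=> //; first exact: (tU N).2.
exact: NP.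
Qed.

(** Where [a <= g z], one-sidedness gives [a <= g w] on the support of the
    mollifier; where [g z < a], also [g w < a] once [3 * e] is below the gap.  So the
    inner integral is eventually zero at every point. *)
Lemma translation_continuous_coord (g : Z -> R) (a : R) : measurable_fun setT g ->
  (forall e z w, 0 < e -> mollifier e (w - z) != 0 -> g z <= g w <= g z + 3 * e) ->
  translation_continuous_set [set z | a <= g z].
Proof.
move=> mg gP; have mA : measurable [set z | a <= g z].
  rewrite (_ : [set z | _] = g @^-1` `[a, +oo[%classic).
    by rewrite -[X in measurable X]setTI; exact: mg.
  by apply/seteqP; split=> z /=; rewrite in_itv/= andbT.
split=> // eps eps0; set h : Z -> R := \1__.
have mh : measurable_fun setT h by exact: measurable_indic.
have h01 z w : `|h w - h z| <= 1.
  rewrite /h !indicE; case: (_ \in _); case: (_ \in _);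
  by rewrite /= ?subrr ?subr0 ?sub0r ?normrN ?normr1 ?normr0.
apply: (@integral_cbox_eventually0 r
  (fun n z => \int[mu]_w (`|h w - h z| * mollifier n.+1%:R^-1 (w - z))%:E)%E _ _ _ _ eps0).
- by move=> n; exact: (measurable_inner (eps_gt0 n) (measurable_diff_abs mh)).
- move=> n z; apply/andP; split.
    by apply: integral_ge0 => w _; rewrite lee_fin mulr_ge0// mollifier_ge0.
  rewrite -(integral_mollifier z (eps_gt0 n)); apply: ge0_le_integral => //.
  + by move=> w _; rewrite lee_fin mulr_ge0// mollifier_ge0.
  + apply/measurable_EFinP/measurable_funM; last exact: measurable_shift_mollifier.
    by apply: measurableT_comp => //; apply: measurable_funB.
  + by apply/measurable_EFinP; exact: measurable_shift_mollifier.
  + by move=> w _; rewrite lee_fin ler_piMl// mollifier_ge0.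
- move=> z; have [N NP] : exists N, forall n, (N <= n)%N ->
      g z < a -> g z + 3 * n.+1%:R^-1 < a.
    have [gza|gza] := ltP (g z) a; last by exists 0%N.
    have d0 : 0 < (a - g z) / 3 by rewrite divr_gt0// subr_gt0.
    have [k _ kP] := near_infty_natSinv_lt (PosNum d0).
    by exists k => n /kP /= kn _; rewrite -ltrBrDl mulrC -ltr_pdivlMr.
  exists N => n Nn; apply: integral0_eq => w _; congr EFin.
  have [->|m0] := eqVneq (mollifier n.+1%:R^-1 (w - z)) 0; first by rewrite mulr0.
  have /andP[zw wz] := gP _ z w (eps_gt0 n) m0.
  have hE y : h y = ((a <= g y)%R)%:R :> R.
    rewrite /h indicE; have -> // : (y \in [set z | a <= g z]) = (a <= g y).
    by apply/idP/idP; rewrite inE.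
  rewrite (_ : h w = h z) ?subrr ?normr0 ?mul0r// !hE; congr (_%:R).
  have [gza|gza] := leP a (g z); first by rewrite (le_trans gza zw).
  by rewrite leNgt (le_lt_trans wz)// NP.
Qed.

Lemma translation_continuous_preimage (g : Z -> R) : measurable_fun setT g ->
  (forall e z w, 0 < e -> mollifier e (w - z) != 0 -> g z <= g w <= g z + 3 * e) ->
  forall B : set R, measurable B -> translation_continuous_set (g @^-1` B).
Proof.
move=> mg gP B mB.
suff: <<s @RGenCInfty.G R >> `<=` [set B | translation_continuous_set (g @^-1` B)].
  by apply; move: mB; rewrite -[<<s _ >>]RGenCInfty.measurableE.
apply: smallest_sub.
  split => /=.
  - by rewrite preimage_set0; exact: translation_continuous_set0.
  - move=> A tA; rewrite setTD preimage_setC; exact: translation_continuous_setC.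
  - move=> F tF; rewrite preimage_bigcup; exact: translation_continuous_bigcup.
move=> _ [a ->] /=; rewrite (_ : _ @^-1` _ = [set z | a <= g z]).
  exact: translation_continuous_coord.
by apply/seteqP; split=> z /=; rewrite in_itv/= andbT.
Qed.

(** These sets form a sigma-algebra that contains the half-spaces delimited by a
    coordinate, and the latter generate. *)
Lemma measurable_translation_continuous A : measurable A ->
  translation_continuous_set A.
Proof.
move: A; rewrite (_ : measurable = g_sigma_preimageU fst snd)//.
apply: smallest_sub.
  split => /=.
  - exact: translation_continuous_set0.
  - move=> A tA; rewrite setTD; exact: translation_continuous_setC.
  - move=> F tF; exact: translation_continuous_bigcup.
move=> A [[B mB <-]|[B mB <-]]; rewrite setTI; last first.
  apply: (@translation_continuous_preimage (fun z : Z => z.2)) => //.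
    exact: measurable_snd.
  move=> e z w e0 /(mollifier_neq0 e0)[_] /= /andP[wz zw].
  by move: wz zw; rewrite subr_gt0 ltrBlDl => /ltW -> /ltW ->.
suff fstP : @measurable _ 'rV[R]_d `<=`
    [set B : set 'rV[R]_d | translation_continuous_set (fst @^-1` B)] by exact: fstP.
apply: smallest_sub.
  split => /=.
  - by rewrite preimage_set0; exact: translation_continuous_set0.
  - move=> A' tA; rewrite setTD preimage_setC; exact: translation_continuous_setC.
  - move=> F tF; rewrite preimage_bigcup; exact: translation_continuous_bigcup.
rewrite -bigcup_seq => _ [i _ [C mC <-]] /=; rewrite setTI -comp_preimage.
apply: (@translation_continuous_preimage (fun z : Z => z.1 ord0 i)) => //.
  exact: (measurableT_comp (measurable_coord_rV i) measurable_fst).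
move=> e z w e0 /(mollifier_neq0 e0)[/(_ i) + _] /=; rewrite !mxE => /andP[wz zw].
by move: wz zw; rewrite subr_gt0 ltrBlDl => /ltW -> /ltW ->.
Qed.

(** The largest multiple of [dl], up to the [N]th, that does not exceed [y], as a
    sum of indicators of conditions [j * dl <= y]. *)
Let quantize (dl : R) N (y : R) : R := \sum_(j < N) dl * ((j.+1%:R * dl <= y)%R)%:R.

Let quantizeP dl N y : 0 < dl -> 0 <= y <= N%:R * dl ->
  0 <= y - quantize dl N y <= dl.
Proof.
move=> dl0 /andP[y0 yN].
have inv n : (n%:R * dl <= y /\ quantize dl n y = n%:R * dl) \/
    (y < n%:R * dl /\ quantize dl n y <= y < quantize dl n y + dl).
  elim: n => [|n [[ny nE]|[ny nE]]]; rewrite /quantize.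
  - by left; rewrite big_ord0 mul0r.
  - rewrite big_ord_recr/=; rewrite /quantize in nE; rewrite nE.
    have [h|h] := leP (n.+1%:R * dl) y; [left|right]; split=> //.
    + by rewrite mulr1 -[n.+1%:R]natr1; ring.
    + by rewrite mulr0 addr0 ny/=; move: h; rewrite -[n.+1%:R]natr1; lra.
  - right; rewrite big_ord_recr/=.
    have h : y < n.+1%:R * dl by rewrite (lt_trans ny)// ltr_pM2r// ltr_nat.
    have -> : (n.+1%:R * dl <= y) = false by rewrite leNgt h.
    by split=> //; rewrite mulr0 addr0.
case: (inv N) => [[Ny ->]|[_ /andP[? ?]]]; last by apply/andP; split; lra.
have yE : y = N%:R * dl by apply/le_anti/andP.
by rewrite yE subrr lexx ltW.
Qed.

(** A bounded function is a uniform limit of finite combinations of the indicators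
    of its superlevel sets. *)
Lemma bounded_vanishing_oscillation g (C : R) : measurable_fun setT g ->
  (forall z, `|g z| <= C) -> vanishing_oscillation g.
Proof.
move=> mg gC; apply: vanishing_oscillation_approx => // eps eps0.
have mB := @measurable_cbox R d (r + 3).
set m := fine (mu (cbox (r + 3))).
have mE : mu (cbox (r + 3)) = m%:E by rewrite fineK// ge0_fin_numE ?cbox_lty.
have m0 : 0 <= m by rewrite -lee_fin -mE.
have C0 : 0 <= C by rewrite (le_trans _ (gC 0)).
pose dl := eps / (m + 1).
have dl0 : 0 < dl by rewrite divr_gt0// ltr_wpDl.
pose N := (Num.truncn (2 * C / dl)).+1.
have NP : 2 * C <= N%:R * dl by rewrite -ler_pdivrMr//; apply: ltW; exact: truncnS_gt.
pose h z := quantize dl N (g z + C).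
have mgC : measurable_fun setT (fun z => g z + C) by exact: measurable_funD.
have mI (j : nat) : measurable [set z | j.+1%:R * dl <= g z + C].
  rewrite (_ : [set z | _] = (fun z => g z + C) @^-1` `[j.+1%:R * dl, +oo[%classic).
    rewrite -[X in measurable X]setTI.
    by apply: mgC.
  by apply/seteqP; split=> z /=; rewrite in_itv/= andbT.
have hE n z : quantize dl n (g z + C) =
    \sum_(j < n) dl * \1_[set z | j.+1%:R * dl <= g z + C] z.
  apply: eq_bigr => j _; rewrite indicE.
  have -> // : (z \in [set z | j.+1%:R * dl <= g z + C]) = (j.+1%:R * dl <= g z + C).
  by apply/idP/idP; rewrite inE.
have mh n : measurable_fun setT (fun z => quantize dl n (g z + C)).
  rewrite (_ : (fun z => _) = fun z => \sum_(j < n) dl * \1_[set z | j.+1%:R * dl <= g z + C] z).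
    by apply: measurable_sum => j; apply: measurable_funM => //; exact: measurable_indic.
  by apply/funext => z; exact: hE.
have vh n : vanishing_oscillation (fun z => quantize dl n (g z + C)).
  elim: n => [|n IH].
    rewrite (_ : (fun z => _) = fun=> 0); first exact: vanishing_oscillation_cst.
    by apply/funext => z; rewrite /quantize big_ord0.
  pose k z : R := dl * \1_[set z | n.+1%:R * dl <= g z + C] z.
  have mk : measurable_fun setT k by apply: measurable_funM => //; exact: measurable_indic.
  apply: (@vanishing_oscillation_triangle _ _ k (mh n.+1) (mh n) mk _ IH).
    move=> z w; rewrite !hE !big_ord_recr/= -!hE -/(k w) -/(k z).
    rewrite (_ : _ - _ = (quantize dl n (g w + C) - quantize dl n (g z + C)) + (k w - k z)).
      exact: ler_normD.
    ring.
  apply: vanishing_oscillationZ; first exact: measurable_indic.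
  exact: (measurable_translation_continuous (mI n)).2.
have mhC : measurable_fun setT (fun z => h z - C) by apply: measurable_funB => //; exact: mh.
exists (fun z => h z - C); split => //.
  apply: (@vanishing_oscillation_triangle _ h (fun=> 0) mhC (mh N)) => //; last first.
    exact: vanishing_oscillation_cst.
  - exact: vh.
  - by move=> z w; rewrite subrr normr0 addr0 (_ : _ - _ = h w - h z)//; ring.
apply: (@le_trans _ _ (\int[mu]_(z in cbox (r + 3)) cst dl%:E z)%E).
  apply: ge0_le_integral => //.
  - apply: measurable_funTS; apply/measurable_EFinP; apply: measurableT_comp => //.
    exact: measurable_funB.
  move=> z _ /=; rewrite lee_fin; have := gC z; rewrite ler_norml => /andP[g1 g2].
  have : 0 <= g z + C <= N%:R * dl by apply/andP; split; lra.
  move=> /(quantizeP dl0) /andP[q1 q2]; rewrite ger0_norm /h; lra.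
rewrite integral_cst// [X in (_ * X)%E](_ : _ = m%:E)// -EFinM lee_fin /dl mulrAC ler_pdivrMr; last lra.
by rewrite ler_wpM2l ?ltW//; lra.
Qed.

End approximate_identity.

(** * Measurable families of probability measures *)

Section young_measures.
Context {R : realType}.
Implicit Types (a xi : R) (n : nat).

(** Functions of [C0] that converge pointwise to the indicator of the ray [xi > a]. *)
Definition ramp a n xi : R :=
  Num.min 1 (n%:R * pospart (xi - a)) * Num.min 1 (pospart (n%:R - xi)).

Lemma ramp_ge0 a n xi : 0 <= ramp a n xi.
Proof.
by rewrite mulr_ge0// le_min ler01 ?pospart_ge0 ?mulr_ge0 ?pospart_ge0.
Qed.

Lemma ramp_le1 a n xi : ramp a n xi <= 1.
Proof.
rewrite -[leRHS]mulr1 ler_pM ?ge_min ?lexx//.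
- by rewrite le_min ler01 mulr_ge0 ?pospart_ge0.
- by rewrite le_min ler01 pospart_ge0.
Qed.

Lemma continuous_ramp a n : continuous (ramp a n).
Proof.
have cp (g : R -> R) : continuous g -> continuous (fun x => pospart (g x)).
  move=> cg x; apply: (@continuous_comp _ _ _ g pospart); first exact: cg.
  exact: continuous_pospart.
have cm (g : R -> R) : continuous g -> continuous (fun x => Num.min 1 (g x)).
  by move=> cg x; apply: (@continuous_min _ _ (fun=> 1) g); [exact: cvg_cst|exact: cg].
have c1 : continuous (fun xi => Num.min 1 (n%:R * pospart (xi - a))).
  apply: cm => x; apply: cvgM; first exact: cvg_cst.
  apply: (cp (fun xi => xi - a)) => y; apply: cvgB; [exact: cvg_id|exact: cvg_cst].
have c2 : continuous (fun xi => Num.min 1 (pospart (n%:R - xi))).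
  apply: cm; apply: cp => y; apply: cvgB; [exact: cvg_cst|exact: cvg_id].
by move=> x; apply: cvgM; [exact: c1|exact: c2].
Qed.

Lemma ramp_C0 a n : C0 (ramp a n).
Proof.
split; first exact: continuous_ramp.
- apply: cvg_near_cst; near=> x; rewrite /ramp [pospart (n%:R - x)]pospart_eq0.
    by rewrite (min_r (@ler01 R)) mulr0.
  by rewrite subr_le0; near: x; apply: nbhs_pinfty_ge; exact: num_real.
- apply: cvg_near_cst; near=> x; rewrite /ramp [pospart (x - a)]pospart_eq0.
    by rewrite mulr0 (min_r (@ler01 R)) mul0r.
  by rewrite subr_le0; near: x; apply: nbhs_ninfty_le; exact: num_real.
Unshelve. all: by end_near. Qed.

Lemma cvg_ramp a xi : ramp a n xi @[n --> \oo] --> (\1_(`]a, +oo[%classic) xi : R).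
Proof.
rewrite indicE mem_setE in_itv/= andbT; have [axi|xia] := ltP a xi; last first.
  apply: cvg_near_cst; near=> n.
  by rewrite /ramp pospart_eq0 ?subr_le0// mulr0 (min_r (@ler01 R)) mul0r.
have d0 : 0 < xi - a by rewrite subr_gt0.
apply: cvg_near_cst; near=> n.
have h1 : 1 <= n%:R * (xi - a).
  by rewrite -ler_pdivrMr//; near: n; exact: nbhs_infty_ger.
have h2 : 1 <= n%:R - xi.
  by rewrite lerBrDl; near: n; exact: nbhs_infty_ger.
have h3 := ltW d0; have h4 := le_trans ler01 h2.
by rewrite /ramp (pospart_id h3) (pospart_id h4) !min_l// mulr1.
Unshelve. all: by end_near. Qed.

Lemma measurable_ramp a n : measurable_fun setT (ramp a n).
Proof. by apply: continuous_measurable_fun; exact: continuous_ramp. Qed.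

Lemma bounded_integrable d (T : measurableType d) (P : {finite_measure set T -> \bar R})
  (g : T -> R) (C : R) : measurable_fun setT g -> (forall x, `|g x| <= C) ->
  P.-integrable setT (EFin \o g).
Proof.
move=> mg gC; apply: measurable_bounded_integrable => //.
- by rewrite -ge0_fin_numE//; exact: fin_num_measure.
- by exists C; split; [exact: num_real|move=> M CM x _; apply: (le_trans (gC x)); exact: ltW].
Qed.

(** Testing against C0 functions determines the measurability of all the maps
    [z |-> nu_z(A)]: rays are bounded limits of C0 functions, and they generate. *)
Lemma young_measure_measurable d (Z : measurableType d) (D : set Z)
    (nu : Z -> probability R R) : measurable D -> young_measure D nu ->
  forall A, measurable A -> measurable_fun D (fun z => nu z A).
Proof.
move=> mD ynu A mA.
have : <<s @RGenOInfty.G R >> A.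
  by move: mA; rewrite -[<<s _ >>]RGenOInfty.measurableE.
apply: (@dynkin_induction _ R (@RGenOInfty.G R)
  [set A | measurable_fun D (fun z => nu z A)]).
- exact: RGenOInfty.measurableE.
- move=> _ _ [x ->] [y ->]; exists (Num.max x y).
  by apply/seteqP; split=> t /=; rewrite !in_itv/= !andbT gt_max; [move=> [-> ->]|move=> /andP].
- rewrite /=; under eq_fun do rewrite probability_setT; exact: measurable_cst.
- move=> _ [a ->] /=.
  apply: (@emeasurable_fun_cvg _ _ _ D (fun n z => (\int[nu z]_xi ramp a n xi)%:E)).
    move=> n; apply/measurable_EFinP; exact: ynu (ramp_C0 a n).
  move=> z Dz.
  have intr n : (nu z).-integrable setT (EFin \o ramp a n).
    apply: (@bounded_integrable _ _ _ _ 1); first exact: measurable_ramp.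
    by move=> x; rewrite ger0_norm ?ramp_ge0 ?ramp_le1.
  rewrite (_ : (fun n => _) = (fun n => \int[nu z]_xi (ramp a n xi)%:E)%E); last first.
    by apply/funext => n; rewrite /Rintegral fineK//; apply: integrable_fin_num => //; exact: intr.
  rewrite -[X in _ --> X](_ : \int[nu z]_xi (\1_(`]a, +oo[%classic) xi)%:E = _)%E; last first.
    by rewrite integral_indic// setIT.
  have [|||||_ _ //] := @dominated_convergence _ _ _ (nu z) setT measurableT
    (fun n xi => (ramp a n xi)%:E) (fun xi => (\1_(`]a, +oo[%classic) xi)%:E) (cst 1%E).
  + by move=> n; apply/measurable_EFinP; exact: measurable_ramp.
  + by apply/measurable_EFinP; exact: measurable_indic.
  + by apply: aeW => xi _; apply: cvg_EFin; [exact: nearW|exact: cvg_ramp].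
  + by apply: (@bounded_integrable _ _ _ (cst 1) 1) => // x; rewrite normr1.
  + by apply: aeW => xi n _; rewrite lee_fin ger0_norm ?ramp_ge0 ?ramp_le1.
- move=> S mS /= mnS; under eq_fun do rewrite probability_setC//.
  by apply: emeasurable_funB => //; exact: measurable_cst.
- move=> F mF tF /= mnF.
  rewrite (_ : (fun z => _) = (fun z => \sum_(0 <= k <oo) nu z (F k)))%E.
    by apply: ge0_emeasurable_sum => // k z _ _; exact: measure_ge0.
  by apply/funext => z; rewrite measure_semi_bigcup//; exact: bigcupT_measurable.
Qed.

Section family.
Context d (X : measurableType d) (P : X -> probability R R).
Hypothesis mP : forall A, measurable A -> measurable_fun setT (fun x => P x A).

(** A family with measurable evaluations is a probability kernel. *)
Lemma measurable_integral_family (k : X * R -> \bar R) :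
  measurable_fun setT k -> (forall p, (0 <= k p)%E) ->
  measurable_fun setT (fun x => \int[P x]_y k (x, y))%E.
Proof.
move=> mk k0.
pose K : X -> {measure set R -> \bar R} := fun x => P x.
pose KK := isKernel.Build _ _ X R R K mP.
pose K1 : kernel _ _ _ := HB.pack K KK.
have p1 x : K1 x setT = 1%E by exact: probability_setT.
pose KP := Kernel_isProbability.Build _ _ X R R K1 p1.
pose K2 : probability_kernel _ _ _ := HB.pack K KK KP.
exact: (@measurable_fun_integral_sfinite_kernel _ _ X R R k K2).
Qed.

Lemma measurable_Rintegral_family (k : X * R -> R) : measurable_fun setT k ->
  measurable_fun setT (fun x => \int[P x]_y k (x, y)).
Proof.
move=> mk; apply: measurableT_comp => //; have mEk := (measurable_EFinP _ _).2 mk.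
rewrite (_ : (fun x => _) = (fun x => \int[P x]_y ((EFin \o k)^\+ (x, y)) -
   \int[P x]_y ((EFin \o k)^\- (x, y))))%E; last first.
  apply/funext => x; rewrite [LHS]integralE.
  by congr (_ - _)%E; apply: eq_integral => y _; rewrite ?funeposE ?funenegE.
apply: emeasurable_funB.
  by apply: measurable_integral_family => //; exact: measurable_funepos.
by apply: measurable_integral_family => //; exact: measurable_funeneg.
Qed.

End family.

Lemma not_supp_null (mu : probability R R) xi : ~ supp mu xi ->
  exists p q : rat, ratr p < xi < ratr q /\
    mu `](ratr p : R), (ratr q : R)[%classic = 0%E.
Proof.
move=> /existsNP[U /not_implyP[oU /not_implyP[Uxi /negP]]]; rewrite -leNgt => mU.
have /nbhs_ballP[e /= e0 eU] : nbhs xi U by exact: open_nbhs_nbhs.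
have [p /andP[p1 p2]] : exists p : rat, xi - e < ratr p < xi.
  have := @rat_in_itvoo R (xi - e) xi; rewrite gtrBl => /(_ e0)[p].
  by rewrite in_itv; exists p.
have [q /andP[q1 q2]] : exists q : rat, xi < ratr q < xi + e.
  have := @rat_in_itvoo R xi (xi + e); rewrite ltrDl => /(_ e0)[q].
  by rewrite in_itv; exists q.
exists p, q; split; first by rewrite p2 q1.
apply/eqP; rewrite eq_le measure_ge0 andbT (le_trans _ mU)//.
apply: le_measure; rewrite ?inE//; first exact: open_measurable.
move=> x /=; rewrite in_itv/= => /andP[px xq]; apply: eU.
by rewrite /ball/= ltr_norml; apply/andP; split; lra.
Qed.

(** By second countability, a measure does not charge the complement of its support. *)
Lemma supp_null (mu : probability R R) (A : set R) :
  A `<=` ~` supp mu -> mu.-negligible A.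
Proof.
move=> As; pose F (n : nat) : set R := if unpickle n is Some (p, q) then
    if `[< mu `](ratr p : R), (ratr q : R)[%classic = 0%E >] then
      `](ratr p : R), (ratr q : R)[%classic else set0 else set0.
have FE p q : mu `](ratr p : R), (ratr q : R)[%classic = 0%E ->
    F (pickle (p, q)) = `](ratr p : R), (ratr q : R)[%classic.
  by move=> m0; rewrite /F pickleK (asboolT m0).
have Fn n : mu.-negligible (F n).
  rewrite /F; case: (unpickle n : option (rat * rat)) => [[p q]|].
    case: ifPn => [/asboolP h|_]; last exact: negligible_set0.
    by exists `](ratr p : R), (ratr q : R)[%classic; split.
  exact: negligible_set0.
clearbody F; apply: (@negligibleS _ _ _ mu (\bigcup_n F n)); last first.
  exact: negligible_bigcup.
move=> xi /As /not_supp_null [p [q [pq m0]]].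
exists (pickle (p, q)); first by [].
by rewrite (FE _ _ m0) /= in_itv.
Qed.

Lemma uniformly_bounded_ae d (Z : measurableType d) (D : set Z) (nu : Z -> probability R R) :
  uniformly_bounded D nu -> exists2 C : R, 0 <= C &
    forall z, D z -> {ae nu z, forall xi, `|xi| <= C}.
Proof.
move=> [K /compact_bounded[M [_ KM]] sK]; exists (`|M| + 1); first by rewrite addr_ge0.
move=> z Dz; apply: supp_null => xi /= nxi sxi; apply: nxi.
by apply: KM; [rewrite (le_lt_trans (ler_norm _))// ltrDl|exact: (sK z)].
Qed.

End young_measures.

(** * Distance to a Dirac mass *)

Section wasserstein.
Context {R : realType}.

Lemma measurable_abs_sub (v : R) : measurable_fun setT (fun x : R => `|v - x|%:E).
Proof. by apply/measurable_EFinP; apply: measurableT_comp => //; exact: measurable_funB. Qed.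

Lemma measurable_abs_sub2 : measurable_fun setT (fun z : R * R => `|z.1 - z.2|%:E).
Proof. by apply/measurable_EFinP; apply: measurableT_comp => //; exact: measurable_funB. Qed.

(** The product is the only coupling with a Dirac mass, so the infimum runs over a
    single value. *)
Lemma W1_dirac (mu : probability R R) (v : R) :
  W1 mu (\d_v) = (\int[mu]_xi `|v - xi|%:E)%E.
Proof.
apply/eqP; rewrite eq_le; apply/andP; split.
  apply: ereal_inf_lbound; exists (mu \x \d_v)%E.
    move=> A mA; split.
      apply: (etrans (product_measure1E _ _ mA measurableT)).
      by rewrite [X in (_ * X)%E](_ : _ = 1%E) ?mule1//; exact: diracT.
    apply: (etrans (product_measure1E _ _ measurableT mA)).
    by rewrite [X in (X * _)%E](_ : _ = 1%E) ?mul1e//; exact: probability_setT.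
  rewrite fubini_tonelli1//; last exact: measurable_abs_sub2.
  apply: eq_integral => x _; rewrite /fubini_F/= integral_dirac//; last first.
    exact: measurable_abs_sub.
  by rewrite diracT mul1e/= distrC.
apply: le_ereal_inf_tmp => _ [pi cpi <-].
have piv : {ae pi, forall z : R * R, z.2 = v}.
  exists (setT `*` [set~ v]); split.
  - apply: measurableX => //; exact: measurableC.
  - have [_ h] := cpi [set~ v] (measurableC (measurable_set1 v)).
    have -> : (0 = \d_v [set~ v] :> \bar R)%E by rewrite diracE memNset//=; apply.
    exact: h.
  - by move=> z /=.
rewrite le_eqVlt; apply/orP; left; apply/eqP.
transitivity (\int[pi]_z `|v - z.1|%:E)%E; last first.
  apply: ge0_ae_eq_integral => //.
  - exact: (measurableT_comp (measurable_abs_sub v) measurable_fst).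
  - exact: measurable_abs_sub2.
  - by apply: filterS piv => z -> _ /=; rewrite distrC.
have mf : measurable_fun setT (@fst R R) by exact: measurable_fst.
have abs0 : {in [set: R], forall x, (0 <= `|v - x|%:E)%E} by move=> x _; rewrite lee_fin.
have := ge0_integral_pushforward mf pi measurableT (measurable_abs_sub v) abs0.
rewrite preimage_setT => <-.
apply: eq_measure_integral => A mA _; have [h _] := cpi A mA.
transitivity (pi (A `*` setT)); first exact/esym/h.
by congr (pi _); apply/seteqP; split => z //= [].
Qed.

Lemma W1_L1norm_dirac d (mu : 'rV[R]_d -> probability R R) (v : 'rV[R]_d -> R) :
  W1_L1norm mu (dirac_young v) = L1_dist mu v.
Proof.
rewrite /W1_L1norm Lnorm1 /L1_dist; apply: eq_integral => x _.
by rewrite W1_dirac gee0_abs// integral_ge0.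
Qed.

(** The distance to [v] vanishes [mu]-almost everywhere, so [mu] charges no set that
    avoids [v]. *)
Lemma same_measure_dirac (mu : probability R R) (v : R) :
  (\int[mu]_xi `|v - xi|%:E = 0)%E -> same_measure mu (\d_v).
Proof.
move=> I0; have /ae_eq_integral_abs : (\int[mu]_xi `| `|v - xi|%:E| = 0)%E.
  by rewrite -[RHS]I0; apply: eq_integral => x _; rewrite gee0_abs.
move=> /(_ measurableT (measurable_abs_sub v)) ae0.
have aev : {ae mu, forall xi, xi = v}.
  apply: filterS ae0 => xi /(_ I)/= [] /eqP; rewrite normr_eq0 subr_eq0 => /eqP.
  by [].
have null B : measurable B -> ~ B v -> mu B = 0%E.
  move=> mB Bv; apply: measure_negligible => //; apply: negligibleS aev.
  by move=> xi Bxi /= xiv; apply: Bv; rewrite -xiv.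
move=> A mA; rewrite diracE; have [vA|nvA] := pselect (A v).
  rewrite mem_set//= -[A]setCK probability_setC; last exact: measurableC.
  rewrite null ?sube0//; first exact: measurableC.
by rewrite memNset// null.
Qed.

End wasserstein.

(** * The entropies of Kruzkov *)

Section kruzkov.
Context {R : realType} (d : nat).
Variable f : R -> 'rV[R]_d.
Hypothesis hf : C1_flux f.
Implicit Types (k xi C : R) (i : 'I_d) (j : 'I_d.+1).

(** [sgn(xi - k) (f xi - f k)], in a form that is visibly continuous and symmetric. *)
Definition kruzkov_flux k xi : 'rV[R]_d := f (Num.max k xi) - f (Num.min k xi).

Lemma kruzkov_fluxC k xi : kruzkov_flux k xi = kruzkov_flux xi k.
Proof. by rewrite /kruzkov_flux maxC minC. Qed.

Lemma kruzkov_flux_ge k xi : k <= xi -> kruzkov_flux k xi = f xi - f k.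
Proof. by move=> kxi; rewrite /kruzkov_flux max_r// min_l. Qed.

Lemma kruzkov_flux_le k xi : xi <= k -> kruzkov_flux k xi = f k - f xi.
Proof. by move=> kxi; rewrite /kruzkov_flux max_l// min_r. Qed.

Lemma continuous_flux : continuous f.
Proof.
move=> x; apply: differentiable_continuous; apply/derivable1_diffP; exact: hf.1.
Qed.

Lemma continuous_kruzkov_flux k : continuous (kruzkov_flux k).
Proof.
have cmax : continuous (fun xi => Num.max k xi).
  by move=> x; apply: (@continuous_max _ _ (fun=> k) id); [exact: cvg_cst|exact: cvg_id].
have cmin : continuous (fun xi => Num.min k xi).
  by move=> x; apply: (@continuous_min _ _ (fun=> k) id); [exact: cvg_cst|exact: cvg_id].
move=> x; apply: cvgB.
- by apply: (@continuous_comp _ _ _ (fun xi => Num.max k xi) f); [exact: cmax|exact: continuous_flux].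
- by apply: (@continuous_comp _ _ _ (fun xi => Num.min k xi) f); [exact: cmin|exact: continuous_flux].
Qed.

Lemma abs_not_derivable k : ~ derivable (fun xi : R => `|xi - k|) k 1.
Proof.
move=> /cvg_ex[l /cvgrPdist_lt /(_ (1 / 2))]; rewrite divr_gt0// => /(_ isT).
move=> [e /= e0 eP].
have e20 : 0 < e / 2 by rewrite divr_gt0.
have e2e : e / 2 < e by lra.
have h1 : `|l - 1| < 1 / 2.
  have := eP (e / 2); rewrite /ball_/= sub0r normrN gtr0_norm// gt_eqF// => /(_ e2e isT).
  rewrite (_ : _ *: _ = 1)//.
  rewrite [_ *: (1 : R)]mulr1 addrK subrr normr0 subr0 gtr0_norm//.
  by apply: mulVf; rewrite gt_eqF.
have h2 : `|l - (- 1)| < 1 / 2.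
  have := eP (- (e / 2)); rewrite /ball_/= sub0r opprK gtr0_norm//.
  rewrite oppr_eq0 gt_eqF// => /(_ e2e isT).
  rewrite (_ : _ *: _ = - 1)//.
  rewrite [_ *: (1 : R)]mulr1 addrK subrr normr0 subr0 normrN gtr0_norm//.
  by rewrite invrN scaleNr; congr (- _); apply: mulVf; rewrite gt_eqF.
move: h1 h2; rewrite !ltr_norml => /andP[? ?] /andP[? ?]; lra.
Qed.

(** On either side of [k] the entropy is affine with slope 1 or -1, which is the sign
    that [kruzkov_flux] gives to the increment of [f]; at [k] itself the entropy has no
    derivative. *)
Lemma kruzkov_entropy_pair k :
  entropy_pair f (fun xi => `|xi - k|) (kruzkov_flux k).
Proof.
split; last 1 first.
- move=> xi dxi; have [xik|kxi|xiE] := ltgtP xi k; last first.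
  + by exfalso; rewrite -xiE in dxi; exact: (abs_not_derivable dxi).
  + have df := hf.1 xi.
    have E1 : derive1 (fun xi : R => `|xi - k|) xi = 1.
      rewrite derive1E (@near_eq_derive _ _ _ _ (fun x : R => x - k)).
        have [] := @is_deriveB _ _ _ id (cst k) xi 1 _ _ (is_derive_id _ _) (is_derive_cst _ _ _).
        by rewrite subr0.
      near=> x; rewrite gtr0_norm// subr_gt0; near: x; exact: lt_nbhsr.
    rewrite E1 scale1r; apply: (@near_eq_is_derive _ _ _ (fun x => f x - f k)).
      near=> x; rewrite kruzkov_flux_ge//; apply: ltW; near: x; exact: lt_nbhsr.
    rewrite derive1E -[X in is_derive _ _ _ X]subr0.
    apply: is_deriveB; exact: derivableP.
  + have df := hf.1 xi.
    have E1 : derive1 (fun xi : R => `|xi - k|) xi = -1.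
      rewrite derive1E (@near_eq_derive _ _ _ _ (fun x : R => k - x)).
        have [] := @is_deriveB _ _ _ (cst k) id xi 1 _ _ (is_derive_cst _ _ _) (is_derive_id _ _).
        by rewrite sub0r.
      near=> x; rewrite ltr0_norm ?opprB// subr_lt0; near: x; exact: lt_nbhsl.
    rewrite E1 scaleN1r; apply: (@near_eq_is_derive _ _ _ (fun x => f k - f x)).
      near=> x; rewrite kruzkov_flux_le//; apply: ltW; near: x; exact: lt_nbhsl.
    rewrite derive1E -[X in is_derive _ _ _ X]sub0r.
    apply: is_deriveB; exact: derivableP.
- move=> t x y _ _; rewrite convRE.
  have E : (conv t x y : R) = t%:num * (x : R) + (1 - t%:num) * (y : R) by [].
  have t0 : 0 <= t%:num by [].
  have t1 : 0 <= 1 - t%:num by rewrite subr_ge0.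
  rewrite E /unstable.onem -[X in X * `|x - k|](ger0_norm t0) -[X in X * `|y - k|](ger0_norm t1).
  rewrite -!normrM (_ : _ - k = t%:num * ((x : R) - k) + (1 - t%:num) * ((y : R) - k)).
    exact: ler_normD.
  by move: (t%:num) => c; ring.
- exact: continuous_kruzkov_flux.
Unshelve. all: by end_near. Qed.

(** The entropy and the components of its flux as one family, indexed like the
    space-time directions, time first: an entropy inequality becomes a single sum. *)
Definition kruzkov j k xi : R :=
  if unlift ord0 j is Some i then kruzkov_flux k xi ord0 i else `|k - xi|.

Lemma kruzkov_sym j k xi : kruzkov j k xi = kruzkov j xi k.
Proof.
by rewrite /kruzkov; case: unlift => [i|]; [rewrite kruzkov_fluxC|rewrite distrC].
Qed.

Lemma kruzkov0 k xi : kruzkov ord0 k xi = `|k - xi|.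
Proof. by rewrite /kruzkov unlift_none. Qed.

Lemma kruzkovS i k xi : kruzkov (lift ord0 i) k xi = kruzkov_flux k xi ord0 i.
Proof. by rewrite /kruzkov liftK. Qed.

Lemma kruzkov_diag j k : kruzkov j k k = 0.
Proof.
by rewrite /kruzkov; case: unlift => [i|]; [rewrite kruzkov_flux_ge// subrr mxE|rewrite subrr normr0].
Qed.

Lemma flux_lipschitz C : exists2 L, 1 <= L & forall i xi zeta,
  `|xi| <= C -> `|zeta| <= C -> `|f xi ord0 i - f zeta ord0 i| <= L * `|xi - zeta|.
Proof.
have cf' : continuous (fun x => derive1 f x) by exact: hf.2.
have /compact_bounded[M [_ MP]] : compact (derive1 f @` `[- C, C]).
  by apply: continuous_compact; [exact: continuous_subspaceT|exact: segment_compact].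
exists (`|M| + 1); first by rewrite lerDr.
have fM x : `|x| <= C -> `|derive1 f x| <= `|M| + 1.
  move=> xC; apply: MP; first by rewrite (le_lt_trans (ler_norm _))// ltrDl.
  by exists x => //=; rewrite in_itv/= -ler_norml.
move=> i.
have main xi zeta : xi <= zeta -> `|xi| <= C -> `|zeta| <= C ->
    `|f zeta ord0 i - f xi ord0 i| <= (`|M| + 1) * `|zeta - xi|.
  move=> xz xC zC.
  have dfi x : is_derive x (1 : R) (fun y => f y ord0 i) (derive1 f x ord0 i).
    have dx := hf.1 x; rewrite derive1E derive_mx// mxE.
    apply: DeriveDef => //; exact: (derivable_mxP _ _ _).1.
  have [|c cxz ->] := @MVT_segment _ (fun y => f y ord0 i) (fun x => derive1 f x ord0 i) xi zeta xz (fun x _ => dfi x).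
    apply: continuous_subspaceT => x; apply: differentiable_continuous.
    by apply/derivable1_diffP; have [] := dfi x.
  rewrite normrM ler_wpM2r//; apply: le_trans (fM c _).
    by rewrite {2}/Num.norm/= mx_normrE; apply: (le_trans _ (le_bigmax _ _ (ord0, i))).
  by move: cxz xC zC; rewrite in_itv/= !ler_norml => /andP[? ?] /andP[? ?] /andP[? ?];
    apply/andP; split; lra.
move=> xi zeta xC zC; have [xz|/ltW zx] := leP xi zeta; last exact: main.
by rewrite distrC [`|xi - zeta|]distrC; exact: main.
Qed.

Lemma kruzkov_lipschitz C : exists2 L, 1 <= L & forall j k k' xi,
  `|k| <= C -> `|k'| <= C -> `|xi| <= C ->
  `|kruzkov j k xi - kruzkov j k' xi| <= L * `|k - k'|.
Proof.
have [L L1 LP] := flux_lipschitz C; exists L => // j k k' xi kC kC' xC.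
rewrite /kruzkov; case: unlift => [i|]; last first.
  have := ler_dist_dist (k - xi) (k' - xi); rewrite opprB addrA subrK => h.
  by apply: (le_trans h); rewrite ler_peMl.
rewrite /kruzkov_flux !mxE.
wlog kk : k k' kC kC' / k <= k'.
  move=> H; have [|/ltW kk'] := leP k k'; first exact: H.
  by rewrite distrC [`|k - k'|]distrC; exact: H.
have nk : `|k' - k| = k' - k by rewrite ger0_norm// subr_ge0.
rewrite [`|k - k'|]distrC nk.
have /orP[xk|kx] := le_total xi k.
  have xk' := le_trans xk kk; rewrite !max_l// !min_r//.
  rewrite (_ : _ - _ = f k ord0 i - f k' ord0 i); last ring.
  by rewrite -nk [`|k' - k|]distrC; exact: LP.
(* For [k <= xi <= k'] the two increments of [f] are controlled by [xi - k] and
   [k' - xi], which add up to [k' - k]. *)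
have /orP[xk'|kx'] := le_total xi k'.
  rewrite (max_r kx) (min_l kx) (max_l xk') (min_r xk').
  have h1 := LP i _ _ xC kC; have h2 := LP i _ _ xC kC'.
  have n1 : `|xi - k| = xi - k by rewrite ger0_norm// subr_ge0.
  have n2 : `|xi - k'| = k' - xi by rewrite distrC ger0_norm// subr_ge0.
  rewrite n1 in h1; rewrite n2 in h2.
  by move: h1 h2; rewrite !ler_norml => /andP[? ?] /andP[? ?]; apply/andP; split; lra.
rewrite (max_r kx) (max_r kx') (min_l kx) (min_l kx').
rewrite (_ : _ - _ = f k' ord0 i - f k ord0 i); last ring.
by rewrite -nk; exact: LP.
Qed.

Lemma measurable_kruzkov j : measurable_fun setT (fun p : R * R => kruzkov j p.1 p.2).
Proof.
have mfi i : measurable_fun setT (fun x => f x ord0 i).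
  apply: continuous_measurable_fun => x.
  apply: (@continuous_comp _ _ _ f (fun v : 'rV[R]_d => v ord0 i)).
    exact: continuous_flux.
  exact: coord_continuous.
rewrite /kruzkov; case: unlift => [i|]; last first.
  by apply: measurableT_comp => //; exact: measurable_funB.
rewrite /kruzkov_flux; under eq_fun do rewrite !mxE.
apply: measurable_funB.
  apply: (measurableT_comp (mfi i) (measurable_maxr _ _)) => //.
apply: (measurableT_comp (mfi i) (measurable_minr _ _)) => //.
Qed.

End kruzkov.

Section Rintegral_Fubini.
Context {R : realType} d1 d2 (T1 : measurableType d1) (T2 : measurableType d2).
Variables (m1 : {sigma_finite_measure set T1 -> \bar R}).
Variables (m2 : {sigma_finite_measure set T2 -> \bar R}).
Variable F : T1 * T2 -> R.
Hypothesis iF : (m1 \x m2)%E.-integrable setT (EFin \o F).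

Lemma Rintegral_fubini1 :
  \int[m1]_x \int[m2]_y F (x, y) = \int[(m1 \x m2)%E]_z F z.
Proof.
rewrite /Rintegral -(integral12_prod_meas1 iF); congr fine.
have mF := measurable_fubini_F iF.
apply: ae_eq_integral => //.
  by apply/measurable_EFinP; apply: measurableT_comp.
apply: filterS (ae_integrable1 iF) => x ix _.
by rewrite /fubini_F fineK//; exact: integrable_fin_num.
Qed.

Lemma Rintegral_fubini2 :
  \int[m2]_y \int[m1]_x F (x, y) = \int[(m1 \x m2)%E]_z F z.
Proof.
rewrite /Rintegral -(integral21_prod_meas1 iF); congr fine.
have mF := measurable_fubini_G iF.
apply: ae_eq_integral => //.
  by apply/measurable_EFinP; apply: measurableT_comp.
apply: filterS (ae_integrable2 iF) => x ix _.
by rewrite /fubini_G fineK//; exact: integrable_fin_num.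
Qed.

End Rintegral_Fubini.

Section integration_tools.
Context {R : realType}.

Lemma integrable_bounded_support d (T : measurableType d)
    (m : {measure set T -> \bar R}) (A : set T) (F : T -> R) C :
  measurable A -> (m A < +oo)%E -> measurable_fun setT F ->
  (forall x, `|F x| <= C) -> (forall x, ~ A x -> F x = 0) ->
  m.-integrable setT (EFin \o F).
Proof.
move=> mA Aoo mF FC F0.
have -> : EFin \o F = (EFin \o F) \_ A.
  by apply/funext => x; rewrite patchE; case: ifPn => // /negP nA;
    rewrite /= F0// => Ax; apply: nA; rewrite inE.
apply/(integrable_mkcond _ mA).1; apply: measurable_bounded_integrable => //.
  exact: measurable_funTS.
exists C; split; first exact: num_real.
by move=> M CM x _; apply: (le_trans (FC x)); exact: ltW.
Qed.

Lemma integrable_bounded_support_prod d1 d2 (T1 : measurableType d1)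
    (T2 : measurableType d2) (m1 : {sigma_finite_measure set T1 -> \bar R})
    (m2 : {sigma_finite_measure set T2 -> \bar R}) (A : set T1) (B : set T2)
    (F : T1 * T2 -> R) C :
  measurable A -> measurable B -> (m1 A < +oo)%E -> (m2 B < +oo)%E ->
  measurable_fun setT F -> (forall p, `|F p| <= C) ->
  (forall x y, ~ A x -> F (x, y) = 0) -> (forall x y, A x -> ~ B y -> F (x, y) = 0) ->
  (m1 \x m2)%E.-integrable setT (EFin \o F).
Proof.
move=> mA mB Aoo Boo mF FC F1 F2.
apply: (@integrable_bounded_support _ _ _ (A `*` B) _ C) => //.
- exact: measurableX.
- by rewrite /= product_measure1E// ltey_eq fin_numM// ge0_fin_numE.
- move=> [x y] nAB; have [Ax|nA] := pselect (A x); last exact: F1.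
  by apply: F2 => // By; apply: nAB.
Qed.

End integration_tools.

(** * Weak formulations as space-time integrals *)

Section weak_form.
Context {R : realType} (d : nat).
Local Notation Z := ('rV[R]_d * measurableTypeR R)%type.
Local Notation mu := (@space_time_measure R d).
Implicit Types (z w : Z) (phi psi : Z -> R) (j : 'I_d.+1).

(** For a test function that vanishes at time 0 the initial datum drops out, and
    Fubini turns the iterated integral into one over space-time. *)
Lemma weak_form_integral phi a b a0 (F : Z -> R) :
  mu.-integrable setT (EFin \o F) ->
  (forall z, 0 <= z.2 -> dt phi z * a z + dotrV (grad phi z) (b z) = F z) ->
  (forall z, z.2 < 0 -> F z = 0) -> (forall x, phi (x, 0) = 0) ->
  weak_form phi a b a0 = \int[mu]_z F z.
Proof.
move=> iF Fge Flt phi0; rewrite /weak_form [X in _ + X](_ : _ = 0) ?addr0; last first.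
  under eq_Rintegral do rewrite phi0 mul0r.
  by rewrite /Rintegral integral0.
rewrite /space_time_measure -(Rintegral_fubini2 iF) Rintegral_mkcond.
apply: eq_Rintegral => t _; rewrite patchE; case: ifPn => [|nt].
  rewrite inE/= in_itv/= andbT => t0; apply: eq_Rintegral => x _.
  exact: (Fge (x, t)).
rewrite -[LHS](_ : \int[lebesgue_rV d]_x (0 : R) = 0); last by rewrite /Rintegral integral0.
apply: eq_Rintegral => x _; rewrite Flt//= ltNge; apply/negP => t0; move/negP: nt; apply.
by rewrite inE/= in_itv/= andbT.
Qed.

Definition zdir j : Z :=
  if unlift ord0 j is Some i then (delta_mx ord0 i, 0) else (0, 1).

Lemma zdir0 : zdir ord0 = (0, 1). Proof. by rewrite /zdir unlift_none. Qed.

Lemma zdirS (i : 'I_d) : zdir (lift ord0 i) = (delta_mx ord0 i, 0).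
Proof. by rewrite /zdir liftK. Qed.

Lemma weak_integrandE phi (a : Z -> R) (b : Z -> 'rV[R]_d) (K : 'I_d.+1 -> Z -> R) z :
  a z = K ord0 z -> (forall i, b z ord0 i = K (lift ord0 i) z) ->
  dt phi z * a z + dotrV (grad phi z) (b z) = \sum_j 'D_(zdir j) phi z * K j z.
Proof.
move=> aE bE; rewrite big_ord_recl zdir0 -aE; congr (_ + _).
by apply: eq_bigr => i _; rewrite mxE bE zdirS.
Qed.

Lemma measurable_weak_integrand phi (K : 'I_d.+1 -> Z -> R) : C1 phi ->
  (forall j, measurable_fun setT (K j)) ->
  measurable_fun setT (fun z => \sum_j 'D_(zdir j) phi z * K j z).
Proof.
move=> Cphi mK; apply: measurable_sum => j; apply: measurable_funM; last exact: mK.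
by apply: continuous_measurable_space_time; exact: Cphi.2.
Qed.

Lemma test_function_bound r phi : C1 phi -> vanishes_off r phi ->
  exists2 M, 0 <= M & forall z, `|phi z| <= M /\ forall j, `|'D_(zdir j) phi z| <= M.
Proof.
move=> Cphi phi0.
have [M0 M00 M0P] := vanishes_off_bounded (C1_continuous Cphi) phi0.
have Mj j : exists M : R, 0 <= M /\ forall z, `|'D_(zdir j) phi z| <= M.
  have [M ? MP] := vanishes_off_bounded (Cphi.2 (zdir j)) (vanishes_off_derive (zdir j) phi0).
  by exists M.
have [M_ M_P] := choice Mj; exists (M0 + \sum_j M_ j).
  by rewrite addr_ge0// sumr_ge0// => j _; have [] := M_P j.
move=> z; split=> [|j].
  apply: (le_trans (M0P z)); rewrite lerDl sumr_ge0// => j _; by have [] := M_P j.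
have [_ /(_ z) h] := M_P j; apply: (le_trans h).
rewrite (bigD1 j)//= addrCA lerDl addr_ge0// sumr_ge0// => k _; by have [] := M_P k.
Qed.

Lemma weak_integrand_bound phi (K : 'I_d.+1 -> Z -> R) M B z :
  (forall j, `|'D_(zdir j) phi z| <= M) -> (forall j, `|K j z| <= B) ->
  `|\sum_j 'D_(zdir j) phi z * K j z| <= d.+1%:R * (M * B).
Proof.
move=> MP BP; apply: (le_trans (ler_norm_sum _ _ _)).
apply: (@le_trans _ _ (\sum_(j < d.+1) M * B)); last first.
  by rewrite sumr_const card_ord mulr_natl.
by apply: ler_sum => j _; rewrite normrM ler_pM.
Qed.

Lemma integrable_weak_integrand r phi (K : 'I_d.+1 -> Z -> R) B : C1 phi ->
  vanishes_off r phi ->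
  (forall j, measurable_fun setT (K j)) -> (forall j z, `|K j z| <= B) ->
  mu.-integrable setT (EFin \o (fun z => \sum_j 'D_(zdir j) phi z * K j z)).
Proof.
move=> Cphi phi0 mK KB; have [M M0 MP] := test_function_bound Cphi phi0.
apply: (@integrable_bounded_support _ _ _ _ (cbox r) _ (d.+1%:R * (M * B))).
- exact: measurable_cbox.
- exact: cbox_lty.
- exact: measurable_weak_integrand.
- by move=> z; apply: weak_integrand_bound => // j; exact: (MP z).2.
- move=> z nz; apply: big1 => j _.
  by rewrite (vanishes_off_derive (zdir j) phi0)// mul0r.
Qed.

End weak_form.

(** * Entropies averaged against a Young measure *)

Section averaged_entropy.
Context {R : realType} (d : nat).
Local Notation Z := ('rV[R]_d * measurableTypeR R)%type.
Local Notation mu := (@space_time_measure R d).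
Variables (f : R -> 'rV[R]_d) (hf : C1_flux f) (C : R) (C0 : 0 <= C).
Variables (nu : Z -> probability R R).
Hypothesis mnu : forall A, measurable A -> measurable_fun setT (fun z => nu z A).
Implicit Types (j : 'I_d.+1) (z w : Z) (k xi : R).

Definition clamp xi : R := Num.max (- C) (Num.min xi C).

Lemma clamp_le xi : `|clamp xi| <= C.
Proof.
rewrite ler_norml /clamp le_max lexx/= ge_max ge_min lexx orbT andbT.
by rewrite (le_trans _ C0)// oppr_le0.
Qed.

Lemma clamp_id xi : `|xi| <= C -> clamp xi = xi.
Proof. by rewrite ler_norml => /andP[? ?]; rewrite /clamp min_l// max_r. Qed.

Lemma measurable_clamp : measurable_fun setT clamp.
Proof. by apply: measurable_maxr => //; exact: measurable_minr. Qed.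

(** Clamping does not change the average for a measure carried by the interval from
    [-C] to [C], and makes the integrand bounded everywhere. *)
Definition averaged_kruzkov j z k : R := \int[nu z]_xi kruzkov f j k (clamp xi).

Lemma measurable_averaged_kruzkov j :
  measurable_fun setT (fun p : Z * R => averaged_kruzkov j p.1 p.2).
Proof.
apply: (@measurable_Rintegral_family _ _ (Z * R)%type (fun p => nu p.1) _
  (fun q : (Z * R) * R => kruzkov f j q.1.2 (clamp q.2))).
  by move=> A mA; exact: (measurableT_comp (mnu mA) measurable_fst).
have mp : measurable_fun setT (fun q : (Z * R) * R => (q.1.2, clamp q.2)).
  apply: measurable_fun_pair; first exact: (measurableT_comp measurable_snd measurable_fst).
  exact: (measurableT_comp measurable_clamp measurable_snd).
exact: (measurableT_comp (measurable_kruzkov hf j) mp).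
Qed.

Lemma Rintegral_probability_le (P : probability R R) (g : R -> R) B :
  measurable_fun setT g -> (forall xi, `|g xi| <= B) -> `|\int[P]_xi g xi| <= B.
Proof.
move=> mg gB; have ig := bounded_integrable P mg gB.
apply: (le_trans (le_normr_Rintegral measurableT ig)).
rewrite -[leRHS](_ : \int[P]_xi B = _); last first.
  rewrite Rintegral_cst// [X in fine X](_ : _ = 1%E) ?mulr1//.
  exact: probability_setT.
apply: le_Rintegral => //.
- by apply: (@bounded_integrable _ _ _ _ _ B); [exact: measurableT_comp|move=> x; rewrite normr_id].
- by apply: (@bounded_integrable _ _ _ _ (cst B) `|B|).
Qed.

Lemma measurable_kruzkov_clamp j k : measurable_fun setT (fun xi => kruzkov f j k (clamp xi)).
Proof.
have mp : measurable_fun setT (fun xi => (k, clamp xi)).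
  by apply: measurable_fun_pair; [exact: measurable_cst|exact: measurable_clamp].
exact: (measurableT_comp (measurable_kruzkov hf j) mp).
Qed.

Variables (L : R) (L1 : 1 <= L).
Hypothesis LP : forall j k k' xi, `|k| <= C -> `|k'| <= C -> `|xi| <= C ->
  `|kruzkov f j k xi - kruzkov f j k' xi| <= L * `|k - k'|.

Lemma kruzkov_dominated j k xi : `|k| <= C -> `|xi| <= C ->
  `|kruzkov f j k xi| <= L * kruzkov f ord0 k xi.
Proof.
move=> kC xiC; rewrite kruzkov0.
by have := LP j kC xiC xiC; rewrite kruzkov_diag subr0.
Qed.

Lemma kruzkov_bounded j k xi : `|k| <= C -> `|xi| <= C ->
  `|kruzkov f j k xi| <= L * (2 * C).
Proof.
move=> kC xiC; apply: (le_trans (kruzkov_dominated j kC xiC)); rewrite kruzkov0.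
rewrite ler_wpM2l ?(le_trans ler01)//; apply: (le_trans (ler_normB _ _)); lra.
Qed.

Lemma integrable_kruzkov_clamp j z k : `|k| <= C ->
  (nu z).-integrable setT (EFin \o (fun xi => kruzkov f j k (clamp xi))).
Proof.
move=> kC; apply: (@bounded_integrable _ _ _ _ _ (L * (2 * C))).
  exact: measurable_kruzkov_clamp.
by move=> xi; apply: kruzkov_bounded => //; exact: clamp_le.
Qed.

Lemma averaged_kruzkov_lipschitz j z k k' : `|k| <= C -> `|k'| <= C ->
  `|averaged_kruzkov j z k - averaged_kruzkov j z k'| <= L * `|k - k'|.
Proof.
move=> kC kC'; rewrite /averaged_kruzkov -RintegralB//; last 2 first.
- exact: integrable_kruzkov_clamp.
- exact: integrable_kruzkov_clamp.
apply: Rintegral_probability_le.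
  by apply: measurable_funB; exact: measurable_kruzkov_clamp.
by move=> xi; apply: LP => //; exact: clamp_le.
Qed.

Lemma averaged_kruzkov_bounded j z k : `|k| <= C ->
  `|averaged_kruzkov j z k| <= L * (2 * C).
Proof.
move=> kC; apply: Rintegral_probability_le; first exact: measurable_kruzkov_clamp.
by move=> xi; apply: kruzkov_bounded => //; exact: clamp_le.
Qed.

(** Finite speed of propagation: the flux of the distance is at most [L] times the
    distance. *)
Lemma averaged_kruzkov_dominated j z k : `|k| <= C ->
  `|averaged_kruzkov j z k| <= L * averaged_kruzkov ord0 z k.
Proof.
move=> kC; have ij := integrable_kruzkov_clamp j z kC.
apply: (le_trans (le_normr_Rintegral measurableT ij)).
have i0 := integrable_kruzkov_clamp ord0 z kC.
rewrite /averaged_kruzkov -RintegralZl//; apply: le_Rintegral => //.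
- exact: integrable_norm.
- apply: (@bounded_integrable _ _ _ _ _ (L * (L * (2 * C)))).
    by apply: measurable_funM => //; exact: measurable_kruzkov_clamp.
  move=> xi; rewrite normrM ger0_norm ?(le_trans ler01)// ler_wpM2l ?(le_trans ler01)//.
  by apply: kruzkov_bounded => //; exact: clamp_le.
- by move=> xi _; apply: kruzkov_dominated => //; exact: clamp_le.
Qed.

Lemma averaged_kruzkov0_ge0 z k : 0 <= averaged_kruzkov ord0 z k.
Proof. by apply: Rintegral_ge0 => xi _; rewrite kruzkov0. Qed.

End averaged_entropy.

Lemma Rintegral_lincomb {R : realType} d (T : measurableType d)
    (m : {measure set T -> \bar R}) (I : Type) (s : seq I) (c : I -> R) (g : I -> T -> R) :
  (forall i, m.-integrable setT (EFin \o g i)) ->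
  m.-integrable setT (EFin \o (fun x => \sum_(i <- s) c i * g i x)) /\
  \int[m]_x (\sum_(i <- s) c i * g i x) = \sum_(i <- s) c i * \int[m]_x g i x.
Proof.
move=> ig; elim: s => [|i s [IH1 IH2]].
  rewrite big_nil; split; under eq_fun do rewrite big_nil; first exact: integrable0.
  by rewrite /Rintegral integral0.
have icg : m.-integrable setT (EFin \o (fun x => c i * g i x)).
  by have := integrableZl measurableT (c i) (ig i).
split.
  rewrite (_ : EFin \o _ = ((EFin \o (fun x => c i * g i x)%R) \+
    (EFin \o (fun x => \sum_(i <- s) c i * g i x)%R))%E); first exact: integrableD.
  by apply/funext => x; rewrite /= big_cons EFinD.
under eq_Rintegral do rewrite big_cons.
by rewrite big_cons RintegralD// RintegralZl// IH2.
Qed.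

(** * Doubling of variables *)

Section doubling_of_variables.
Context {R : realType} (d : nat).
Local Notation Z := ('rV[R]_d * measurableTypeR R)%type.
Local Notation mu := (@space_time_measure R d).
Variables (f : R -> 'rV[R]_d) (hf : C1_flux f) (C : R) (C0 : 0 <= C).
Variables (nu : Z -> probability R R) (u : Z -> R).
Hypothesis mnu : forall A, measurable A -> measurable_fun setT (fun z => nu z A).
Hypothesis mu_ : measurable_fun setT u.
Hypothesis uC : forall z, `|u z| <= C.
Implicit Types (j : 'I_d.+1) (z w : Z) (k xi e r : R) (phi psi : Z -> R).

Local Notation K := (averaged_kruzkov f C nu).

(** Test functions that do not see the initial data. *)
Definition admissible phi : Prop :=
  [/\ test_function phi, forall z, 0 <= phi z & forall z, z.2 <= 0 -> phi z = 0].

Hypothesis entropy_nu : forall k phi, `|k| <= C -> admissible phi ->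
  0 <= \int[mu]_z \sum_j 'D_(zdir j) phi z * K j z k.
Hypothesis entropy_u : forall k phi, `|k| <= C -> admissible phi ->
  0 <= \int[mu]_z \sum_j 'D_(zdir j) phi z * kruzkov f j k (u z).

Section fixed_test_function.
Variable psi : Z -> R.
Hypothesis psiA : admissible psi.
Variables (r : R) (r0 : 0 <= r).
Hypothesis psi_off : vanishes_off r psi.
Let Cpsi : C1 psi. Proof. by case: psiA => /test_function_C1[]. Qed.

Lemma integrable_double (F : Z * Z -> R) B : measurable_fun setT F ->
  (forall p, `|F p| <= B) ->
  (forall z w, ~ cbox r z -> F (z, w) = 0) ->
  (forall z w, cbox r z -> ~ cbox (r + 3) w -> F (z, w) = 0) ->
  (mu \x mu)%E.-integrable setT (EFin \o F).
Proof.
move=> mF FB F1 F2.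
apply: (@integrable_bounded_support_prod _ _ _ _ _ _ _ (cbox r) (cbox (r + 3)) _ B) => //.
- exact: measurable_cbox.
- exact: measurable_cbox.
- exact: cbox_lty.
- exact: cbox_lty.
Qed.

Lemma measurable_averaged_double j :
  measurable_fun setT (fun p : Z * Z => K j p.1 (u p.2)).
Proof.
have mp : measurable_fun setT (fun p : Z * Z => (p.1, u p.2)).
  apply: measurable_fun_pair; first exact: measurable_fst.
  exact: (measurableT_comp mu_ measurable_snd).
have h := measurable_averaged_kruzkov hf C mnu j.
exact: (measurableT_comp h mp).
Qed.

Lemma measurable_averaged_trace j :
  measurable_fun setT (fun z : Z => K j z (u z)).
Proof.
have mp : measurable_fun setT (fun z : Z => (z, u z)) by exact: measurable_fun_pair.
have h := measurable_averaged_kruzkov hf C mnu j.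
exact: (measurableT_comp h mp).
Qed.

Variables (L : R) (L1 : 1 <= L).
Hypothesis LP : forall j k k' xi, `|k| <= C -> `|k'| <= C -> `|xi| <= C ->
  `|kruzkov f j k xi - kruzkov f j k' xi| <= L * `|k - k'|.

Variables (e : R) (e0 : 0 < e) (e1 : e <= 1).
Local Notation om := (@mollifier R d e).
Let Com : C1 om. Proof. exact: C1_mollifier. Qed.

(* In [alpha] the derivatives fall on [psi], in [beta] on the mollifier; [alpha0] is
   [alpha] with [u] evaluated at the same point as [nu]. *)
Let alpha (p : Z * Z) := (\sum_j 'D_(zdir j) psi p.1 * K j p.1 (u p.2)) * om (p.2 - p.1).
Let beta (p : Z * Z) := (\sum_j 'D_(zdir j) om (p.2 - p.1) * K j p.1 (u p.2)) * psi p.1.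
Let alpha0 (p : Z * Z) := (\sum_j 'D_(zdir j) psi p.1 * K j p.1 (u p.1)) * om (p.2 - p.1).

Let mom : measurable_fun setT (fun p : Z * Z => om (p.2 - p.1)).
Proof. by apply: measurable_continuous_sub; exact: C1_continuous. Qed.

Let mDpsi j : measurable_fun setT (fun p : Z * Z => 'D_(zdir j) psi p.1).
Proof.
have h : measurable_fun setT (fun z => 'D_(zdir j) psi z).
  by apply: continuous_measurable_space_time; exact: Cpsi.2.
exact: (measurableT_comp h measurable_fst).
Qed.

Let malpha : measurable_fun setT alpha.
Proof.
apply: measurable_funM => //; apply: measurable_sum => j; apply: measurable_funM => //.
exact: measurable_averaged_double.
Qed.

Let malpha0 : measurable_fun setT alpha0.
Proof.
apply: measurable_funM => //; apply: measurable_sum => j; apply: measurable_funM => //.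
exact: (measurableT_comp (measurable_averaged_trace j) measurable_fst).
Qed.

Let mbeta : measurable_fun setT beta.
Proof.
apply: measurable_funM.
  apply: measurable_sum => j; apply: measurable_funM.
    by apply: (measurable_continuous_sub (g := fun x => 'D_(zdir j) om x)); exact: Com.2.
  exact: measurable_averaged_double.
have h : measurable_fun setT psi.
  by apply: continuous_measurable_space_time; exact: C1_continuous.
exact: (measurableT_comp h measurable_fst).
Qed.

Let om_off z w : cbox r z -> ~ cbox (r + 3) w ->
  om (w - z) = 0 /\ forall j, 'D_(zdir j) om (w - z) = 0.
Proof.
move=> zr nw; have nw' : ~ cbox (r + 3 * e) w.
  by move=> h; apply: nw; apply: le_cbox h; rewrite lerD2l ler_piMr.
have om0 := @mollifier_vanishes_off _ d _ e0.
split=> [|j]; first exact: (vanishes_off_translate zr om0).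
exact: (vanishes_off_translate zr (vanishes_off_derive (zdir j) om0)).
Qed.

Let Dpsi_off z j : ~ cbox r z -> 'D_(zdir j) psi z = 0.
Proof. exact: vanishes_off_derive. Qed.

Let KB j z w : `|K j z (u w)| <= L * (2 * C).
Proof. exact: averaged_kruzkov_bounded. Qed.

Let ialpha : (mu \x mu)%E.-integrable setT (EFin \o alpha).
Proof.
have [M M0 MP] := test_function_bound Cpsi psi_off.
have [N N0 NP] := test_function_bound Com (@mollifier_vanishes_off _ d _ e0).
apply: (@integrable_double _ (d.+1%:R * (M * (L * (2 * C))) * N)) => //.
- move=> [z w]; rewrite /alpha normrM ler_pM//=; last exact: (NP _).1.
  by apply: (weak_integrand_bound (K := fun j _ => K j z (u w))) => // j; exact: (MP z).2.
- by move=> z w nz; rewrite /alpha big1 ?mul0r//= => j _; rewrite Dpsi_off// mul0r.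
- by move=> z w zr nw; rewrite /alpha /= (om_off zr nw).1 mulr0.
Qed.

Let ialpha0 : (mu \x mu)%E.-integrable setT (EFin \o alpha0).
Proof.
have [M M0 MP] := test_function_bound Cpsi psi_off.
have [N N0 NP] := test_function_bound Com (@mollifier_vanishes_off _ d _ e0).
apply: (@integrable_double _ (d.+1%:R * (M * (L * (2 * C))) * N)) => //.
- move=> [z w]; rewrite /alpha0 normrM ler_pM//=; last exact: (NP _).1.
  by apply: (weak_integrand_bound (K := fun j _ => K j z (u z))) => // j; exact: (MP z).2.
- by move=> z w nz; rewrite /alpha0 big1 ?mul0r//= => j _; rewrite Dpsi_off// mul0r.
- by move=> z w zr nw; rewrite /alpha0 /= (om_off zr nw).1 mulr0.
Qed.

Let ibeta : (mu \x mu)%E.-integrable setT (EFin \o beta).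
Proof.
have [M M0 MP] := test_function_bound Cpsi psi_off.
have [N N0 NP] := test_function_bound Com (@mollifier_vanishes_off _ d _ e0).
apply: (@integrable_double _ (d.+1%:R * (N * (L * (2 * C))) * M)) => //.
- move=> [z w]; rewrite /beta normrM ler_pM//=; last exact: (MP _).1.
  by apply: (weak_integrand_bound (K := fun j _ => K j z (u w))) => // j; exact: (NP _).2.
- by move=> z w nz; rewrite /beta /= psi_off// mulr0.
- move=> z w zr nw; rewrite /beta big1 ?mul0r//= => j _.
  by rewrite (om_off zr nw).2 mul0r.
Qed.

Let psi_test_z w : admissible (fun z => psi z * om (w - z)).
Proof.
have [_ psi0 psi_neg] := psiA; split.
- apply: (@C1_test_function _ _ r).
    by apply: C1_mul => //; exact: C1_reflect.
  by move=> z nz; rewrite psi_off// mul0r.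
- by move=> z; rewrite mulr_ge0// mollifier_ge0.
- by move=> z z0; rewrite psi_neg// mul0r.
Qed.

Let psi_test_w z : admissible (fun w => psi z * om (w - z)).
Proof.
have [_ psi0 psi_neg] := psiA; have om0 := @mollifier_vanishes_off _ d _ e0.
have [rz rz0 zrz] : exists2 rz : R, 0 <= rz & cbox rz z.
  have [rz rz0 h] := compact_sub_cbox (@compact_set1 _ z); exists rz => //; exact: h.
split.
- apply: (@C1_test_function _ _ (rz + 3 * e)).
    by apply: C1_mul; [exact: C1_cst|exact: C1_translate].
  by move=> w nw; rewrite (vanishes_off_translate zrz om0)// mulr0.
- by move=> w; rewrite mulr_ge0// mollifier_ge0.
- move=> w w0; have [z0|z0] := leP z.2 0; first by rewrite psi_neg// mul0r.
  have [->|/(mollifier_neq0 e0)[_ /andP[+ _]]] := eqVneq (om (w - z)) 0.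
    by rewrite mulr0.
  by rewrite /= subr_gt0 => /(lt_trans z0); rewrite ltNge w0.
Qed.

(* The inequality of [nu] in the variable [z], with [k := u w].  The mollifier is
   [mollifier e (w - z)], whence the sign of [beta]. *)
Let ge0_alpha_beta : 0 <= \int[(mu \x mu)%E]_p (alpha p - beta p).
Proof.
have iab : (mu \x mu)%E.-integrable setT (EFin \o (fun p => alpha p - beta p)).
  exact: (integrableB measurableT ialpha ibeta).
rewrite -(Rintegral_fubini2 iab); apply: Rintegral_ge0 => w _.
have := entropy_nu (uC w) (psi_test_z w).
rewrite (_ : Rintegral _ _ _ = \int[mu]_z (alpha (z, w) - beta (z, w)))//.
apply: eq_Rintegral => z _; rewrite /alpha /beta/= !mulr_suml -sumrB.
apply: eq_bigr => j _; rewrite deriveM_C1//; last exact: C1_reflect.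
rewrite derive_reflect//; ring.
Qed.

(* The inequality of [u] in the variable [w], with [k := xi] averaged over [nu z];
   the symmetry of the Kruzkov pair brings it to the form of [beta]. *)
Let ge0_beta : 0 <= \int[(mu \x mu)%E]_p beta p.
Proof.
rewrite -(Rintegral_fubini1 ibeta); apply: Rintegral_ge0 => z _.
have [_ psi0 _] := psiA.
have [rz rz0 zrz] : exists2 rz : R, 0 <= rz & cbox rz z.
  have [rz rz0 h] := compact_sub_cbox (@compact_set1 _ z); exists rz => //; exact: h.
have om0 := @mollifier_vanishes_off _ d _ e0.
have [N N0 NP] := test_function_bound Com om0.
pose G (p : R * Z) : R :=
  \sum_j 'D_(zdir j) om (p.2 - z) * kruzkov f j (clamp C p.1) (u p.2) * psi z.
have mG : measurable_fun setT G.
  apply: measurable_sum => j; apply: measurable_funM => //; apply: measurable_funM.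
    have h : measurable_fun setT (fun w => 'D_(zdir j) om (w - z)).
      apply: continuous_measurable_space_time.
      have [_ /(_ (zdir j))] := C1_translate z Com.
      by under eq_fun do rewrite derive_translate//.
    exact: (measurableT_comp h measurable_snd).
  have mp : measurable_fun setT (fun p : R * Z => (clamp C p.1, u p.2)).
    apply: measurable_fun_pair; first exact: (measurableT_comp (measurable_clamp C) measurable_fst).
    exact: (measurableT_comp mu_ measurable_snd).
  exact: (measurableT_comp (measurable_kruzkov hf j) mp).
have iG : (nu z \x mu)%E.-integrable setT (EFin \o G).
  apply: (@integrable_bounded_support_prod _ _ _ _ _ _ _ setT (cbox (rz + 3 * e)) _
    (d.+1%:R * (N * (L * (2 * C))) * psi z)) => //.
  - exact: measurable_cbox.
  - by rewrite -ge0_fin_numE// fin_num_measure.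
  - exact: cbox_lty.
  - move=> [xi w]; rewrite /G -mulr_suml normrM (ger0_norm (psi0 z)) ler_wpM2r//=.
    apply: (weak_integrand_bound (K := fun j _ => kruzkov f j (clamp C xi) (u w))).
      by move=> j; exact: (NP _).2.
    by move=> j; apply: (kruzkov_bounded L1 LP) => //; exact: clamp_le.
  - by move=> xi w /(_ I).
  - move=> xi w _ nw; rewrite /G big1// => j _.
    by rewrite (vanishes_off_translate zrz (vanishes_off_derive (zdir j) om0)) ?mul0r.
have -> : \int[mu]_w beta (z, w) = \int[mu]_w \int[nu z]_xi G (xi, w).
  apply: eq_Rintegral => w _.
  have ik j : (nu z).-integrable setT (EFin \o (fun xi => kruzkov f j (u w) (clamp C xi))).
    exact: (integrable_kruzkov_clamp hf C0 nu L1 LP j z (uC w)).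
  have [_ E] := Rintegral_lincomb (index_enum _)
    (fun j => 'D_(zdir j) om (w - z) * psi z) ik.
  rewrite /beta/= mulr_suml; under eq_bigr do rewrite mulrAC; rewrite -E.
  apply: eq_Rintegral => xi _; apply: eq_bigr => j _.
  by rewrite kruzkov_sym mulrAC.
rewrite (Rintegral_fubini2 iG) -(Rintegral_fubini1 iG).
apply: Rintegral_ge0 => xi _.
have := entropy_u (clamp_le C0 xi) (psi_test_w z).
rewrite (_ : Rintegral _ _ _ = \int[mu]_w G (xi, w))//.
apply: eq_Rintegral => w _; rewrite /G; apply: eq_bigr => j _.
rewrite deriveM_C1//; [|exact: C1_cst|exact: C1_translate].
by rewrite derive_translate// derive_cst mulr0 addr0 mulrC mulrA mulrC mulrA.
Qed.

(* The mollifier depends on [w - z] only, so its derivatives have opposite signs in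
   the two inequalities and cancel in their sum. *)
Let ge0_alpha : 0 <= \int[(mu \x mu)%E]_p alpha p.
Proof.
rewrite -[X in 0 <= X](subrK (\int[(mu \x mu)%E]_p beta p)).
by rewrite -RintegralB// addr_ge0.
Qed.

Let int_alpha0 : \int[(mu \x mu)%E]_p alpha0 p =
  \int[mu]_z \sum_j 'D_(zdir j) psi z * K j z (u z).
Proof.
rewrite -(Rintegral_fubini1 ialpha0); apply: eq_Rintegral => z _.
have iom : mu.-integrable setT (EFin \o (fun w => om (w - z))).
  apply/integrableP; split; first by apply/measurable_EFinP; exact: measurable_shift_mollifier.
  under eq_integral do rewrite /= ger0_norm ?mollifier_ge0//.
  by rewrite integral_mollifier// ltry.
rewrite /alpha0/= RintegralZl//.
by rewrite [X in _ * X]/Rintegral integral_mollifier// mulr1.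
Qed.

(** The entropies are Lipschitz in [k], so replacing [u w] by [u z] costs at most a
    multiple of the oscillation of [u]. *)
Lemma doubling_error M : 0 <= M -> (forall z j, `|'D_(zdir j) psi z| <= M) ->
  (- (\int[mu]_z \sum_j 'D_(zdir j) psi z * K j z (u z))%:E
   <= (d.+1%:R * (M * L))%:E * oscillation r e u)%E.
Proof.
move=> M0 MP.
set B := d.+1%:R * (M * L).
pose g p := alpha p - alpha0 p.
have mg : measurable_fun setT g by exact: measurable_funB.
have ig : (mu \x mu)%E.-integrable setT (EFin \o g).
  exact: (integrableB measurableT ialpha ialpha0).
have gE z w : g (z, w) =
    (\sum_j 'D_(zdir j) psi z * (K j z (u w) - K j z (u z))) * om (w - z).
  rewrite /g /alpha /alpha0/= -mulrBl -sumrB; congr (_ * _).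
  by apply: eq_bigr => j _; rewrite mulrBr.
have g_off z w : ~ cbox r z -> g (z, w) = 0.
  by move=> nz; rewrite gE big1 ?mul0r// => j _; rewrite Dpsi_off// mul0r.
have g_le z w : `|g (z, w)| <= B * (`|u w - u z| * om (w - z)).
  rewrite gE normrM [`|om _|]ger0_norm ?mollifier_ge0// [leRHS]mulrA ler_wpM2r ?mollifier_ge0//.
  rewrite /B -[leRHS]mulrA -[M * L * _]mulrA.
  apply: (weak_integrand_bound (K := fun j _ => K j z (u w) - K j z (u z))).
    by move=> j; exact: MP.
  by move=> j; exact: (averaged_kruzkov_lipschitz hf C0 nu L1 LP j z (uC w) (uC z)).
have mgn : measurable_fun setT (fun p => `|g p|%:E).
  by apply/measurable_EFinP; exact: measurableT_comp.
have step1 : (- (\int[mu]_z \sum_j 'D_(zdir j) psi z * K j z (u z))%:E <=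
    \int[(mu \x mu)%E]_p `|g p|%:E)%E.
  apply: (@le_trans _ _ (\int[(mu \x mu)%E]_p g p)%:E).
    by rewrite -EFinN lee_fin /g RintegralB// int_alpha0 lerBrDr addNr ge0_alpha.
  apply: (@le_trans _ _ (`|\int[(mu \x mu)%E]_p g p|)%:E); first by rewrite lee_fin ler_norm.
  by rewrite EFin_normr_Rintegral//; apply: le_abse_integral => //; exact/measurable_EFinP.
apply: (le_trans step1).
have -> : (\int[(mu \x mu)%E]_p `|g p|%:E = \int[mu]_z \int[mu]_w `|g (z, w)|%:E)%E.
  by apply: (fubini_tonelli1 (fun p => `|g p|%:E)) => // p; rewrite lee_fin.
have minner : measurable_fun setT (fun z => \int[mu]_w `|g (z, w)|%:E)%E.
  by apply: (measurable_fun_fubini_tonelli_F (fun p => `|g p|%:E)) => // p; rewrite lee_fin.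
have -> : (\int[mu]_z \int[mu]_w `|g (z, w)|%:E =
    \int[mu]_(z in cbox r) \int[mu]_w `|g (z, w)|%:E)%E.
  rewrite [RHS]integral_mkcond; apply: eq_integral => z _; rewrite patchE.
  case: ifPn => // /negP nz; apply: integral0_eq => w _; rewrite g_off ?normr0//.
  by move=> zr; apply: nz; rewrite inE.
have B0 : 0 <= B by rewrite /B !mulr_ge0// (le_trans ler01).
have mB := @measurable_cbox R d r.
have mI := measurable_inner e0 (measurable_diff_abs mu_).
have mz z : measurable_fun setT (fun w => (`|u w - u z| * om (w - z))%:E).
  apply/measurable_EFinP/measurable_funM; last exact: measurable_shift_mollifier.
  by apply: measurableT_comp => //; exact: measurable_funB.
have uo0 z w : 0 <= `|u w - u z| * om (w - z) by rewrite mulr_ge0// mollifier_ge0.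
rewrite /oscillation -ge0_integralZl_EFin//; last 2 first.
- by move=> z _; apply: integral_ge0 => w _; rewrite lee_fin.
- by apply: measurable_funTS; exact: mI.
apply: ge0_le_integral => //.
- by move=> z _; apply: integral_ge0 => w _; rewrite lee_fin.
- by apply: measurable_funTS; exact: minner.
- by apply: measurable_funTS; apply: measurable_funeM; exact: mI.
move=> z _; rewrite -ge0_integralZl_EFin//; last by move=> w _; rewrite lee_fin.
apply: ge0_le_integral => //.
- exact: (measurableT_comp mgn (measurable_pair1 z)).
- by apply: measurable_funeM; exact: mz.
- by move=> w _; rewrite -EFinM lee_fin.
Qed.

End fixed_test_function.

(** Were the integral negative, a scale at which the oscillation of [u] is small
    enough would contradict [doubling_error]. *)
Lemma doubling_of_variables psi : admissible psi ->
  0 <= \int[mu]_z \sum_j 'D_(zdir j) psi z * K j z (u z).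
Proof.
move=> psiA; have [/test_function_C1[Cpsi [r r0 psi_off]] _ _] := psiA.
have [L L1 LP] := kruzkov_lipschitz hf C.
rewrite leNgt; apply/negP => I0; set I := Rintegral _ _ _ in I0.
have vu := bounded_vanishing_oscillation r mu_ uC.
have [M M0 MP] := test_function_bound Cpsi psi_off.
have eps0 n : 0 < n.+1%:R^-1 :> R by rewrite invr_gt0.
have eps1 n : n.+1%:R^-1 <= 1 :> R by rewrite invf_le1// ler1n.
set B := d.+1%:R * (M * L).
have B1 : 0 < B + 1.
  by rewrite ltr_wpDl// /B !mulr_ge0// (le_trans ler01).
have x0 : 0 < - I / (2 * (B + 1)) by rewrite divr_gt0 ?oppr_gt0// mulr_gt0.
have [N NP] := vu _ x0; move: x0 NP; set x := _ / _ => x0 NP.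
have xE : (B + 1) * x = - I / 2 by rewrite /x; field; rewrite gt_eqF.
have := doubling_error psiA psi_off L1 LP (eps0 N) (eps1 N) M0 (fun z j => (MP z).2 j).
rewrite -/I -/B => /le_trans h.
have : ((- I)%:E <= B%:E * x%:E)%E.
  apply: h; apply: lee_wpmul2l; last exact: NP.
  by rewrite lee_fin !mulr_ge0// (le_trans ler01).
rewrite -EFinM lee_fin; apply/negP; rewrite -ltNge.
apply: (@le_lt_trans _ _ ((B + 1) * x)); first by rewrite ler_wpM2r ?(ltW x0)// lerDl.
by rewrite xE gtr_pMr ?oppr_gt0// invf_lt1// ltr1n.
Qed.

End doubling_of_variables.

(** * Averages at Lebesgue points *)

Section lebesgue_points.
Context {R : realType}.
Local Notation leb := (@lebesgue_measure R).
Implicit Types (m : R -> R) (t y e : R).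

Lemma spline_bump_le e y : 0 < e -> spline_bump e y <= e^-1.
Proof. by move=> e0; rewrite /spline_bump ler_piMr ?bspline_le1// invr_ge0 ltW. Qed.

Lemma measurable_spline_bump_shift e t : measurable_fun setT (fun y : R => spline_bump e (y - t)).
Proof.
apply: measurableT_comp; [exact: measurable_spline_bump|exact: measurable_funB].
Qed.

Lemma integrable_spline_bump_mul m e t : 0 < e -> leb.-integrable setT (EFin \o m) ->
  leb.-integrable setT (EFin \o (fun y => spline_bump e (y - t) * m y)).
Proof.
move=> e0 im; have mm : measurable_fun setT m by apply/measurable_EFinP; case/integrableP : im.
have ie := integrableZl measurableT e^-1 im.
apply: (le_integrable measurableT _ _ ie).
  by apply/measurable_EFinP/measurable_funM => //; exact: measurable_spline_bump_shift.
move=> y _; rewrite /= lee_fin (normrM (spline_bump e (y - t))) [leRHS]normrM; apply: ler_wpM2r => //.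
have n1 : `|spline_bump e (y - t)| = spline_bump e (y - t) by rewrite ger0_norm// spline_bump_ge0.
have n2 : `|e^-1| = e^-1 by rewrite ger0_norm// invr_ge0 ltW.
rewrite n1 n2; exact: spline_bump_le.
Qed.

(** The bump is at most [e^-1] and lives in the ball of radius [3 * e]; the average
    therefore misses the value by at most six times the mean deviation over that
    ball, and this tends to 0 at a Lebesgue point. *)
Lemma lebesgue_pt_spline_bump m t : leb.-integrable setT (EFin \o m) -> lebesgue_pt m t ->
  forall eta, 0 < eta -> exists2 e0 : R, 0 < e0 & forall e, 0 < e -> e < e0 ->
    `|\int[leb]_y (spline_bump e (y - t) * m y) - m t| <= eta.
Proof.
move=> im Lt eta eta0.
have mm : measurable_fun setT m by apply/measurable_EFinP; case/integrableP : im.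
have : \forall r \near (0 : R)^'+, (davg m t r <= (eta / 6)%:E)%E.
  have e60 : 0 < eta / 6 by rewrite divr_gt0.
  move/fine_cvgP : Lt => [fin /cvgrPdist_le /(_ _ e60) le].
  near=> r0; rewrite -[davg m t r0]fineK; last by near: r0.
  rewrite lee_fin; apply: (le_trans (ler_norm _)); rewrite -normrN -sub0r.
  by near: r0.
move=> -[e1 /= e10 e1P]; exists (e1 / 3); first by rewrite divr_gt0.
move=> e e0 ee1.
have ib : leb.-integrable setT (EFin \o (fun y => spline_bump e (y - t))).
  apply/integrableP; split; first by apply/measurable_EFinP; exact: measurable_spline_bump_shift.
  under eq_integral do rewrite /= ger0_norm ?spline_bump_ge0//.
  by rewrite integral_spline_bump// ltry.
have ibm := integrable_spline_bump_mul t e0 im.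
have -> : m t = \int[leb]_y (spline_bump e (y - t) * m t).
  by rewrite RintegralZr// [X in X * _]/Rintegral integral_spline_bump// mul1r.
have ibt : leb.-integrable setT (EFin \o (fun y => spline_bump e (y - t) * m t)).
  exact: (integrableZr measurableT (m t) ib).
rewrite -RintegralB//.
have ibd : leb.-integrable setT
    (EFin \o (fun y => spline_bump e (y - t) * m y - spline_bump e (y - t) * m t)).
  exact: (integrableB measurableT ibm ibt).
rewrite -lee_fin EFin_normr_Rintegral//.
apply: (le_trans (le_abse_integral _ measurableT _)); first by case/integrableP : ibd.
have e3 : 0 < 3 * e by rewrite mulr_gt0.
have mball : measurable (ball t (3 * e)) by exact: measurable_ball.
have bd : (e^-1%:E * \int[leb]_(y in ball t (3 * e)) `|m y - m t|%:E = 6%:E * davg m t (3 * e))%E.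
  rewrite /davg /iavg lebesgue_measure_ball ?ltW// inver gt_eqF ?pmulrn_lgt0// muleA -EFinM.
  by congr (_%:E * _)%E; rewrite -mulr_natr; field; rewrite gt_eqF.
have h3 : 3 * e < e1 by rewrite mulrC -ltr_pdivlMr.
have := e1P (3 * e); rewrite /ball_/= sub0r normrN gtr0_norm// => /(_ h3 e3) h.
apply: (@le_trans _ _ (e^-1%:E * \int[leb]_(y in ball t (3 * e)) `|m y - m t|%:E)%E); last first.
  rewrite bd; have -> : eta%:E = (6%:E * (eta / 6)%:E)%E by rewrite -EFinM; congr EFin; field.
  by apply: lee_wpmul2l; [rewrite lee_fin|exact: h].
have mc : measurable_fun setT (fun y => `|m y - m t|%:E).
  by apply/measurable_EFinP; apply: measurableT_comp => //; exact: measurable_funB.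
rewrite -ge0_integralZl_EFin//; last 2 first.
- exact: measurable_funTS.
- by rewrite invr_ge0 ltW.
rewrite [leRHS]integral_mkcond; apply: ge0_le_integral => //.
- have /integrableP[mi _] := ibd; exact: (measurableT_comp (@abse_measurable R setT) mi).
- apply/(measurable_restrictT _ mball); apply: measurable_funTS; exact: measurable_funeM.
move=> y _; rewrite patchE /= -mulrBr normrM (ger0_norm (spline_bump_ge0 _ e0)).
case: ifPn => [_|/negP ny]; first by rewrite -EFinM lee_fin ler_wpM2r// spline_bump_le.
rewrite spline_bump_out ?mul0r//.
have [yt|ty] := leP (y - t) 0; [by left|right].
rewrite leNgt; apply/negP => ye; apply: ny; rewrite inE /ball/= distrC gtr0_norm//.
Unshelve. all: by end_near. Qed.

End lebesgue_points.

(** * Decay in light cones *)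

Section cone.
Context {R : realType} (d : nat).
Local Notation Z := ('rV[R]_d * measurableTypeR R)%type.
Local Notation mu := (@space_time_measure R d).
Local Notation leb := (@lebesgue_measure R).
Local Notation lebd := (@lebesgue_rV R d).
Implicit Types (j : 'I_d.+1) (z w v : Z) (M e t s : R).

Variable c : R.
Hypothesis c1 : 1 <= c.

(** [cone] is a C1 weight carried by the backward light cone of the points with
    [|x| <= M - c * t]; squaring the positive parts makes it C1 across the boundary
    and at the tip. *)
Definition cone_gap M z : R := pospart (M - c * z.2) ^+ 2 - \sum_(i < d) z.1 ord0 i ^+ 2.

Definition cone M z : R := pospart (cone_gap M z) ^+ 2.

Lemma C1_pospart2 (g : Z -> R) : C1 g -> C1 (fun z => pospart (g z) ^+ 2).
Proof.
apply: (@C1_comp_real _ _ (fun x => pospart x ^+ 2) (fun x => 2 * pospart x)).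
  exact: is_derive_pospart2.
move=> x; apply: cvgM; [exact: cvg_cst|exact: continuous_pospart].
Qed.

Lemma derive_pospart2 (g : Z -> R) z v : C1 g ->
  'D_v (fun z => pospart (g z) ^+ 2) z = 2 * pospart (g z) * 'D_v g z.
Proof.
move=> Cg; have [] := @is_derive_comp_real _ _ (fun x => pospart x ^+ 2) g z v _ Cg
  (is_derive_pospart2 _); by [].
Qed.

Let Cdist M : C1 (fun z : Z => M - c * z.2).
Proof.
rewrite (_ : (fun z => _) = (fun z : Z => M + (- c) * z.2)); last first.
  by apply/funext => z; rewrite mulNr.
apply: C1_add; first exact: C1_cst.
by apply: C1_mul; [exact: C1_cst|exact: C1_time].
Qed.

Let Csq : C1 (fun z : Z => \sum_(i < d) z.1 ord0 i ^+ 2).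
Proof. by apply: C1_sum => i; apply: C1_mul; exact: C1_coord. Qed.

Lemma C1_cone_gap M : C1 (cone_gap M).
Proof.
rewrite (_ : cone_gap M = (fun z : Z => pospart (M - c * z.2) ^+ 2 +
  (- 1) * (\sum_(i < d) z.1 ord0 i ^+ 2))); last first.
  by apply/funext => z; rewrite mulN1r.
apply: C1_add; first exact: C1_pospart2.
by apply: C1_mul; [exact: C1_cst|exact: Csq].
Qed.

Lemma C1_cone M : C1 (cone M).
Proof. by apply: C1_pospart2; exact: C1_cone_gap. Qed.

Lemma derive_cone_gap M z v : 'D_v (cone_gap M) z =
  - (2 * c * pospart (M - c * z.2) * v.2) - \sum_(i < d) 2 * z.1 ord0 i * v.1 ord0 i.
Proof.
rewrite (_ : cone_gap M = (fun z : Z => pospart (M - c * z.2) ^+ 2 +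
  (- 1) * (\sum_(i < d) z.1 ord0 i ^+ 2))); last first.
  by apply/funext => w; rewrite mulN1r.
have Cm : C1 (fun z : Z => (- 1) * \sum_(i < d) z.1 ord0 i ^+ 2).
  by apply: C1_mul; [exact: C1_cst|exact: Csq].
rewrite deriveD_C1//; last exact: C1_pospart2.
congr (_ + _).
  rewrite derive_pospart2// (_ : 'D_v _ z = - (c * v.2)); first by ring.
  rewrite (_ : (fun z => _) = (fun z : Z => M + (- c) * z.2)); last first.
    by apply/funext => w; rewrite mulNr.
  have Ct : C1 (fun z : Z => - c * z.2) by apply: C1_mul; [exact: C1_cst|exact: C1_time].
  rewrite deriveD_C1//; last exact: C1_cst.
  rewrite deriveM_C1//; [|exact: C1_cst|exact: C1_time].
  rewrite !derive_cst mulr0 addr0 add0r.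
  have [_ ->] := @linear_is_derive _ _ (fun z : Z => z.2) z v (fun _ _ _ => erefl).
  by rewrite mulNr.
rewrite deriveM_C1; [|exact: C1_cst|exact: Csq].
rewrite derive_cst mulr0 addr0 mulN1r; congr (- _).
rewrite derive_sum_C1; last by move=> i; apply: C1_mul; exact: C1_coord.
apply: eq_bigr => i _; rewrite (@deriveM_C1 _ _ (fun z : Z => z.1 ord0 i) (fun z : Z => z.1 ord0 i));
  [|exact: C1_coord|exact: C1_coord].
have lc : linear (fun z : Z => z.1 ord0 i) by move=> a y w /=; rewrite !mxE.
have [_ ->] := @linear_is_derive _ _ (fun z : Z => z.1 ord0 i) z v lc.
ring.
Qed.

Lemma derive_cone M z v : 'D_v (cone M) z = 2 * pospart (cone_gap M z) *
  (- (2 * c * pospart (M - c * z.2) * v.2) - \sum_(i < d) 2 * z.1 ord0 i * v.1 ord0 i).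
Proof. by rewrite derive_pospart2 ?derive_cone_gap//; exact: C1_cone_gap. Qed.

Lemma cone_ge0 M z : 0 <= cone M z.
Proof. exact: sqr_ge0. Qed.

(** This bounds the spatial derivatives of [cone] by its decay in time. *)
Lemma cone_gap_gt0 M z : 0 < pospart (cone_gap M z) ->
  forall i, `|z.1 ord0 i| <= pospart (M - c * z.2).
Proof.
move=> gp i; have gap0 : 0 < cone_gap M z.
  by rewrite ltNge; apply/negP => /pospart_eq0 g0; rewrite g0 ltxx in gp.
rewrite -ler_sqr ?nnegrE ?pospart_ge0// real_normK ?num_real//.
move: gap0; rewrite /cone_gap subr_gt0 => /ltW; apply: le_trans.
by rewrite (bigD1 i)//= lerDl sumr_ge0// => k _; exact: sqr_ge0.
Qed.

Lemma cone_off M z : 0 <= M -> 0 <= z.2 -> ~ cbox M z -> cone M z = 0.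
Proof.
move=> M0 t0 nz; rewrite /cone.
have [g0|gp] := leP (pospart (cone_gap M z)) 0.
  by rewrite (_ : pospart _ = 0) ?expr0n//; apply/le_anti; rewrite g0 pospart_ge0.
exfalso; apply: nz; have xP := cone_gap_gt0 gp.
have hM : pospart (M - c * z.2) <= M.
  rewrite -[leRHS](pospart_id M0); apply: le_pospart.
  by rewrite gerBl mulr_ge0// (le_trans ler01).
split=> [i|]; first exact: (le_trans (xP i)).
rewrite ger0_norm// leNgt; apply/negP => Mt.
have p0 : pospart (M - c * z.2) = 0.
  apply: pospart_eq0; rewrite subr_le0 (le_trans (ltW Mt))// ler_peMl//.
move: gp; rewrite /cone_gap p0 expr0n/= sub0r pospart_eq0 ?ltxx//.
by rewrite oppr_le0 sumr_ge0// => i _; exact: sqr_ge0.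
Qed.

Lemma cone_le M z : 0 <= M -> 0 <= z.2 -> cone M z <= M ^+ 4.
Proof.
move=> M0 t0; have c0 := le_trans ler01 c1.
rewrite /cone (_ : M ^+ 4 = (M ^+ 2) ^+ 2); last by rewrite -exprM.
rewrite ler_sqr ?nnegrE ?pospart_ge0 ?sqr_ge0//.
rewrite -[leRHS](pospart_id (sqr_ge0 M)); apply: le_pospart.
rewrite /cone_gap lerBlDr (@le_trans _ _ (M ^+ 2))//.
  rewrite ler_sqr ?nnegrE ?pospart_ge0//.
  by rewrite -[leRHS](pospart_id M0); apply: le_pospart; rewrite gerBl mulr_ge0.
by rewrite lerDl sumr_ge0// => i _; exact: sqr_ge0.
Qed.

End cone.

(** Here [G] stands for the averaged Kruzkov pair of the two solutions: [G ord0] is the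
    pointwise distance and the other components are its flux. *)
Section light_cone_comparison.
Context {R : realType} (d : nat).
Local Notation Z := ('rV[R]_d * measurableTypeR R)%type.
Local Notation mu := (@space_time_measure R d).
Local Notation leb := (@lebesgue_measure R).
Local Notation lebd := (@lebesgue_rV R d).
Implicit Types (j : 'I_d.+1) (z w v : Z) (e t s : R).
Variables (G : 'I_d.+1 -> Z -> R) (B L : R).
Hypothesis mG : forall j, measurable_fun setT (G j).
Hypothesis GB : forall j z, `|G j z| <= B.
Hypothesis L0 : 0 <= L.
Hypothesis GL : forall j z, `|G j z| <= L * G ord0 z.
Hypothesis G0 : forall z, 0 <= G ord0 z.
Hypothesis comparison : forall psi, admissible psi ->
  0 <= \int[mu]_z \sum_j 'D_(zdir j) psi z * G j z.

Let c : R := 1 + d%:R * L.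
Let c1 : 1 <= c. Proof. by rewrite /c lerDl mulr_ge0. Qed.

Variables (M : R) (M0 : 0 <= M).

Definition weighted_gap z : R := if 0 <= z.2 then cone c M z * G ord0 z else 0.

Lemma weighted_gap_off z : ~ cbox M z -> weighted_gap z = 0.
Proof.
by move=> nz; rewrite /weighted_gap; case: ifPn => // t0; rewrite (cone_off c1)// mul0r.
Qed.

Lemma weighted_gap_ge0 z : 0 <= weighted_gap z.
Proof. by rewrite /weighted_gap; case: ifPn => // _; rewrite mulr_ge0// cone_ge0. Qed.

Lemma weighted_gap_le z : 0 <= z.2 -> weighted_gap z <= M ^+ 4 * G ord0 z.
Proof. by move=> t0; rewrite /weighted_gap t0 ler_wpM2r// cone_le. Qed.

Lemma weighted_gap_bounded z : `|weighted_gap z| <= M ^+ 4 * B.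
Proof.
rewrite ger0_norm ?weighted_gap_ge0// /weighted_gap; case: ifPn => [t0|_].
  by apply: ler_pM; rewrite ?cone_ge0 ?cone_le//; apply: le_trans (GB ord0 z); rewrite ler_norm.
by rewrite mulr_ge0 ?exprn_ge0// (le_trans _ (GB ord0 z)).
Qed.

Lemma measurable_weighted_gap : measurable_fun setT weighted_gap.
Proof.
apply: measurable_fun_ifT => //.
- apply: measurable_fun_ler => //; exact: measurable_snd.
- apply: measurable_funM => //; apply: continuous_measurable_space_time.
  by apply: C1_continuous; exact: C1_cone.
Qed.

Lemma integrable_weighted_gap : mu.-integrable setT (EFin \o weighted_gap).
Proof.
apply: (@integrable_bounded_support _ _ _ _ (cbox M) _ (M ^+ 4 * B)).
- exact: measurable_cbox.
- exact: cbox_lty.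
- exact: measurable_weighted_gap.
- exact: weighted_gap_bounded.
- exact: weighted_gap_off.
Qed.

Lemma integrable_weighted_gap_section t :
  lebd.-integrable setT (EFin \o (fun x => weighted_gap (x, t))).
Proof.
have mI (i : 'I_d) : measurable (`[- M, M]%classic : set R) by [].
apply: (@integrable_bounded_support _ _ _ _
  [set x : 'rV[R]_d | forall i, `[- M, M]%classic (x ord0 i)] _ (M ^+ 4 * B)).
- exact: (@measurable_rV_box R d (fun=> `[- M, M]%classic)).
- have := @lebesgue_rV_box R d (fun=> `[- M, M]%classic) mI; move=> /= ->.
  rewrite ltey_eq prode_fin_num// => i _.
  by rewrite lebesgue_measure_itv/=; case: ifP.
- exact: (measurableT_comp measurable_weighted_gap (measurable_pair2 t)).
- by move=> x; exact: weighted_gap_bounded.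
- move=> x nx; apply: weighted_gap_off => -[xM _]; apply: nx => i /=.
  by rewrite in_itv/= -ler_norml; exact: xM.
Qed.

Definition weighted_distance t : R := \int[lebd]_x weighted_gap (x, t).

Lemma integrable_weighted_distance : leb.-integrable setT (EFin \o weighted_distance).
Proof.
have iH := integrable_weighted_gap.
have mm : measurable_fun setT weighted_distance.
  by apply: measurableT_comp => //; exact: (measurable_fubini_G iH).
apply/integrableP; split; first exact/measurable_EFinP.
have /integrableP[mH] := iH; apply: le_lt_trans.
have mHn : measurable_fun setT (fun z => `|(weighted_gap z)%:E|)%E.
  by apply/measurable_EFinP; apply: measurableT_comp => //; exact: measurable_weighted_gap.
rewrite [leRHS](fubini_tonelli2 (m1 := lebd) (m2 := leb) _ mHn)//.
apply: ge0_le_integral => //.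
- by apply/measurable_EFinP; exact: measurableT_comp.
- exact: (measurable_fun_fubini_tonelli_G (m1 := lebd) _ mHn).
- move=> t _; apply: (@le_trans _ _ (`|weighted_distance t|)%:E) => //.
  rewrite /weighted_distance EFin_normr_Rintegral//.
    have it := integrable_weighted_gap_section t.
    by apply: le_abse_integral => //; case/integrableP : it.
  exact: integrable_weighted_gap_section.
Qed.

Section time_localization.
Variables (s t0 e : R) (s0 : 0 <= s) (st : s < t0) (e0 : 0 < e).

(* A C1 indicator of the times between [s] and [t0]; its derivative is a difference
   of two bumps of width [3 * e], just after [s] and just after [t0]. *)
Let theta t := bspline_prim (e^-1 * t + - (e^-1 * s)) - bspline_prim (e^-1 * t + - (e^-1 * t0)).
Let dtheta t := spline_bump e (t - s) - spline_bump e (t - t0).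

Let is_derive_theta t : is_derive t (1 : R) theta (dtheta t).
Proof.
rewrite /dtheta /spline_bump !mulrBr; apply: is_deriveB;
  apply: is_derive_scale_arg; exact: is_derive_bspline_prim.
Qed.

Let continuous_dtheta : continuous dtheta.
Proof.
have cb a : continuous (fun t : R => spline_bump e (t - a)).
  move=> x; apply: (@continuous_comp _ _ _ (fun t => t - a) (spline_bump e)).
    by apply: cvgB => //; exact: cvg_cst.
  exact: continuous_spline_bump.
by move=> x; apply: cvgB; exact: cb.
Qed.

Let theta_ge0 t : 0 <= theta t.
Proof.
rewrite subr_ge0 le_bspline_prim// lerD2l lerN2 ler_wpM2l ?invr_ge0 ?ltW//.
Qed.

Let theta_le0 t : t <= 0 -> theta t = 0.
Proof.
move=> tl; have ei : 0 <= e^-1 by rewrite invr_ge0 ltW.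
by rewrite /theta !bspline_prim_le0 ?subrr// -mulrBr mulr_ge0_le0// subr_le0;
  [rewrite (le_trans tl)// (le_trans s0)// ltW|rewrite (le_trans tl)].
Qed.

Let theta_late t : t0 + 3 * e <= t -> theta t = 0.
Proof.
move=> tl; have e30 : 0 < 3 * e by rewrite mulr_gt0.
have h a : a + 3 * e <= t -> 3 <= e^-1 * t + - (e^-1 * a).
  by move=> ?; rewrite -mulrBr mulrC ler_pdivlMr//; lra.
rewrite /theta !bspline_prim_ge3 ?subrr//; apply: h => //.
by apply: le_trans tl; rewrite lerD2r ltW.
Qed.

Let dtheta_neg t : t < 0 -> dtheta t = 0.
Proof.
move=> tl; have ts := lt_le_trans tl s0; have tt0 := lt_trans ts st.
by rewrite /dtheta !spline_bump_out ?subrr//; left; rewrite subr_le0 ltW.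
Qed.

Let psi z := theta z.2 * cone c M z.

Let Ctheta : C1 (fun z : Z => theta z.2).
Proof. by apply: (C1_comp_real is_derive_theta continuous_dtheta); exact: C1_time. Qed.

Let Cpsi : C1 psi. Proof. by apply: C1_mul => //; exact: C1_cone. Qed.

Let psi_off : vanishes_off (M + (t0 + 3 * e)) psi.
Proof.
have e30 : 0 < 3 * e by rewrite mulr_gt0.
move=> z nz; rewrite /psi; have [tl|tg] := leP z.2 0; first by rewrite theta_le0// mul0r.
rewrite (cone_off c1) ?mulr0// ?(ltW tg)// => h; apply: nz; apply: le_cbox h.
by rewrite lerDl addr_ge0 ?ltW// (le_lt_trans s0 st).
Qed.

Let psiA : admissible psi.
Proof.
split; first exact: C1_test_function Cpsi psi_off.
- by move=> z; rewrite mulr_ge0// cone_ge0.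
- by move=> z z0; rewrite /psi theta_le0// mul0r.
Qed.

(* The weight shrinks at the speed [c = 1 + d * L], and each of the [d] fluxes is at
   most [L] times the density. *)
Let cone_decay z : \sum_j 'D_(zdir j) (cone c M) z * G j z <= 0.
Proof.
rewrite big_ord_recl zdir0 derive_cone/= mulr1.
rewrite [X in _ - X](_ : _ = 0) ?subr0; last first.
  by apply: big1 => i _; rewrite mxE mulr0.
rewrite [X in _ + X](_ : _ = \sum_(i < d) 2 * pospart (cone_gap c M z) *
    - (2 * z.1 ord0 i) * G (lift ord0 i) z); last first.
  apply: eq_bigr => i _; rewrite zdirS derive_cone/= mulr0 oppr0 sub0r.
  congr (_ * - _ * _); rewrite (bigD1 i)//= mxE !eqxx mulr1 big1 ?addr0// => k ki.
  by rewrite mxE eqxx (negbTE ki) mulr0.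
have [g0|gp] := leP (pospart (cone_gap c M z)) 0.
  have -> : pospart (cone_gap c M z) = 0 by apply/le_anti; rewrite g0 pospart_ge0.
  by rewrite mulr0 !mul0r add0r big1// => i _; rewrite !mul0r.
have xP := cone_gap_gt0 gp; set p := pospart (M - c * z.2) in xP *.
set q := pospart (cone_gap c M z) in gp *.
have p0 : 0 <= p by exact: pospart_ge0.
have le i : 2 * q * - (2 * z.1 ord0 i) * G (lift ord0 i) z <= 2 * q * (2 * p * (L * G ord0 z)).
  rewrite -mulrA ler_wpM2l ?mulr_ge0 ?(ltW gp)//; apply: (le_trans (ler_norm _)).
  rewrite normrM normrN normrM [`|2|]ger0_norm// ler_pM ?mulr_ge0//.
  by rewrite ler_wpM2l.
apply: (@le_trans _ _ (2 * q * - (2 * c * p) * G ord0 z +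
    \sum_(i < d) 2 * q * (2 * p * (L * G ord0 z)))).
  by rewrite lerD2l; apply: ler_sum => i _; exact: le.
rewrite sumr_const card_ord -[X in _ + X]mulr_natl.
have -> : 2 * q * - (2 * c * p) * G ord0 z + d%:R * (2 * q * (2 * p * (L * G ord0 z))) =
  - (4 * q * p * G ord0 z) by rewrite /c; ring.
by rewrite oppr_le0 !mulr_ge0// ltW.
Qed.

Lemma integrable_localized :
  mu.-integrable setT (EFin \o (fun z => dtheta z.2 * weighted_gap z)).
Proof.
apply: (@integrable_bounded_support _ _ _ _ (cbox M) _ ((e^-1 + e^-1) * (M ^+ 4 * B))).
- exact: measurable_cbox.
- exact: cbox_lty.
- apply: measurable_funM; last exact: measurable_weighted_gap.
  have md : measurable_fun setT dtheta.
    by apply: measurable_funB; exact: measurable_spline_bump_shift.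
  exact: (measurableT_comp md measurable_snd).
- move=> z; rewrite normrM; apply: ler_pM => //; last exact: weighted_gap_bounded.
  apply: (le_trans (ler_normB _ _)); apply: lerD;
    by rewrite ger0_norm ?spline_bump_ge0//; exact: spline_bump_le.
- by move=> z nz; rewrite weighted_gap_off// mulr0.
Qed.

Lemma localized_comparison : 0 <= \int[mu]_z (dtheta z.2 * weighted_gap z).
Proof.
apply: (le_trans (comparison psiA)); apply: le_Rintegral => //.
- exact: (integrable_weak_integrand Cpsi psi_off mG GB).
- exact: integrable_localized.
move=> z _; have [tneg|tpos] := ltP z.2 0.
  rewrite dtheta_neg// mul0r big1// => j _.
  rewrite (@derive_negative_time _ _ psi) ?mul0r// => y y0.
  by rewrite /psi theta_le0// mul0r.
have -> : \sum_j 'D_(zdir j) psi z * G j z =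
    theta z.2 * (\sum_j 'D_(zdir j) (cone c M) z * G j z) + dtheta z.2 * weighted_gap z.
  have Dpsi j : 'D_(zdir j) psi z =
      theta z.2 * 'D_(zdir j) (cone c M) z + cone c M z * (dtheta z.2 * (zdir j).2).
    rewrite deriveM_C1//; last exact: C1_cone.
    congr (_ + _ * _).
    have [_ ->] := is_derive_comp_real (zdir j) (@C1_time R d) (is_derive_theta z.2).
    congr (_ * _).
    by have [_ ->] := @linear_is_derive _ _ (fun z : Z => z.2) z (zdir j) (fun _ _ _ => erefl).
  under eq_bigr do rewrite Dpsi mulrDl -mulrA.
  rewrite big_split/= -mulr_sumr; congr (_ + _).
  rewrite big_ord_recl zdir0/= mulr1 big1 ?addr0; last first.
    by move=> i _; rewrite zdirS/= !mulr0 mul0r.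
  by rewrite /weighted_gap tpos; ring.
by rewrite gerDr mulr_ge0_le0.
Qed.

Lemma localized_weighted_distance :
  \int[leb]_t (spline_bump e (t - t0) * weighted_distance t) <=
  \int[leb]_t (spline_bump e (t - s) * weighted_distance t).
Proof.
have im := integrable_weighted_distance.
have i1 := integrable_spline_bump_mul s e0 im.
have i2 := integrable_spline_bump_mul t0 e0 im.
rewrite -subr_ge0 -RintegralB//.
have := localized_comparison; rewrite /space_time_measure -(Rintegral_fubini2 integrable_localized).
move=> h; apply: (le_trans h); rewrite le_eqVlt; apply/orP; left; apply/eqP.
apply: eq_Rintegral => t _; rewrite /= RintegralZl//; last exact: integrable_weighted_gap_section.
by rewrite /dtheta mulrBl.
Qed.

End time_localization.

(** The cut-off in time compares averages just after [s] and just after [t]; at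
    Lebesgue points these tend to the values. *)
Lemma weighted_distance_monotone s t : 0 <= s -> s < t ->
  lebesgue_pt weighted_distance s -> lebesgue_pt weighted_distance t ->
  weighted_distance t <= weighted_distance s.
Proof.
move=> s0 st ls lt; have im := integrable_weighted_distance.
rewrite leNgt; apply/negP => h.
have eta0 : 0 < (weighted_distance t - weighted_distance s) / 3.
  by rewrite divr_gt0// subr_gt0.
have [es es0 esP] := lebesgue_pt_spline_bump im ls eta0.
have [et et0 etP] := lebesgue_pt_spline_bump im lt eta0.
have m0 : 0 < Num.min es et by rewrite lt_min es0.
have e0 : 0 < Num.min es et / 2 by rewrite divr_gt0.
have em : Num.min es et / 2 < Num.min es et by rewrite gtr_pMr// invf_lt1// ltr1n.
have := esP _ e0 (lt_le_trans em _); rewrite ge_min lexx => /(_ isT) h1.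
have := etP _ e0 (lt_le_trans em _); rewrite ge_min lexx orbT => /(_ isT) h2.
have h3 := localized_weighted_distance s0 st e0.
move: h1 h2; rewrite !ler_norml => /andP[? ?] /andP[? ?]; lra.
Qed.

End light_cone_comparison.

(** * The total distance *)

Lemma fatou_bound d (T : measurableType d) (R : realType) (m : {measure set T -> \bar R})
    (F : (T -> \bar R)^nat) (g : T -> \bar R) (K : \bar R) :
  (forall n, measurable_fun setT (F n)) -> (forall n x, (0 <= F n x)%E) ->
  (forall x, F ^~ x @ \oo --> g x) ->
  (forall n, \int[m]_x F n x <= K)%E -> (\int[m]_x g x <= K)%E.
Proof.
move=> mF F0 Fg FK.
have gE : g = fun x => limn_einf (F ^~ x).
  apply/funext => x; rewrite is_cvg_limn_einfE; last by apply/cvg_ex; exists (g x); exact: Fg.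
  by apply/esym/cvg_lim => //; exact: Fg.
rewrite gE; apply: (le_trans (fatou m measurableT mF (fun n x _ => F0 n x))).
apply: (le_trans (limn_einf_sup _)); rewrite limn_esup_lim.
apply: lime_le; first exact: is_cvg_esups.
by apply: nearW => n; apply: ge_ereal_sup => _ [m0 _ <-]; exact: FK.
Qed.

Section cone_exhaustion.
Context {R : realType} (d : nat).
Local Notation Z := ('rV[R]_d * measurableTypeR R)%type.
Implicit Types (z : Z) (M c : R).

Lemma pospartM (a x : R) : 0 <= a -> pospart (a * x) = a * pospart x.
Proof. by move=> a0; rewrite /pospart maxr_pMr// mulr0. Qed.

Lemma cone_scale c M z : 0 < M -> cone c M z =
  M ^+ 4 * pospart (pospart (1 - c * z.2 * M^-1) ^+ 2 -
    (\sum_(i < d) z.1 ord0 i ^+ 2) * M^-1 ^+ 2) ^+ 2.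
Proof.
move=> M0; have Mn0 : M != 0 by rewrite gt_eqF.
rewrite /cone /cone_gap (_ : M - c * z.2 = M * (1 - c * z.2 * M^-1)); last by field.
rewrite pospartM ?ltW//; set p := pospart (1 - _); set S := \sum_(i < d) _.
rewrite (_ : (M * p) ^+ 2 - S = M ^+ 2 * (p ^+ 2 - S * M^-1 ^+ 2)); last by field.
by rewrite pospartM ?exprn_ge0 ?ltW//; ring.
Qed.

(** Normalised by its maximal value [M ^+ 4], the weight exhausts the half-space: it
    is a continuous function of [M^-1]. *)
Lemma cvg_cone c z : (fun n => cone c n.+1%:R z / n.+1%:R ^+ 4) @ \oo --> (1 : R).
Proof.
set S := \sum_(i < d) z.1 ord0 i ^+ 2.
pose h (v : R) := pospart (pospart (1 - c * z.2 * v) ^+ 2 - S * v ^+ 2) ^+ 2.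
have -> : (fun n => cone c n.+1%:R z / n.+1%:R ^+ 4) = h \o @harmonic R.
  apply/funext => n /=; rewrite cone_scale// [LHS]mulrC mulKf; last by rewrite expf_neq0// pnatr_eq0.
  by [].
have h0 : h 0 = 1.
  by rewrite /h !mulr0 expr0n/= mulr0 !subr0 !pospart_id// !expr1n.
have ch : {for 0, continuous h}.
  have cp (k : R -> R) : {for 0, continuous k} -> {for 0, continuous (fun v => pospart (k v) ^+ 2)}.
    move=> ck; have := @continuous_comp _ _ _ k pospart 0 ck (@continuous_pospart R _).
    by move=> h'; apply: (cvgM h' h').
  apply: (cp _); apply: cvgB.
    apply: (cp _); apply: cvgB; first exact: cvg_cst.
    apply: cvgM; first exact: cvg_cst.
    exact: cvg_id.
  apply: cvgM; first exact: cvg_cst.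
  by apply: cvgM; exact: cvg_id.
rewrite -h0; apply: cvg_comp; first exact: cvg_harmonic.
exact: ch.
Qed.

End cone_exhaustion.

Section total_distance.
Context {R : realType} (d : nat).
Local Notation Z := ('rV[R]_d * measurableTypeR R)%type.
Local Notation mu := (@space_time_measure R d).
Local Notation leb := (@lebesgue_measure R).
Local Notation lebd := (@lebesgue_rV R d).
Variables (G : 'I_d.+1 -> Z -> R) (B L : R).
Hypothesis mG : forall j, measurable_fun setT (G j).
Hypothesis GB : forall j z, `|G j z| <= B.
Hypothesis L0 : 0 <= L.
Hypothesis GL : forall j z, `|G j z| <= L * G ord0 z.
Hypothesis G0 : forall z, 0 <= G ord0 z.
Hypothesis comparison : forall psi, admissible psi ->
  0 <= \int[mu]_z \sum_j 'D_(zdir j) psi z * G j z.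

Definition total_distance (t : R) : \bar R := (\int[lebd]_x (G ord0 (x, t))%:E)%E.

Lemma measurable_total_distance : measurable_fun setT total_distance.
Proof.
have m0 : measurable_fun setT (fun z => (G ord0 z)%:E) by exact/measurable_EFinP.
have g0 z : (0 <= (G ord0 z)%:E)%E by rewrite lee_fin.
exact: (measurable_fun_fubini_tonelli_G (m1 := lebd) _ m0 g0).
Qed.

Lemma total_distance_ge0 t : (0 <= total_distance t)%E.
Proof. by apply: integral_ge0 => x _; rewrite lee_fin. Qed.

Lemma weighted_distance_le_total M t : 0 <= M -> 0 <= t ->
  ((weighted_distance G L M t)%:E <= (M ^+ 4)%:E * total_distance t)%E.
Proof.
move=> M0 t0; have it := integrable_weighted_gap_section mG GB L0 G0 M0 t.
rewrite /weighted_distance /Rintegral fineK; last exact: integral_fune_fin_num.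
have ms : measurable_fun setT (fun x => (G ord0 (x, t))%:E).
  by apply/measurable_EFinP; exact: (measurableT_comp (mG ord0) (measurable_pair2 t)).
rewrite /total_distance -ge0_integralZl//; last 2 first.
- by move=> x _; rewrite lee_fin.
- by rewrite lee_fin exprn_ge0.
apply: ge0_le_integral => //.
- by move=> x _; rewrite lee_fin; exact: weighted_gap_ge0.
- by case/integrableP : it.
- by apply/measurable_EFinP; apply: measurable_funM => //; exact/measurable_EFinP.
- by move=> x _; rewrite -EFinM lee_fin; exact: (weighted_gap_le L0 G0 M0).
Qed.

(** Averages [weighted_distance_monotone] over the earlier times [s <= T]. *)
Lemma weighted_distance_average M : 0 < M ->
  {ae leb, forall t, 0 < t -> forall T, 0 < T -> T < t ->
    ((T * (weighted_distance G L M t / M ^+ 4))%:E <=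
      \int[leb]_(s in `[0%R, T]) total_distance s)%E}.
Proof.
move=> M0; have M4 : 0 < M ^+ 4 by rewrite exprn_gt0.
have iw := integrable_weighted_distance mG GB L0 G0 (ltW M0).
have lw : locally_integrable setT (weighted_distance G L M).
  by apply: open_integrable_locally => //; exact: openT.
have Lw := lebesgue_differentiation lw.
have leb_filter := ae_filter_ringOfSetsType leb.
move: Lw; apply: filterS => t Lt t0 T T0 Tt.
have w0 : 0 <= weighted_distance G L M t / M ^+ 4.
  by rewrite divr_ge0 ?(ltW M4)//; apply: Rintegral_ge0 => x _; exact: weighted_gap_ge0.
have -> : ((T * (weighted_distance G L M t / M ^+ 4))%:E =
    \int[leb]_(s in `[0%R, T]) (weighted_distance G L M t / M ^+ 4)%:E)%E.
  by rewrite integral_cst//= lebesgue_measure_itv/= lte_fin T0 oppr0 adde0 -EFinM mulrC.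
apply: ae_ge0_le_integral => //.
- by move=> x _; exact: total_distance_ge0.
- by apply: measurable_funS measurable_total_distance.
move: (lebesgue_differentiation lw); apply: filterS => s Ls; rewrite /= in_itv/= => /andP[s0 sT].
have h := weighted_distance_monotone mG GB L0 GL G0 comparison (ltW M0) s0
  (le_lt_trans sT Tt) Ls Lt.
have := weighted_distance_le_total (ltW M0) s0.
rewrite -(@lee_pmul2l _ (M ^+ 4)^-1%:E)//; last by rewrite lte_fin invr_gt0.
rewrite muleA -EFinM -EFinM mulVf ?gt_eqF// mul1e; apply: le_trans.
by rewrite lee_fin mulrC ler_pM2l ?invr_gt0.
Qed.

(** Enlarging the cones; Fatou's lemma copes with infinite distances. *)
Lemma total_distance_decay :
  {ae leb, forall t, 0 < t -> forall T, 0 < T -> T < t ->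
    (T%:E * total_distance t <= \int[leb]_(s in `[0%R, T]) total_distance s)%E}.
Proof.
have /ae_foralln := fun n : nat => @weighted_distance_average n.+1%:R (ltr0Sn R n).
have leb_filter := ae_filter_ringOfSetsType leb.
apply: filterS => t ht t0 T T0 Tt.
have ms : measurable_fun setT (fun x => G ord0 (x, t)).
  exact: (measurableT_comp (mG ord0) (measurable_pair2 t)).
rewrite /total_distance -ge0_integralZl_EFin ?(ltW T0)//; last 2 first.
- by move=> x _; rewrite lee_fin.
- exact/measurable_EFinP.
pose F (n : nat) (x : 'rV[R]_d) := (T / n.+1%:R ^+ 4 * weighted_gap G L n.+1%:R (x, t))%:E.
have T4 n : 0 <= T / n.+1%:R ^+ 4 by rewrite divr_ge0 ?(ltW T0)// exprn_ge0.
have n0 n : 0 <= n.+1%:R :> R by [].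
apply: (@fatou_bound _ _ _ _ F).
- move=> n; apply/measurable_EFinP; apply: measurable_funM => //.
  by have /integrableP[/measurable_EFinP] := integrable_weighted_gap_section mG GB L0 G0 (n0 n) t.
- by move=> n x; rewrite lee_fin mulr_ge0//; exact: weighted_gap_ge0.
- move=> x; rewrite -EFinM; apply: cvg_EFin; first exact: nearW.
  have -> : fine \o F^~ x = (fun n => T * G ord0 (x, t) *
      (cone (1 + d%:R * L) n.+1%:R (x, t) / n.+1%:R ^+ 4)).
    by apply/funext => n; rewrite /F /= /weighted_gap /= ltW//; ring.
  rewrite -[X in _ --> X]mulr1; apply: cvgM; first exact: cvg_cst.
  exact: cvg_cone.
- move=> n; apply: le_trans (ht n t0 T T0 Tt).
  have it := integrable_weighted_gap_section mG GB L0 G0 (n0 n) t.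
  rewrite /F (_ : (\int[lebd]_x _)%E = ((T / n.+1%:R ^+ 4)%:E *
    \int[lebd]_x (weighted_gap G L n.+1%:R (x, t))%:E)%E); last first.
    by rewrite -integralZl.
  rewrite -[X in (_ * X)%E]fineK; last exact: integral_fune_fin_num.
  by rewrite -EFinM lee_fin /weighted_distance mulrA mulrAC.
Qed.

End total_distance.

(** * Almost everywhere arguments *)

Section almost_everywhere.
Context {R : realType} d (T : measurableType d) (m : {measure set T -> \bar R}).

Lemma Lfun_measurable p (v : T -> R) : v \in Lfun m p -> measurable_fun setT v.
Proof. by case/andP; rewrite inE. Qed.

Lemma Lfun_infty_bounded (v : T -> R) : v \in Lfun m +oo%E ->
  exists2 C, 0 <= C & {ae m, forall x, `|v x| <= C}.
Proof.
case/andP => _; rewrite inE/= /finite_norm unlock; case: ifPn => [_|].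
  have -> : (abse \o (EFin \o v))%E = EFin \o (fun x => `|v x|) by apply/funext.
  move/ess_supr_bounded => [M vM]; exists (Num.max M 0); first by rewrite le_max lexx orbT.
  by move: vM; apply: filterS => x /= h; rewrite le_max h.
(* On a null space the norm is zero by convention, and everything holds almost
   everywhere. *)
rewrite -leNgt => m0 _; exists 0 => //; exists setT; split => //.
by apply/eqP; rewrite eq_le m0 measure_ge0.
Qed.

Lemma ae_eq_integrable (g h : T -> R) : measurable_fun setT g ->
  m.-integrable setT (EFin \o h) -> {ae m, forall x, g x = h x} ->
  m.-integrable setT (EFin \o g) /\ \int[m]_x g x = \int[m]_x h x.
Proof.
move=> mg ih gh; have /integrableP[mh hoo] := ih.
have mEg : measurable_fun setT (EFin \o g) by exact/measurable_EFinP.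
split; last first.
  rewrite /Rintegral; congr fine; apply: ae_eq_integral => //.
  by move: gh; apply: filterS => x /= ->.
apply/integrableP; split => //; apply: le_lt_trans hoo.
rewrite le_eqVlt; apply/orP; left; apply/eqP.
apply: ge0_ae_eq_integral => //.
- by apply: measurableT_comp.
- by apply: measurableT_comp.
- by move: gh; apply: filterS => x /= ->.
Qed.

End almost_everywhere.

Section null_sections.
Context {R : realType} d1 d2 (T1 : measurableType d1) (T2 : measurableType d2).
Variables (m1 : {sigma_finite_measure set T1 -> \bar R}).
Variables (m2 : {sigma_finite_measure set T2 -> \bar R}).

Lemma ae_section (P : T1 * T2 -> Prop) : {ae (m1 \x m2)%E, forall z, P z} ->
  {ae m2, forall y, {ae m1, forall x, P (x, y)}}.
Proof.
move=> [N [mN N0 PN]].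
have mI : measurable_fun setT (fun z => (\1_N z)%:E : \bar R).
  by apply/measurable_EFinP; exact: measurable_indic.
have I0 z : (0 <= (\1_N z)%:E :> \bar R)%E by rewrite lee_fin.
have iN0 : (\int[(m1 \x m2)%E]_z (\1_N z)%:E = 0)%E by rewrite integral_indic// setIT.
have := @fubini_tonelli2 _ _ _ _ _ m1 m2 _ mI I0; rewrite iN0 => /esym J0.
have mG := @measurable_fun_fubini_tonelli_G _ _ _ _ _ m1 _ mI I0.
have /(@ae_eq_integral_abs _ _ _ m2 _ measurableT _ mG) :
    (\int[m2]_y `|fubini_G m1 (fun z => (\1_N z)%:E) y| = 0)%E.
  rewrite -[RHS]J0; apply: eq_integral => y _; rewrite gee0_abs//.
  by apply: integral_ge0.
apply: filterS => y /(_ I) /= Gy.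
have mIy : measurable_fun setT (fun x => (\1_N (x, y))%:E : \bar R).
  exact: (measurableT_comp mI (measurable_pair2 y)).
have /(@ae_eq_integral_abs _ _ _ m1 _ measurableT _ mIy) :
    (\int[m1]_x `|(\1_N (x, y))%:E| = 0)%E.
  by rewrite -[RHS]Gy; apply: eq_integral => x _; rewrite gee0_abs.
apply: filterS => x /(_ I) /= /eqP; rewrite eqe indicE; case: (boolP (_ \in N)) => [_|].
  by rewrite oner_eq0.
move=> nN _; apply: contrapT => nP; move/negP: nN; apply; rewrite inE; exact: PN.
Qed.

Lemma ae_product (g : T1 * T2 -> \bar R) : measurable_fun setT g ->
  (forall z, (0 <= g z)%E) -> {ae m2, forall y, (\int[m1]_x g (x, y) = 0)%E} ->
  {ae (m1 \x m2)%E, forall z, (g z = 0)%E}.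
Proof.
move=> mg g0 gy.
have mG := @measurable_fun_fubini_tonelli_G _ _ _ _ _ m1 _ mg g0.
have /(@ae_eq_integral_abs _ _ _ (m1 \x m2)%E _ measurableT _ mg) :
    (\int[(m1 \x m2)%E]_z `|g z| = 0)%E.
  rewrite (_ : \int[_]_z _ = \int[(m1 \x m2)%E]_z g z)%E; last first.
    by apply: eq_integral => z _; rewrite gee0_abs.
  rewrite fubini_tonelli2//.
  rewrite -[RHS](integral0 m2 setT); apply: ae_eq_integral => //.
  by move: gy; apply: filterS => y h _.
by apply: filterS => z; apply.
Qed.

End null_sections.

Section weak_form_admissible.
Context {R : realType} (d : nat).
Local Notation Z := ('rV[R]_d * measurableTypeR R)%type.
Local Notation mu := (@space_time_measure R d).
Implicit Types (z : Z) (j : 'I_d.+1).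

(** [K'] is a bounded representative of [K], which may be unbounded on a null set. *)
Lemma weak_form_admissible phi (a : Z -> R) (b : Z -> 'rV[R]_d) a0 (K K' : 'I_d.+1 -> Z -> R) (B : R) : admissible phi ->
  (forall j, measurable_fun setT (K j)) -> (forall j, measurable_fun setT (K' j)) ->
  (forall j z, `|K' j z| <= B) -> {ae mu, forall z, forall j, K j z = K' j z} ->
  (forall z, 0 <= z.2 -> a z = K ord0 z) ->
  (forall z i, 0 <= z.2 -> b z ord0 i = K (lift ord0 i) z) ->
  weak_form phi a b a0 = \int[mu]_z \sum_j 'D_(zdir j) phi z * K' j z.
Proof.
move=> [/test_function_C1[Cphi [r _ phir]] phi_ge0 phi_le0] mK mK' K'B KK' aE bE.
have iK' := integrable_weak_integrand Cphi phir mK' K'B.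
have mKs := measurable_weak_integrand Cphi mK.
have [|iK <-] := ae_eq_integrable mKs iK'.
  by move: KK'; apply: filterS => z h; apply: eq_bigr => j _; rewrite h.
apply: weak_form_integral => //.
- by move=> z z0; apply: weak_integrandE; [exact: aE|move=> i; exact: bE].
- move=> z z0; apply: big1 => j _; rewrite (@derive_negative_time _ _ phi)//; first by rewrite mul0r.
- by move=> x; exact: phi_le0.
Qed.

End weak_form_admissible.

(** * Entropy inequalities for the two solutions *)

Section comparison.
Context {R : realType} (d : nat).
Local Notation Z := ('rV[R]_d * measurableTypeR R)%type.
Local Notation mu := (@space_time_measure R d).
Local Notation leb := (@lebesgue_measure R).
Local Notation lebd := (@lebesgue_rV R d).
Implicit Types (z : Z) (j : 'I_d.+1) (k t T : R) (phi : Z -> R).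

Lemma in_halfspace z : (z \in @halfspace R d) = (0 <= z.2).
Proof. by apply/idP/idP; rewrite inE. Qed.

Lemma measurable_halfspace : measurable (@halfspace R d : set Z).
Proof.
have mz : measurable_fun setT (fun z : Z => 0 <= z.2).
  by apply: measurable_fun_ler => //; exact: measurable_snd.
have := mz measurableT [set true] I; rewrite setTI; congr measurable.
Qed.

Variables (f : R -> 'rV[R]_d) (hf : C1_flux f).

Lemma averaged_kruzkovE C (P : Z -> probability R R) j z k :
  {ae P z, forall xi, `|xi| <= C} ->
  averaged_kruzkov f C P j z k = \int[P z]_xi kruzkov f j k xi.
Proof.
have mk (h : R -> R) : measurable_fun setT h ->
    measurable_fun setT (fun xi => (kruzkov f j k (h xi))%:E).
  move=> mh; apply/measurable_EFinP.
  have mp : measurable_fun setT (fun xi : R => (k, h xi)).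
    by apply: measurable_fun_pair => //; exact: measurable_cst.
  exact: (measurableT_comp (measurable_kruzkov hf j) mp).
move=> PC; rewrite /averaged_kruzkov /Rintegral; congr fine.
apply: ae_eq_integral => //.
- by apply: mk; exact: measurable_clamp.
- by apply: mk; exact: measurable_id.
- by move: PC; apply: filterS => xi h _ /=; rewrite clamp_id.
Qed.

Section extension.
Variable nu : 'rV[R]_d * R -> probability R R.

(** Extending the family to negative times makes it measurable over the whole of
    space-time; the Dirac mass at 0 respects every bound on the support. *)
Definition extended_young z : probability R R :=
  if 0 <= z.2 then nu z else dirac_young (fun=> 0) z.

Lemma extended_youngE z : 0 <= z.2 -> extended_young z = nu z.
Proof. by rewrite /extended_young => ->. Qed.

Lemma measurable_extended_young : young_measure (@halfspace R d : set Z) nu ->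
  forall A, measurable A -> measurable_fun setT (fun z => extended_young z A).
Proof.
move=> ynu A mA; have mz : measurable_fun setT (fun z : Z => 0 <= z.2).
  by apply: measurable_fun_ler => //; exact: measurable_snd.
rewrite (_ : (fun z => _) = (fun z => if 0 <= z.2 then nu z A else \d_(0 : R) A)); last first.
  by apply/funext => z; rewrite /extended_young; case: ifP.
apply: measurable_fun_if => //.
  rewrite setTI (_ : _ @^-1` _ = @halfspace R d); last by apply/seteqP; split.
  exact: (young_measure_measurable measurable_halfspace ynu mA).
Qed.

Lemma extended_young_ae C : 0 <= C -> (forall z, halfspace z -> {ae nu z, forall xi, `|xi| <= C}) ->
  forall z, {ae extended_young z, forall xi, `|xi| <= C}.
Proof.
move=> C0 nuC z; rewrite /extended_young; case: ifPn => [z0|_]; first exact: nuC.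
exists [set xi : R | C < `|xi|]; split.
- have mz : measurable_fun setT (fun xi : R => C < `|xi|).
    by apply: measurable_fun_ltr.
  by have := mz measurableT [set true] I; rewrite setTI; congr measurable.
- by rewrite /dirac_young/= diracE memNset//= normr0 => /(le_lt_trans C0); rewrite ltxx.
- by move=> xi /= /negP; rewrite ltNge.
Qed.

End extension.

Section entropy_inequalities.
Variables (C : R) (C0 : 0 <= C) (L : R) (L1 : 1 <= L).
Hypothesis LP : forall j k k' xi, `|k| <= C -> `|k'| <= C -> `|xi| <= C ->
  `|kruzkov f j k xi - kruzkov f j k' xi| <= L * `|k - k'|.

Lemma EMV_kruzkov sigma (nu : 'rV[R]_d * R -> probability R R) k phi :
  EMV_solution f sigma nu ->
  (forall z, halfspace z -> {ae nu z, forall xi, `|xi| <= C}) ->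
  `|k| <= C -> admissible phi ->
  0 <= \int[mu]_z \sum_j 'D_(zdir j) phi z * averaged_kruzkov f C (extended_young nu) j z k.
Proof.
move=> [ynu _ ent] nuC kC phiA; have mnu := measurable_extended_young ynu.
have nuC' := extended_young_ae C0 nuC.
have [tphi phi0 _] := phiA.
have := ent _ _ (kruzkov_entropy_pair hf k) phi tphi (fun z _ => phi0 z).
pose K j z := averaged_kruzkov f C (extended_young nu) j z k.
rewrite (@weak_form_admissible _ _ _ _ _ _ K K (L * (2 * C)))//.
- by move=> j; exact: (measurableT_comp (measurable_averaged_kruzkov hf C mnu j) (measurable_pair2 k)).
- by move=> j; exact: (measurableT_comp (measurable_averaged_kruzkov hf C mnu j) (measurable_pair2 k)).
- by move=> j z; exact: (averaged_kruzkov_bounded hf C0 (extended_young nu) L1 LP j z kC).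
- by apply: aeW.
- move=> z z0; rewrite /K averaged_kruzkovE// extended_youngE//.
  by apply: eq_Rintegral => xi _; rewrite kruzkov0 distrC.
- move=> z i z0; rewrite /K averaged_kruzkovE// extended_youngE// mxE.
  by apply: eq_Rintegral => xi _; rewrite kruzkovS.
Qed.

Lemma entropy_solution_kruzkov u0 (u : 'rV[R]_d * R -> R) k phi :
  entropy_solution f u0 u ->
  measurable_fun setT (u \_ (@halfspace R d) : Z -> R) ->
  {ae mu, forall z, `|(u \_ (@halfspace R d)) z| <= C} ->
  `|k| <= C -> admissible phi ->
  0 <= \int[mu]_z \sum_j 'D_(zdir j) phi z *
         kruzkov f j k (clamp C ((u \_ (@halfspace R d)) z)).
Proof.
move=> [_ ent] mu_ uC kC phiA; have [tphi phi0 _] := phiA.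
have := ent _ _ (kruzkov_entropy_pair hf k) phi tphi (fun z _ => phi0 z).
have mk (v : Z -> R) j : measurable_fun setT v -> measurable_fun setT (fun z => kruzkov f j k (v z)).
  move=> mv; have mp : measurable_fun setT (fun z : Z => (k, v z)).
    by apply: measurable_fun_pair => //; exact: measurable_cst.
  exact: (measurableT_comp (measurable_kruzkov hf j) mp).
pose K j z := kruzkov f j k ((u \_ (@halfspace R d)) z).
pose K' j z := kruzkov f j k (clamp C ((u \_ (@halfspace R d)) z)).
have uE z : 0 <= z.2 -> (u \_ (@halfspace R d)) z = u z.
  by move=> z0; rewrite patchE in_halfspace z0.
rewrite (@weak_form_admissible _ _ _ _ _ _ K K' (L * (2 * C)))//.
- by move=> j; exact: mk.
- by move=> j; apply: mk; exact: (measurableT_comp (measurable_clamp C) mu_).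
- move=> j z; rewrite /K'; set v := clamp C _.
  have vC : `|v| <= C by exact: clamp_le.
  have := LP j kC vC vC; rewrite kruzkov_diag subr0 => h; apply: (le_trans h).
  by rewrite ler_wpM2l ?(le_trans ler01 L1)// (le_trans (ler_normB _ _))// mulr_natl mulr2n lerD.
- by move: uC; apply: filterS => z h j; rewrite /K' clamp_id.
- by move=> z z0; rewrite /K kruzkov0 uE// distrC.
- by move=> z i z0; rewrite /K kruzkovS uE.
Qed.

End entropy_inequalities.
End comparison.

(** * The contraction *)

Section contraction.
Context {R : realType} (d : nat).
Local Notation Z := ('rV[R]_d * measurableTypeR R)%type.
Local Notation mu := (@space_time_measure R d).
Local Notation leb := (@lebesgue_measure R).
Local Notation lebd := (@lebesgue_rV R d).
Implicit Types (z : Z) (j : 'I_d.+1) (k t T : R) (phi : Z -> R).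

Lemma measurable_distance dx (X : measurableType dx) (P : X -> probability R R) (v : X -> R) :
  (forall A, measurable A -> measurable_fun setT (fun x => P x A)) ->
  measurable_fun setT v -> measurable_fun setT (fun x => \int[P x]_xi `|v x - xi|%:E)%E.
Proof.
move=> mP mv; apply: (measurable_integral_family mP (k := fun p : X * R => `|v p.1 - p.2|%:E)).
  apply/measurable_EFinP; apply: measurableT_comp => //; apply: measurable_funB => //.
  exact: (measurableT_comp mv measurable_fst).
by move=> p; rewrite lee_fin.
Qed.

Variables (f : R -> 'rV[R]_d) (hf : C1_flux f).
Variables (sigma : 'rV[R]_d -> probability R R) (u0 : 'rV[R]_d -> R).
Variables (u : 'rV[R]_d * R -> R) (nu : 'rV[R]_d * R -> probability R R).
Hypothesis hu_Loo : (u \_ (@halfspace R d) : Z -> R) \in Lfun mu +oo%E.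
Hypothesis hu : entropy_solution f u0 u.
Hypothesis hnu_bdd : uniformly_bounded (@halfspace R d : set Z) nu.
Hypothesis hnu : EMV_solution f sigma nu.

Local Notation uh := (u \_ (@halfspace R d) : Z -> R).

Definition pointwise_distance z : \bar R :=
  (\int[extended_young nu z]_xi `|uh z - xi|%:E)%E.

Let mu_ : measurable_fun setT uh. Proof. exact: Lfun_measurable hu_Loo. Qed.

Let mnu : forall A, measurable A -> measurable_fun setT (fun z => extended_young nu z A).
Proof. by case: hnu => ynu _ _; exact: measurable_extended_young. Qed.

Lemma measurable_pointwise_distance : measurable_fun setT pointwise_distance.
Proof. exact: (measurable_distance mnu mu_). Qed.

Lemma pointwise_distance_ge0 z : (0 <= pointwise_distance z)%E.
Proof. by apply: integral_ge0 => xi _; rewrite lee_fin. Qed.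

Lemma pointwise_distanceE z : 0 <= z.2 ->
  pointwise_distance z = (\int[nu z]_xi `|u z - xi|%:E)%E.
Proof.
by move=> z0; rewrite /pointwise_distance extended_youngE// patchE in_halfspace z0.
Qed.

Local Notation distance_at t :=
  (L1_dist (fun x => nu (x, t)) (fun x => u (x, t))).

Lemma L1_distE t : 0 <= t -> distance_at t = (\int[lebd]_x pointwise_distance (x, t))%E.
Proof. by move=> t0; apply: eq_integral => x _; rewrite pointwise_distanceE. Qed.

(** The averaged Kruzkov pair, taken at the clamped [u], satisfies the comparison
    inequality.  Its density is the pointwise distance off a null set of space-time,
    hence off a null set of space at almost every time. *)
Lemma distance_decay :
  {ae leb, forall t, 0 < t -> forall T, 0 < T -> T < t ->
    (T%:E * distance_at t <= \int[leb]_(s in `[0%R, T]) distance_at s)%E}.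
Proof.
have [C1 C10 nuC1] := uniformly_bounded_ae hnu_bdd.
have [C2 C20 uC2] := Lfun_infty_bounded hu_Loo.
pose C := Num.max C1 C2; have C0 : 0 <= C by rewrite le_max C10.
have nuC z : halfspace z -> {ae nu z, forall xi, `|xi| <= C}.
  by move=> /nuC1; apply: filterS => xi h; rewrite le_max h.
have uC : {ae mu, forall z, `|uh z| <= C}.
  by move: uC2; apply: filterS => z h; rewrite le_max h orbT.
have [L L1 LP] := kruzkov_lipschitz hf C.
have L0 : 0 <= L by exact: le_trans ler01 L1.
pose ub z := clamp C (uh z).
have mub : measurable_fun setT ub by exact: (measurableT_comp (measurable_clamp C) mu_).
have ubC z : `|ub z| <= C by exact: clamp_le.
have nuC' := extended_young_ae C0 nuC.
pose G j z := averaged_kruzkov f C (extended_young nu) j z (ub z).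
have GB j z : `|G j z| <= L * (2 * C).
  exact: (averaged_kruzkov_bounded hf C0 (extended_young nu) L1 LP j z (ubC z)).
have GL j z : `|G j z| <= L * G ord0 z.
  exact: (averaged_kruzkov_dominated hf C0 (extended_young nu) L1 LP j z (ubC z)).
have G0 z : 0 <= G ord0 z by exact: averaged_kruzkov0_ge0.
have mG j : measurable_fun setT (G j).
  have mp : measurable_fun setT (fun z : Z => (z, ub z)) by exact: measurable_fun_pair.
  exact: (measurableT_comp (measurable_averaged_kruzkov hf C mnu j) mp).
have comparison psi : admissible psi -> 0 <= \int[mu]_z \sum_j 'D_(zdir j) psi z * G j z.
  move=> psiA; apply: (@doubling_of_variables _ _ f hf C C0 (extended_young nu) ub mnu mub ubC) => //.
  - by move=> k phi kC phiA; exact: (EMV_kruzkov hf C0 L1 LP hnu nuC kC phiA).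
  - by move=> k phi kC phiA; exact: (entropy_solution_kruzkov hf C0 L1 LP hu mu_ uC kC phiA).
have GE : {ae mu, forall z, pointwise_distance z = (G ord0 z)%:E}.
  move: uC; apply: filterS => z zC.
  rewrite /G averaged_kruzkovE// /ub clamp_id// /pointwise_distance.
  have mabs : measurable_fun setT (fun xi : R => `|uh z - xi|).
    by apply/measurable_EFinP; exact: measurable_abs_sub.
  have iabs : (extended_young nu z).-integrable setT (EFin \o (fun xi => `|uh z - xi|)).
    apply/integrableP; split; first exact/measurable_EFinP.
    apply: (@le_lt_trans _ _ (\int[extended_young nu z]_xi (2 * C)%:E)%E).
      apply: ae_ge0_le_integral => //.
      - by apply: measurableT_comp => //; exact/measurable_EFinP.
      - by move=> xi _; rewrite lee_fin mulr_ge0.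
      - move: (nuC' z); apply: filterS => xi h _ /=; rewrite lee_fin normr_id.
        by rewrite (le_trans (ler_normB _ _))// mulr_natl mulr2n lerD.
    rewrite integral_cst// [X in (_ * X)%E](_ : _ = 1%E) ?mule1 ?ltry//.
    exact: probability_setT.
  rewrite -[LHS]fineK; last exact: integral_fune_fin_num iabs.
  by congr EFin; apply: eq_Rintegral => xi _; rewrite kruzkov0.
have leb_filter := ae_filter_ringOfSetsType leb.
have tE : {ae leb, forall t, 0 <= t -> distance_at t = total_distance G t}.
  move: (ae_section GE); apply: filterS => t ht t0; rewrite L1_distE//.
  apply: ae_eq_integral => //.
  - exact: (measurableT_comp measurable_pointwise_distance (measurable_pair2 t)).
  - by apply/measurable_EFinP; exact: (measurableT_comp (mG ord0) (measurable_pair2 t)).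
  - by move: ht; apply: filterS => x /= h _.
have mL : measurable_fun setT (fun t => \int[lebd]_x pointwise_distance (x, t))%E.
  exact: (measurable_fun_fubini_tonelli_G (m1 := lebd) _ measurable_pointwise_distance
    pointwise_distance_ge0).
have average T : 0 < T ->
    (\int[leb]_(s in `[0%R, T]) distance_at s = \int[leb]_(s in `[0%R, T]) total_distance G s)%E.
  move=> T0; rewrite [LHS](_ : _ =
      (\int[leb]_(s in `[0%R, T]) \int[lebd]_x pointwise_distance (x, s))%E); last first.
    by apply: eq_integral => s; rewrite inE/= in_itv/= => /andP[s0 _]; exact: L1_distE.
  apply: ae_eq_integral => //.
  - by apply: measurable_funS mL.
  - by apply: measurable_funS (measurable_total_distance mG G0).
  - move: tE; apply: filterS => s hs; rewrite /= in_itv/= => /andP[s0 _].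
    by rewrite -L1_distE// hs.
have decay := total_distance_decay mG GB L0 GL G0 comparison.
move: decay tE; apply: filterS2 => t dt tE' t0 T T0 Tt.
by rewrite average// tE' ?(ltW t0)//; exact: dt.
Qed.

(** Every right neighbourhood of 0 contains some [T] below [t], to which
    [distance_decay] applies. *)
Lemma distance_le_limsup : {ae leb, forall t, 0 < t ->
  (distance_at t <= limf_esup (fun T : R =>
     (T^-1)%:E * \int[leb]_(s in `[0%R, T]) distance_at s) (0%R)^'+)%E}.
Proof.
have leb_filter := ae_filter_ringOfSetsType leb.
move: distance_decay; apply: filterS => t h t0; apply: le_ereal_inf_tmp => _ [V V0 <-].
have [T [[VT T0] Tt]] : exists T, (V T /\ 0 < T) /\ T < t.
  have /filter_ex[T [[VT T0] Tt]] : \forall T \near (0 : R)^'+, (V T /\ 0 < T) /\ T < t.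
    apply: filterI; last exact: nbhs_right_lt.
    by apply: filterI => //; exact: nbhs_right_gt.
  by exists T.
apply: (@le_trans _ _ ((T^-1)%:E * \int[leb]_(s in `[0%R, T]) distance_at s)%E).
  by rewrite lee_pdivlMl//; exact: h.
by apply: ereal_sup_ubound; exists T.
Qed.

End contraction.

Lemma L1_dist_dirac {R : realType} (d : nat) (sigma : 'rV[R]_d -> probability R R)
    (u0 : 'rV[R]_d -> R) : young_measure setT sigma -> measurable_fun setT u0 ->
  {ae lebesgue_rV d, forall x, same_measure (sigma x) (dirac_young u0 x)} ->
  L1_dist sigma u0 = 0%E.
Proof.
move=> ys mu0 su0.
have ms := young_measure_measurable measurableT ys.
have md : measurable_fun setT (fun x => \int[sigma x]_xi `|u0 x - xi|%:E)%E.
  exact: measurable_distance.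
rewrite /L1_dist -[RHS](integral0 (lebesgue_rV d) setT).
apply: ae_eq_integral => //.
move: su0; apply: filterS => x sx _.
rewrite (eq_measure_integral (dirac_young u0 x)); last by move=> A mA _; exact: sx.
rewrite integral_dirac//; last exact: measurable_abs_sub.
by rewrite subrr normr0 diracE mem_setT mul1e.
Qed.

Theorem theorem3p3 (R : realType) (d : nat) (hd : (0 < d)%N)
  (f : R -> 'rV[R]_d) (hf : C1_flux f)
  (u0 : 'rV[R]_d -> R)
  (hu0_L1 : u0 \in Lfun (lebesgue_rV d) 1%E)
  (hu0_Loo : u0 \in Lfun (lebesgue_rV d) +oo%E)
  (sigma : 'rV[R]_d -> probability R R)
  (hsigma : young_measure setT sigma)
  (hsigma_bdd : uniformly_bounded setT sigma)
  (u : 'rV[R]_d * R -> R)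
  (hu_L1 : u \_ (@halfspace R d) \in
     Lfun (lebesgue_rV d \x @lebesgue_measure R)%E 1%E)
  (hu_Loo : u \_ (@halfspace R d) \in
     Lfun (lebesgue_rV d \x @lebesgue_measure R)%E +oo%E)
  (hu : entropy_solution f u0 u)
  (nu : 'rV[R]_d * R -> probability R R)
  (hnu_bdd : uniformly_bounded (@halfspace R d) nu)
  (hnu : EMV_solution f sigma nu)
  (hlimsup :
    (limf_esup (fun T : R =>
        (T^-1)%:E * \int[@lebesgue_measure R]_(t in `[0%R, T])
          L1_dist (fun x => nu (x, t)) (fun x => u (x, t)))
      (0%R)^'+
     <= L1_dist sigma u0)%E) :
  [/\ {ae @lebesgue_measure R, forall t : R, 0 < t ->
        (L1_dist (fun x => nu (x, t)) (fun x => u (x, t))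
           <= L1_dist sigma u0)%E /\
        (W1_L1norm (fun x => nu (x, t)) (dirac_young (fun x => u (x, t)))
           <= W1_L1norm sigma (dirac_young u0))%E},
      forall t : R, 0 < t ->
        ((L1_dist (fun x => nu (x, t)) (fun x => u (x, t))
            <= L1_dist sigma u0)%E <->
         (W1_L1norm (fun x => nu (x, t)) (dirac_young (fun x => u (x, t)))
            <= W1_L1norm sigma (dirac_young u0))%E) &
      {ae lebesgue_rV d, forall x, same_measure (sigma x) (dirac_young u0 x)} ->
      {ae (lebesgue_rV d \x @lebesgue_measure R)%E, forall z, halfspace z ->
        same_measure (nu z) (dirac_young u z)}].
Proof.
have leb_filter := ae_filter_ringOfSetsType (@lebesgue_measure R).
have decay : {ae @lebesgue_measure R, forall t, 0 < t ->
    (L1_dist (fun x => nu (x, t)) (fun x => u (x, t)) <= L1_dist sigma u0)%E}.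
  move: (distance_le_limsup hf hu_Loo hu hnu_bdd hnu); apply: filterS => t h t0.
  exact: (le_trans (h t0) hlimsup).
split.
- move: decay; apply: filterS => t h t0; rewrite !W1_L1norm_dirac; split; exact: h.
- by move=> t t0; rewrite !W1_L1norm_dirac.
move=> sigma_dirac.
have sigma0 := L1_dist_dirac hsigma (Lfun_measurable hu0_Loo) sigma_dirac.
pose W := pointwise_distance u nu.
pose g (z : 'rV[R]_d * measurableTypeR R) : \bar R := if 0 <= z.2 then W z else 0%E.
have mW : measurable_fun setT W := measurable_pointwise_distance hu_Loo hnu.
have mg : measurable_fun setT g.
  apply: measurable_fun_ifT => //; apply: measurable_fun_ler => //; exact: measurable_snd.
have g0 z : (0 <= g z)%E by rewrite /g; case: ifP => // _; exact: pointwise_distance_ge0.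
have t_neq0 : {ae @lebesgue_measure R, forall t, t != 0}.
  exists [set 0]; split; [by []|exact: lebesgue_measure_set1|].
  by move=> t /= /negP; rewrite negbK => /eqP.
(* The time [t = 0] is excluded from the decay, but it is a null set. *)
have g_sections : {ae @lebesgue_measure R, forall t, (\int[lebesgue_rV d]_x g (x, t) = 0)%E}.
  move: decay t_neq0; apply: filterS2 => t h tn0; rewrite /g/=.
  have [t0|_] := leP 0 t; last exact: integral0.
  have tp : 0 < t by rewrite lt_neqAle eq_sym tn0.
  rewrite -(L1_distE u nu t0); apply/eqP; rewrite eq_le -[in X in X && _]sigma0 h//=.
  by apply: integral_ge0 => x _; apply: integral_ge0.
have := ae_product mg g0 g_sections; apply: filterS => z gz z0.
apply: same_measure_dirac; rewrite -pointwise_distanceE//.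
by move: gz; rewrite /g; move: z0; rewrite /halfspace/= => ->.
Qed.
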